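(* Let $\mathbf{L}=\coprod_{k\geq1}\mathbf{L}_k$ be a finitely generated $\mathbb{N}$-graded Lie algebra over a field $\mathbb{F}$ which is generated in degree $1$ and satisfies $\mathbf{h}(\mathbf{L})=1$. Then either $\mathrm{cd}(\mathbf{L})=\infty$ or there exists $k\geq2$ such that $\dim(H^k(\mathbf{L},\mathbb{F}))=\infty$.
   Context: $\mathbb{F}$ is an arbitrary field. An $\mathbb{N}$-graded Lie algebra $\mathbf{L}=\coprod_{k\geq1}\mathbf{L}_k$ satisfies $[\mathbf{L}_n,\mathbf{L}_m]\subseteq\mathbf{L}_{n+m}$. It is generated in degree $1$ if $[\mathbf{L},\mathbf{L}]=\coprod_{k\geq2}\mathbf{L}_k$ (equivalently, $\mathbf{L}_1$ generates $\mathbf{L}$). The entropy is $\mathbf{h}(\mathbf{L})=\limsup_{n\to\infty}\sqrt[n]{\dim(\mathbf{L}_n)}$. $\mathcal{U}(\mathbf{L})$ denotes the universal enveloping algebra, $H^k(\mathbf{L},\mathbb{F})=\mathrm{Ext}^k_{\mathcal{U}(\mathbf{L})}(\mathbb{F},\mathbb{F})$ with $\mathbb{F}$ the trivial module, and $\mathrm{cd}(\mathbf{L})$ is the cohomological dimension, i.e., the minimal $n\geq0$ such that $\mathrm{Ext}^{n+1}_{\mathcal{U}(\mathbf{L})}(\mathbb{F},M)=0$ for all left $\mathcal{U}(\mathbf{L})$-modules $M$, and $\mathrm{cd}(\mathbf{L})=\infty$ if no such $n$ exists. *)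

(* Defs.v *)
From HB Require Import structures.
From mathcomp Require Import all_boot all_order all_algebra.
From mathcomp Require Import finmap.
From mathcomp Require Import all_classical all_reals all_analysis.
From mathcomp Require monalg.
(* The notations of monalg clash with those of mathcomp-analysis. *)
Import -(notations) monalg.

Set Implicit Arguments.
Unset Strict Implicit.
Unset Printing Implicit Defensive.

Import Order.TTheory GRing.Theory Num.Theory.

Local Open Scope classical_set_scope.
Local Open Scope ring_scope.
Local Open Scope quotient_scope.

HB.mixin Record Lmodule_isLie (F : fieldType) L of GRing.Lmodule F L := {
  bracket : L -> L -> L;
  bracket_linearl : forall y, linear (bracket^~ y);
  bracket_linearr : forall x, linear (bracket x);
  bracketxx : forall x, bracket x x = 0;
  jacobi : forall x y z, bracket x (bracket y z) + bracket y (bracket z x)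
                         + bracket z (bracket x y) = 0
}.

#[short(type="lieAlgType")]
HB.structure Definition LieAlgebra (F : fieldType) :=
  {L of GRing.Lmodule F L & Lmodule_isLie F L}.

Section Dimension.
Context (F : fieldType) (V : lmodType F).

Definition is_subspace (W : set V) :=
  W 0 /\ forall a x y, W x -> W y -> W (a *: x + y).

Definition lspan (S : set V) := smallest is_subspace S.

Definition independent_mod (B : set V) n (v : 'I_n -> V) :=
  forall c : 'I_n -> F, B (\sum_i c i *: v i) -> forall i, c i = 0.

(* For subspaces B `<=` Z this is the dimension of Z / B, where all infinite
   cardinals are identified with +oo. *)
Definition quot_dim (R : realType) (Z B : set V) : \bar R :=
  ereal_sup [set n%:R%:E | n in
    [set n | exists v : 'I_n -> V, (forall i, Z (v i)) /\ independent_mod B v]].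

Definition subspace_dim (R : realType) (W : set V) : \bar R :=
  quot_dim R W [set 0].

End Dimension.

Section GradedLieAlgebras.
Context (F : fieldType) (L : lieAlgType F).

Definition is_lie_subalgebra (H : set L) :=
  is_subspace H /\ forall x y, H x -> H y -> H (bracket x y).

Definition finitely_generated :=
  exists s : seq L, smallest is_lie_subalgebra [set` s] = setT.

(* L is the direct sum of the gr k for k >= 1; gr 0 is irrelevant. *)
Record is_grading (gr : nat -> set L) : Prop := {
  grading_subspace : forall k, (1 <= k)%N -> is_subspace (gr k);
  grading_sum : forall x : L, exists n (v : nat -> L),
    (forall k, (1 <= k)%N -> gr k (v k)) /\ x = \sum_(1 <= k < n) v k;
  grading_direct : forall n (v : nat -> L),
    (forall k, (1 <= k)%N -> gr k (v k)) -> \sum_(1 <= k < n) v k = 0 ->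
    forall k, (1 <= k < n)%N -> v k = 0;
  grading_bracket : forall n m x y, (1 <= n)%N -> (1 <= m)%N ->
    gr n x -> gr m y -> gr (n + m)%N (bracket x y)
}.

Definition generated_in_degree1 (gr : nat -> set L) :=
  lspan [set z | exists x y : L, z = bracket x y]
  = lspan (\bigcup_(k in [set k | (2 <= k)%N]) gr k).

Definition entropy (R : realType) (gr : nat -> set L) : \bar R :=
  limn_esup (fun n => poweR (subspace_dim R (gr n)) n%:R^-1).

End GradedLieAlgebras.

Section EnvelopingAlgebra.
Context (F : fieldType) (L : lieAlgType F).

(* The free associative F-algebra on the set L; modulo the relations
   [env_linear] it is the tensor algebra of the vector space L. *)
Let T := malg (fmonom L) F.

Definition letter (x : L) : T := mkmalgU (fmu x) 1.

Variant env_relation : set T :=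
| env_linear a x y :
    env_relation (letter (a *: x + y) - (a *: letter x + letter y))
| env_bracket x y :
    env_relation (letter x * letter y - letter y * letter x
                  - letter (bracket x y)).

Definition is_two_sided_ideal (I : set T) :=
  [/\ I 0, forall s t, I s -> I t -> I (s - t)
    & forall a b t, I t -> I (a * t * b)].

Definition env_ideal : set T := smallest is_two_sided_ideal env_relation.

Lemma env_idealP : is_two_sided_ideal env_ideal.
Proof.
split=> [I [[? ? ?] _]//|s t Is It I HI|a b t It I HI]; have [[I0 IB IM] _] := HI.
  by apply: IB; [exact: Is|exact: It].
by apply: IM; exact: It.
Qed.

Definition env_pred : {pred T} := fun t => `[< env_ideal t >].

Lemma env_pred_zmod : zmod_closed env_pred.
Proof.
have [I0 IB _] := env_idealP.
split=> [|s t /asboolP Is /asboolP It]; apply/asboolP => //; exact: IB.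
Qed.

HB.instance Definition _ := GRing.isZmodClosed.Build T env_pred env_pred_zmod.

Definition uea := Quotient.quot env_pred.
HB.instance Definition _ := EqQuotient.on uea.
HB.instance Definition _ := GRing.Zmodule.on uea.

Definition uea_one : uea := \pi_uea 1.
Definition uea_mul (u v : uea) : uea := \pi_uea (repr u * repr v).

Lemma uea_piE (s t : T) : (\pi_uea s = \pi_uea t) <-> env_ideal (s - t).
Proof.
split=> [/eqP|st].
  by rewrite -Quotient.idealrBE => /asboolP.
by apply/eqP; rewrite -Quotient.idealrBE; apply/asboolP.
Qed.

Lemma uea_repr (s : T) : env_ideal (repr (\pi_uea s) - s).
Proof. by apply/uea_piE; rewrite reprK. Qed.

Lemma uea_piM (s t : T) : uea_mul (\pi_uea s) (\pi_uea t) = \pi_uea (s * t).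
Proof.
apply/uea_piE; have [I0 IB IM] := env_idealP.
have ID x y : env_ideal x -> env_ideal y -> env_ideal (x + y).
  by move=> Ix Iy; rewrite -[y]opprK -[- y]sub0r; apply: (IB) => //; exact: IB.
set s' := repr _; set t' := repr _.
have -> : s' * t' - s * t = 1 * (s' - s) * t' + s * (t' - t) * 1.
  by rewrite mul1r mulr1 mulrBl mulrBr addrA subrK.
by apply: ID; apply: IM; exact: uea_repr.
Qed.

Lemma uea_piD (s t : T) : \pi_uea s + \pi_uea t = \pi_uea (s + t).
Proof. by rewrite -[LHS]Quotient.pi_add. Qed.

Lemma uea_mulA : associative uea_mul.
Proof.
elim/quotW=> r; elim/quotW=> s; elim/quotW=> t.
by rewrite (uea_piM s) (uea_piM r s) (uea_piM r) (uea_piM (r * s)) mulrA.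
Qed.

Lemma uea_mul1 : left_id uea_one uea_mul.
Proof. by elim/quotW=> t; rewrite uea_piM mul1r. Qed.

Lemma uea_mulr1 : right_id uea_one uea_mul.
Proof. by elim/quotW=> t; rewrite uea_piM mulr1. Qed.

Lemma uea_mulDl : left_distributive uea_mul +%R.
Proof.
elim/quotW=> r; elim/quotW=> s; elim/quotW=> t.
rewrite (uea_piM r) (uea_piM s) (uea_piD r) (uea_piD (r * t)).
by rewrite (uea_piM (r + s)) mulrDl.
Qed.

Lemma uea_mulDr : right_distributive uea_mul +%R.
Proof.
elim/quotW=> r; elim/quotW=> s; elim/quotW=> t.
rewrite (uea_piM r s) (uea_piM r t) (uea_piD s) (uea_piD (r * s)).
by rewrite (uea_piM r (s + t)) mulrDr.
Qed.

Lemma mcoeff1M (s t : T) :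
  mcoeff (fmone L) (s * t) = mcoeff (fmone L) s * mcoeff (fmone L) t.
Proof. exact: (mcoeff1g_is_multiplicative (fmonom L) F).1. Qed.

Lemma mcoeff1_ideal (t : T) : env_ideal t -> mcoeff (fmone L) t = 0.
Proof.
move=> /(_ [set t : T | mcoeff (fmone L) t = 0]); apply; split.
  split=> [|s t' /= s0 t0|a b t' /= t0].
  - exact: mcoeff0.
  - by rewrite mcoeffB s0 t0 subr0.
  - by rewrite !mcoeff1M t0 mulr0 mul0r.
have l0 x : mcoeff (fmone L) (letter x) = 0.
  by rewrite mcoeffU -val_eqE /= fmuE fmoneE.
move=> _ [a x y|x y] /=.
  by rewrite mcoeffB mcoeffD mcoeffZ !l0 mulr0 addr0 subrr.
by rewrite !mcoeffB !mcoeff1M !l0 mulr0 !subr0.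
Qed.

(* The ring morphism killing L, i.e. the constant coefficient. *)
Definition augmentation (u : uea) : F := mcoeff (fmone L) (repr u).

Lemma augmentation_pi (t : T) :
  augmentation (\pi_uea t) = mcoeff (fmone L) t.
Proof.
by apply/eqP; rewrite -subr_eq0 -mcoeffB (mcoeff1_ideal (uea_repr t)).
Qed.

Lemma augmentation_is_zmod_morphism : zmod_morphism augmentation.
Proof.
elim/quotW=> s; elim/quotW=> t.
rewrite -[- _]Quotient.pi_opp (uea_piD s) !augmentation_pi.
exact: mcoeffB.
Qed.

HB.instance Definition _ :=
  GRing.isZmodMorphism.Build uea F augmentation augmentation_is_zmod_morphism.

Lemma uea_one_neq0 : uea_one != 0.
Proof.
apply/eqP => /(congr1 augmentation) /eqP.
by rewrite raddf0 augmentation_pi mcoeffUU oner_eq0.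
Qed.

HB.instance Definition _ := GRing.Zmodule_isNzRing.Build uea
  uea_mulA uea_mul1 uea_mulr1 uea_mulDl uea_mulDr uea_one_neq0.

Lemma augmentation_is_monoid_morphism : monoid_morphism augmentation.
Proof.
split; first by rewrite augmentation_pi mcoeffUU.
elim/quotW=> s; elim/quotW=> t; rewrite [_ * _]uea_piM !augmentation_pi.
exact: mcoeff1M.
Qed.

HB.instance Definition _ :=
  GRing.isMonoidMorphism.Build uea F augmentation
    augmentation_is_monoid_morphism.

(* F as the left module on which L acts by zero. *)
Definition trivial_module (_ : lieAlgType F) : Type := F.
HB.instance Definition _ (L' : lieAlgType F) :=
  GRing.Zmodule.copy (trivial_module L') F.
Local Notation triv := (trivial_module L).

Definition trivial_scale (u : uea) (c : triv) : triv :=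
  augmentation u * c.

Lemma trivial_scaleA u v c :
  trivial_scale u (trivial_scale v c) = trivial_scale (u * v) c.
Proof. by rewrite /trivial_scale mulrA -(rmorphM augmentation). Qed.

Lemma trivial_scale1 : left_id 1 trivial_scale.
Proof. by move=> c; rewrite /trivial_scale rmorph1 mul1r. Qed.

Lemma trivial_scaleDr : right_distributive trivial_scale +%R.
Proof. by move=> u c c'; exact: mulrDr. Qed.

Lemma trivial_scaleDl c : {morph trivial_scale^~ c : u v / u + v}.
Proof. by move=> u v; rewrite /trivial_scale raddfD; exact: mulrDl. Qed.

HB.instance Definition _ := GRing.Zmodule_isLmodule.Build uea triv
  trivial_scaleA trivial_scale1 trivial_scaleDr trivial_scaleDl.

End EnvelopingAlgebra.

Section Ext.
Context (A : nzRingType).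

Section FreeCover.
Context (N : lmodType A).

(* The free A-module on the underlying set of N. *)
Definition free_cover := malg N A.
HB.instance Definition _ := GRing.Lmodule.on free_cover.

Definition cover_eval (g : free_cover) : N :=
  \sum_(x <- msupp g) mcoeff x g *: x.

Lemma cover_evalEw (d : {fset N}) (g : free_cover) : (msupp g `<=` d)%fset ->
  cover_eval g = \sum_(x <- d) mcoeff x g *: x.
Proof.
move=> le; rewrite [LHS](big_fset_incl _ le) // => x _ /mcoeff_outdom ->.
by rewrite scale0r.
Qed.

Lemma cover_eval_is_linear : linear cover_eval.
Proof.
move=> a g h; pose d := (msupp g `|` msupp h `|` msupp (a *: g + h)%R)%fset.
rewrite !(@cover_evalEw d);
  try by apply/fsubsetP => x; rewrite /d !in_fsetU => ->; rewrite ?orbT.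
rewrite scaler_sumr -big_split; apply: eq_bigr => x _ /=.
by rewrite mcoeffD mcoeffZ scalerDl scalerA.
Qed.

HB.instance Definition _ :=
  GRing.isLinear.Build A free_cover N *:%R cover_eval cover_eval_is_linear.

Definition cover_ker : {pred free_cover} := fun g => cover_eval g == 0.

Lemma cover_ker_submod : submod_closed cover_ker.
Proof.
split=> [|a g h]; rewrite !unfold_in; first by rewrite raddf0.
by move=> /eqP g0 /eqP h0; rewrite (cover_eval_is_linear a) g0 h0 scaler0 addr0.
Qed.

HB.instance Definition _ :=
  GRing.isSubmodClosed.Build A free_cover cover_ker cover_ker_submod.

Record syzygy := Syzygy { syzygy_val : free_cover;
                          _ : syzygy_val \in cover_ker }.
HB.instance Definition _ := [isSub for syzygy_val].
HB.instance Definition _ := [Choice of syzygy by <:].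
HB.instance Definition _ := [SubChoice_isSubLmodule of syzygy by <:].

End FreeCover.

Context (N : lmodType A).

Fixpoint nth_syzygy n : lmodType A :=
  if n is m.+1 then syzygy (nth_syzygy m) else N.

(* The standard free resolution of N:
     ... -> resolution 1 -> resolution 0 -> N -> 0,
   where resolution n is free on the underlying set of N for n = 0, and of the
   kernel of the preceding arrow for n > 0. *)
Definition resolution n : lmodType A := free_cover (nth_syzygy n).

Definition resolution_diff n (g : resolution n.+1) : resolution n :=
  syzygy_val (cover_eval g : syzygy (nth_syzygy n)).

Lemma cover_eval_surj (M : lmodType A) (x : M) :
  exists g : free_cover M, cover_eval g = x.
Proof.
exists (mkmalgU x 1); rewrite (@cover_evalEw _ [fset x]%fset) ?msuppU_le //.
by rewrite big_seq_fset1 mcoeffUU scale1r.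
Qed.

Lemma resolution_diff_linear n : linear (@resolution_diff n).
Proof.
by move=> a g h; rewrite /resolution_diff (cover_eval_is_linear a).
Qed.

Lemma resolution_exact0 (g : resolution 0) :
  cover_eval g = 0 <-> exists h, @resolution_diff 0 h = g.
Proof.
split=> [/eqP g0|[h <-]]; last by apply/eqP; exact: (valP (cover_eval h)).
by have [h hg] := cover_eval_surj (Syzygy g0); exists h;
rewrite /resolution_diff hg.
Qed.

Lemma resolution_exact n (g : resolution n.+1) :
  resolution_diff g = 0 <-> exists h, @resolution_diff n.+1 h = g.
Proof.
have d0 (f : resolution n.+1) : resolution_diff f = 0 <-> cover_eval f = 0.
  rewrite /resolution_diff; split=> [f0|->]; last by [].
  by apply: val_inj; exact: f0.
split=> [/d0/eqP g0|[h <-]]; last by apply/d0/eqP; exact: (valP (cover_eval h)).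
by have [h hg] := cover_eval_surj (Syzygy g0); exists h;
rewrite /resolution_diff hg.
Qed.

Section Cochains.
Context (M : lmodType A).

Definition cocycles n : set (resolution n -> M) :=
  [set f | linear f /\ forall g, f (@resolution_diff n g) = 0].

Definition coboundaries n : set (resolution n -> M) :=
  match n with
  | 0 => [set f | forall g, f g = 0]
  | m.+1 => [set f | exists2 h : resolution m -> M,
                      linear h & forall g, f g = h (resolution_diff g)]
  end.

(* Ext^n_A(N, M) = cocycles n / coboundaries n; as usual, any other projective
   resolution of N would give an isomorphic group. *)
Definition Ext_eq0 n := @cocycles n `<=` @coboundaries n.

End Cochains.

End Ext.

Arguments cocycles {A} N M n _.
Arguments coboundaries {A} N M n _.

Section Cohomology.
Context (F : fieldType) (L : lieAlgType F) (R : realType).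

Local Notation triv := (trivial_module L).

Definition cd : \bar R :=
  ereal_inf [set n%:R%:E | n in [set n |
    forall M : lmodType (uea L), Ext_eq0 triv M n.+1]].

(* L acts trivially on the coefficients, so that U(L)-linear maps into F form
   an F-subspace of the space of all functions. *)
Definition cohomology_dim n : \bar R :=
  @quot_dim F (resolution triv n -> F^o) R
    (cocycles triv triv n) (coboundaries triv triv n).

End Cohomology.

(* Main.v *)
(** Suppose that [cd L] is finite and that all [H^k(L, F)], [k >= 2], are finite
    dimensional. In the minimal graded free resolution of [F] over [U(L)] the
    rank of the [k]-th module is at most [dim H^k(L, F)], because the standard
    resolution computes the same cohomology and the differential vanishes modulo
    the augmentation ideal; in degree 1 the rank is finite since [L] is finitely
    generated. So this resolution is finite with finite ranks, and the Hilbert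
    series of [U(L)] is [1 / p] for a polynomial [p] with integer coefficients.
    By PBW that series is [\prod_d (1 - X^d)^(- dim L_d)]; its logarithmic
    derivative shows that [s_n = \sum_(d | n) d * dim L_d] is the [n]-th power sum
    of the reciprocal roots of [p]. Entropy 1 makes [s_n] subexponential, so these
    roots have modulus at most 1 and [n * dim L_n <= s_n <= deg p] for all [n].
    Hence [L_n = 0] for large [n] and the entropy is 0, a contradiction. *)

Require Import Defs.
From HB Require Import structures.
From mathcomp Require Import all_boot all_order all_algebra all_field.
From mathcomp Require Import finmap.
From mathcomp Require Import all_classical all_reals all_analysis.
From mathcomp Require Import zify ring.
From mathcomp Require monalg.
Import -(notations) monalg.

Set Implicit Arguments.
Unset Strict Implicit.
Unset Printing Implicit Defensive.

Import Order.TTheory GRing.Theory Num.Theory.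
Local Open Scope classical_set_scope.
Local Open Scope ring_scope.

(** The standard resolution is ungraded and usually of infinite rank, while the Hilbert series needs
    graded modules of finite rank. The two are therefore followed side by side: with each new
    minimal module come chain maps to and from the standard one and a homotopy in one direction,
    just enough to turn functionals on [K / I K] into independent classes, where [K] is the current
    kernel and [I] the augmentation ideal. Only the resulting inequality is used, never an
    isomorphism. The shift of degree matters: generators of the [k]-th kernel are counted by
    [H^(k+1)], so [H^2] and higher control every kernel but the first. That one is [I] itself, where
    brackets die in [I / I^2] and Lie generators give the bound. Vanishing of Ext in degree [n+1]
    leaves the [n]-th kernel without generators, hence zero. All dimensions are natural numbers, so
    the later steps forget the field: the logarithmic derivative becomes a double count of sorted
    words, and the roots live in [algC] whatever the characteristic of [F]. The last obstacle is
    cancellation among roots of equal modulus in a power sum; it is overcome by isolating one root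
    at a time. *)

(** * Linear algebra: free modules, subspaces, finite dimension *)

Section LinearExtension.
Context (K : choiceType) (R : nzRingType) (V : lmodType R) (f : K -> V).

Definition mlin (g : malg K R) : V := \sum_(k <- msupp g) mcoeff k g *: f k.

Lemma mlinEw (d : {fset K}) (g : malg K R) : (msupp g `<=` d)%fset ->
  mlin g = \sum_(k <- d) mcoeff k g *: f k.
Proof.
move=> le; rewrite [LHS](big_fset_incl _ le) // => x _ /mcoeff_outdom ->.
by rewrite scale0r.
Qed.

Lemma mlin_is_linear : linear mlin.
Proof.
move=> a g h; pose d := (msupp g `|` msupp h `|` msupp (a *: g + h)%R)%fset.
rewrite !(@mlinEw d);
  try by apply/fsubsetP => x; rewrite /d !in_fsetU => ->; rewrite ?orbT.
rewrite scaler_sumr -big_split; apply: eq_bigr => x _ /=.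
by rewrite mcoeffD mcoeffZ scalerDl scalerA.
Qed.

HB.instance Definition _ :=
  GRing.isLinear.Build R (malg K R) V *:%R mlin mlin_is_linear.

Lemma mlinU k : mlin (mkmalgU k 1) = f k.
Proof.
by rewrite (@mlinEw [fset k]%fset) ?msuppU_le // big_seq_fset1 mcoeffUU scale1r.
Qed.

End LinearExtension.

Lemma malgZU (K : choiceType) (R : nzRingType) (a : R) (k : K) :
  a *: mkmalgU k 1 = mkmalgU k a.
Proof.
by apply/malgP => k'; rewrite mcoeffZ !mcoeffU; case: eqP => _;
  rewrite ?mulr1n ?mulr1 ?mulr0n ?mulr0.
Qed.

Lemma malg_sumZU (K : choiceType) (R : nzRingType) (g : malg K R) :
  g = \sum_(k <- msupp g) mcoeff k g *: mkmalgU k 1.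
Proof.
by rewrite {1}[g]monalgE; apply: eq_bigr => k _; rewrite malgZU.
Qed.

Lemma malg_linear_ext (K : choiceType) (R : nzRingType) (V : lmodType R)
    (f h : {linear malg K R -> V}) g :
  (forall k, k \in msupp g -> f (mkmalgU k 1) = h (mkmalgU k 1)) -> f g = h g.
Proof.
move=> fh; rewrite (malg_sumZU g) !linear_sum /=.
by rewrite big_seq [RHS]big_seq; apply: eq_bigr => k /fh e; rewrite !linearZ /= e.
Qed.

(** Linearity of the Lie defect in PBW and of the homotopy error between resolutions both reduce to
    this shape. *)
Lemma scaleB3 (R : nzRingType) (V : lmodType R) a (p q r p' q' r' : V) :
  (a *: p + p') - (a *: q + q') - (a *: r + r') =
  a *: (p - q - r) + (p' - q' - r').
Proof. by rewrite !scalerBr !opprD [X in X + _ = _]addrACA [LHS]addrACA. Qed.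

Section LinearFunctions.
Context (R : nzRingType) (U V : lmodType R) (f : U -> V).
Hypothesis f_linear : linear f.
Let f' : {linear U -> V} := HB.pack f (GRing.isLinear.Build R U V *:%R f f_linear).

Lemma linear_fun0 : f 0 = 0.
Proof. exact: (linear0 f'). Qed.

Lemma linear_funZ a u : f (a *: u) = a *: f u.
Proof. by rewrite -[a *: u]addr0 f_linear linear_fun0 addr0. Qed.

Lemma linear_funD u v : f (u + v) = f u + f v.
Proof. exact: (linearD f' u v). Qed.

Lemma linear_funB u v : f (u - v) = f u - f v.
Proof. exact: (linearB f' u v). Qed.

Lemma linear_fun_sum (J : Type) (r : seq J) (P : pred J) (g : J -> U) :
  f (\sum_(j <- r | P j) g j) = \sum_(j <- r | P j) f (g j).
Proof. exact: (linear_sum f'). Qed.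

End LinearFunctions.

Section Subspaces.
Context (F : fieldType).
Implicit Types V : lmodType F.

Lemma subspace0 V (W : set V) : is_subspace W -> W 0.
Proof. by case. Qed.

Lemma subspaceZ V (W : set V) a x : is_subspace W -> W x -> W (a *: x).
Proof. by move=> [W0 WD] Wx; rewrite -[_ *: _]addr0; exact: WD. Qed.

Lemma subspaceD V (W : set V) x y : is_subspace W -> W x -> W y -> W (x + y).
Proof. by move=> [W0 WD] Wx Wy; rewrite -[x]scale1r; exact: WD. Qed.

Lemma subspaceN V (W : set V) x : is_subspace W -> W x -> W (- x).
Proof. by move=> sW Wx; rewrite -scaleN1r; exact: subspaceZ. Qed.

Lemma subspaceB V (W : set V) x y : is_subspace W -> W x -> W y -> W (x - y).
Proof. by move=> sW Wx Wy; apply: subspaceD => //; exact: subspaceN. Qed.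

Lemma subspace_sum V (W : set V) (J : Type) (r : seq J) (P : pred J) (f : J -> V) :
  is_subspace W -> (forall j, P j -> W (f j)) -> W (\sum_(j <- r | P j) f j).
Proof.
move=> sW Wf; elim/big_ind: _ => [|x y|//]; first exact: subspace0.
exact: subspaceD.
Qed.

Lemma subspace_sum_seq V (W : set V) (J : eqType) (r : seq J) (f : J -> V) :
  is_subspace W -> (forall j, j \in r -> W (f j)) -> W (\sum_(j <- r) f j).
Proof.
move=> sW Wf; rewrite big_seq; exact: subspace_sum.
Qed.

Lemma lspan_subspace V (S : set V) : is_subspace (lspan S).
Proof.
split=> [T [[T0 _] _]|a x y Sx Sy T TS]; first exact: T0.
by have [[_ TD] _] := TS; apply: TD; [exact: Sx|exact: Sy].
Qed.

Lemma sub_lspan V (S : set V) : S `<=` lspan S.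
Proof. by move=> x Sx T [_]; exact. Qed.

Lemma lspan_min V (S W : set V) : is_subspace W -> S `<=` W -> lspan S `<=` W.
Proof. by move=> sW SW x; apply. Qed.

Lemma lspan_mono V (S S' : set V) : S `<=` S' -> lspan S `<=` lspan S'.
Proof.
by move=> SS; apply: lspan_min (lspan_subspace _) _ => x /SS; exact: sub_lspan.
Qed.

(* A maximal subspace avoiding [x] is a hyperplane not containing [x]; psi is
   the coordinate along [x]. *)
Lemma separating_functional V (B : set V) (x : V) : is_subspace B -> ~ B x ->
  exists psi : {linear V -> F^o}, (forall b, B b -> psi b = 0) /\ psi x = 1.
Proof.
move=> sB nBx.
pose P := [set W : set V | W = set0 \/ [/\ is_subspace W, B `<=` W & ~ W x]].
have [W [PW Wmax]] : exists W, P W /\ forall W', W `<` W' -> ~ P W'.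
  apply: Zorn_bigcup => C CP tot.
  have [[X [CX X0]]|C0] := pselect (exists X, C X /\ X !=set0); last first.
    left; apply/seteqP; split=> // y [X CX Xy]; apply: C0; exists X.
    by split=> //; exists y.
  have good Y : C Y -> Y !=set0 -> [/\ is_subspace Y, B `<=` Y & ~ Y x].
    by move=> /CP[->[]|].
  have [sX BX _] := good X CX X0.
  right; split=> [|b /BX Xb|[Y CY Yx]]; last 2 first.
  - by exists X.
  - by have [] := good Y CY (ex_intro _ x Yx).
  split=> [|a y z [Y CY Yy] [Z CZ Zz]].
    by exists X => //; exact: subspace0.
  have [YZ|ZY] := tot Y Z CY CZ.
    have [[_ ZD] _ _] := good Z CZ (ex_intro _ z Zz).
    by exists Z => //; apply: ZD => //; exact: YZ.
  have [[_ YD] _ _] := good Y CY (ex_intro _ y Yy).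
  by exists Y => //; apply: YD => //; exact: ZY.
have {PW} [sW BW nWx] : [/\ is_subspace W, B `<=` W & ~ W x].
  case: PW => // W0; exfalso.
  have PB : P B by right; split.
  apply: (Wmax B) PB; rewrite W0; split=> [y []|/(_ 0 (subspace0 sB)) []].
have coordP v : exists c, W (v - c *: x).
  have [Wv|nWv] := pselect (W v); first by exists 0; rewrite scale0r subr0.
  pose W' := [set w | exists a, W (w - a *: v)].
  have WW' : W `<` W'.
    split=> [w Ww|/(_ v)]; first by exists 0; rewrite scale0r subr0.
    move=> /(_ _)/nWv; apply; exists 1; rewrite scale1r subrr; exact: subspace0.
  have nP := Wmax _ WW'.
  have [[a Wa]|nW'x] := pselect (W' x).
    exists a^-1; have a0 : a != 0.
      by apply/eqP => a0; apply: nWx; rewrite -[x]subr0 -(scale0r v) -a0.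
    have -> : v - a^-1 *: x = - a^-1 *: (x - a *: v).
      by rewrite scalerBr scalerA mulNr mulVf// !scaleNr scale1r opprK addrC.
    exact: subspaceZ.
  exfalso; apply: nP; right; split=> //; last by move=> b /BW; exact: WW'.1.
  split; first by exists 0; rewrite scale0r subr0; exact: subspace0.
  move=> a y z [c Wc] [d Wd]; exists (a * c + d).
  rewrite scalerDl opprD addrACA -scalerA -scalerBr.
  by apply: subspaceD => //; exact: subspaceZ.
have uniqc v c d : W (v - c *: x) -> W (v - d *: x) -> c = d.
  move=> Wc Wd; apply/eqP; rewrite -subr_eq0; apply/eqP.
  apply: contra_notP nWx => /eqP cd0.
  have : W ((v - d *: x) - (v - c *: x)) by exact: subspaceB.
  rewrite opprB addrC addrA subrK -scalerBl => /(subspaceZ (c - d)^-1 sW).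
  by rewrite scalerK.
pose psi v : F^o := sval (cid (coordP v)).
have psiP v : W (v - psi v *: x) by exact: svalP (cid (coordP v)).
have psiE v c : W (v - c *: x) -> psi v = c by apply: uniqc.
have lin : linear psi.
  move=> a y z; apply: psiE.
  rewrite scalerDl opprD addrACA -scalerA -scalerBr.
  by apply: subspaceD => //; exact: subspaceZ.
pose m := GRing.isLinear.Build F V F^o *:%R psi lin.
pose psi' : {linear V -> F^o} := HB.pack psi m.
exists psi'; split=> [b Bb|]; apply: psiE; first by rewrite scale0r subr0; exact: BW.
by rewrite scale1r subrr; exact: subspace0.
Qed.
End Subspaces.

Section Dimensions.
Context (F : fieldType).
Implicit Types V : lmodType F.

Lemma is_subspace_set0 V : is_subspace ([set 0] : set V).
Proof. by split=> // a x y /= -> ->; rewrite scaler0 addr0. Qed.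

(** With more vectors than generators, the coefficient matrix has a nonzero left kernel, and its
    rows are relations modulo [B]. *)
Lemma independent_mod_le V (B : set V) m (s : 'I_m -> V) k (v : 'I_k -> V) :
  is_subspace B -> (forall i, exists c : 'I_m -> F, B (v i - \sum_j c j *: s j)) ->
  independent_mod B v -> (k <= m)%N.
Proof.
move=> sB /choice[c cP] indep; rewrite leqNgt; apply/negP => ltmk.
pose C := \matrix_(i < k, j < m) c i j.
have kC : (kermx C != 0).
  rewrite -mxrank_eq0 mxrank_ker -lt0n subn_gt0.
  exact: leq_ltn_trans (rank_leq_col C) ltmk.
have [i [j /eqP nz]] : exists i j, kermx C i j != 0.
  apply: contra_neqP kC => /forallNP nz; apply/matrixP => i j.
  rewrite [RHS]mxE; apply: contra_notP (nz i) => /eqP ?; by exists j.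
apply: nz; apply: (indep (fun j => kermx C i j)).
have -> : \sum_i0 kermx C i i0 *: v i0 =
    \sum_i0 kermx C i i0 *: (v i0 - \sum_j0 c i0 j0 *: s j0).
  rewrite -[LHS]subr0; under [RHS]eq_bigr do rewrite scalerBr.
  rewrite sumrB; congr (_ - _).
  under eq_bigr do rewrite scaler_sumr.
  rewrite exchange_big /= big1 // => j0 _.
  under eq_bigr do rewrite scalerA.
  rewrite -scaler_suml.
  have /matrixP/(_ i j0) := mulmx_ker C; rewrite mxE [RHS]mxE => e.
  rewrite (eq_bigr (fun l => kermx C i l * C l j0)) => [|l _]; last by rewrite [C _ _]mxE.
  by rewrite e scale0r.
by apply: subspace_sum => // l _; exact: subspaceZ.
Qed.

(* Appending [z] to an independent family keeps it independent unless [z] is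
   already in its span modulo [B]. *)
Lemma max_independent V (B Z : set V) N : is_subspace B ->
  (forall k (v : 'I_k -> V), (forall i, Z (v i)) -> independent_mod B v ->
     (k <= N)%N) ->
  exists k (v : 'I_k -> V), [/\ (k <= N)%N, forall i, Z (v i), independent_mod B v &
    forall z, Z z -> exists c : 'I_k -> F, B (z - \sum_i c i *: v i)].
Proof.
move=> sB bnd.
pose P k := `[< exists v : 'I_k -> V, (forall i, Z (v i)) /\ independent_mod B v >].
have P0 : exists k, P k.
  exists 0; apply/asboolP; exists (fun=> 0); split; first by case.
  by move=> c _; case.
have PN k : P k -> (k <= N)%N by move=> /asboolP[v [Zv iv]]; exact: bnd iv.
case: (ex_maxnP P0 PN) => k /[dup] /PN kN /asboolP[v [Zv iv]] kmax.
exists k, v; split=> // z Zz.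
have [//|nc] := pselect (exists c : 'I_k -> F, B (z - \sum_i c i *: v i)).
exfalso; suff /kmax : P k.+1 by rewrite ltnn.
pose w (i : 'I_k.+1) := if unlift ord0 i is Some j then v j else z.
apply/asboolP; exists w; split=> [i|c].
  by rewrite /w; case: unliftP.
rewrite big_ord_recl /w unlift_none.
under eq_bigr do rewrite liftK.
move=> Bc; have c0 : c ord0 = 0.
  apply: contra_notP nc => /eqP c0.
  exists (fun i => - (c ord0)^-1 * c (lift ord0 i)).
  have := subspaceZ (c ord0)^-1 sB Bc.
  rewrite scalerDr scalerK// scaler_sumr -sumrN.
  congr (B (_ + _)); apply: eq_bigr => i _.
  by rewrite scalerA mulNr scaleNr opprK.
move: Bc; rewrite c0 scale0r add0r => /iv cj0 i.
by case: (unliftP ord0 i) => [j ->|->].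
Qed.

(** The [j]-th functional separates [x j] from the sum of [B] and the span of the other [x i]. *)
Lemma dual_functionals V (B : set V) r (x : 'I_r -> V) :
  is_subspace B -> independent_mod B x ->
  exists psi : 'I_r -> {linear V -> F^o}, forall j,
    (forall b, B b -> psi j b = 0) /\ forall i, psi j (x i) = (i == j)%:R.
Proof.
move=> sB ix; suff /choice[psi psiP] : forall j, exists psi : {linear V -> F^o},
    (forall b, B b -> psi b = 0) /\ forall i, psi (x i) = (i == j)%:R by exists psi.
move=> j.
pose Bj := [set b | exists c : 'I_r -> F, c j = 0 /\ B (b - \sum_i c i *: x i)].
have sBj : is_subspace Bj.
  split=> [|a u v [c [cj Bc]] [c' [cj' Bc']]].
    exists (fun=> 0); split=> //; rewrite big1 ?subr0; first exact: subspace0.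
    by move=> i _; rewrite scale0r.
  exists (fun i => a * c i + c' i); split; first by rewrite cj cj' mulr0 addr0.
  have -> : a *: u + v - \sum_i (a * c i + c' i) *: x i =
      a *: (u - \sum_i c i *: x i) + (v - \sum_i c' i *: x i).
    rewrite scalerBr [RHS]addrACA -opprD; congr (_ - _).
    rewrite scaler_sumr -big_split; apply: eq_bigr => i _ /=.
    by rewrite scalerDl scalerA.
  by case: sB => _; apply.
have nBj : ~ Bj (x j).
  move=> [c [cj Bc]].
  have : B (\sum_i (- c i + (i == j)%:R) *: x i).
    have -> : \sum_i (- c i + (i == j)%:R) *: x i = x j - \sum_i c i *: x i.
      under eq_bigr do rewrite scalerDl scaleNr.
      rewrite big_split sumrN /= addrC; congr (_ + _).
      rewrite (bigD1 j)//= eqxx scale1r big1 ?addr0// => i /negPf ->.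
      by rewrite scale0r.
    exact: Bc.
  by move=> /ix /(_ j); rewrite cj eqxx oppr0 add0r => /eqP; rewrite oner_eq0.
have [psi [psi0 psi1]] := separating_functional sBj nBj.
exists psi; split=> [b Bb|i].
  apply: psi0; exists (fun=> 0); split=> //; rewrite big1 ?subr0// => i _.
  by rewrite scale0r.
have [->|ij] := eqVneq i j; first by rewrite psi1.
apply: psi0; exists (fun l => (l == i)%:R); split; first by rewrite eq_sym (negPf ij).
rewrite (bigD1 i)//= eqxx scale1r big1 ?addr0 ?subrr; first exact: subspace0.
by move=> l /negPf ->; rewrite scale0r.
Qed.

(** Hilbert functions have to be sequences of natural numbers, so finite dimension is witnessed by a
    basis; [subspace_dim_fdim] links it to the supremum in the extended reals. *)
Definition fdim V (W : set V) n := exists e : 'I_n -> V,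
  [/\ forall i, W (e i), independent_mod [set 0] e &
      forall x, W x -> exists c : 'I_n -> F, x = \sum_i c i *: e i].

Lemma fdim_le V (W : set V) n m (v : 'I_m -> V) : fdim W n ->
  (forall i, W (v i)) -> independent_mod [set 0] v -> (m <= n)%N.
Proof.
move=> [e [We ie gen]] Wv.
apply: (@independent_mod_le _ _ _ e); first exact: is_subspace_set0.
by move=> i; have [c {1}->] := gen _ (Wv i); exists c; rewrite /= subrr.
Qed.

Lemma fdim_uniq V (W : set V) n m : fdim W n -> fdim W m -> n = m.
Proof.
move=> dn dm; apply/eqP; rewrite eqn_leq.
have [v [Wv iv _]] := dn; have [w [Ww iw _]] := dm.
by rewrite (fdim_le dm Wv iv) (fdim_le dn Ww iw).
Qed.

Lemma fdim_bounded V (W : set V) N :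
  (forall k (v : 'I_k -> V), (forall i, W (v i)) -> independent_mod [set 0] v ->
     (k <= N)%N) -> exists2 n, (n <= N)%N & fdim W n.
Proof.
move=> /(max_independent (@is_subspace_set0 V))[k [v [kN Wv iv gen]]].
exists k => //; exists v; split=> // x /gen[c /= /eqP]; rewrite subr_eq0 => /eqP.
by exists c.
Qed.

Lemma fdim_generated V (W : set V) m (s : 'I_m -> V) :
  (forall x, W x -> exists c : 'I_m -> F, x = \sum_i c i *: s i) ->
  exists2 n, (n <= m)%N & fdim W n.
Proof.
move=> gen; apply: fdim_bounded => k v Wv.
apply: (@independent_mod_le _ _ _ s); first exact: is_subspace_set0.
by move=> i; have [c {1}->] := gen _ (Wv i); exists c; rewrite /= subrr.
Qed.

Lemma fdim_seq V (W : set V) (s : seq V) :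
  W `<=` lspan [set` s] -> exists n, fdim W n.
Proof.
move=> Ws; have [n _ dn] : exists2 n, (n <= size s)%N & fdim W n.
  apply: (@fdim_generated _ _ _ (fun i => s`_i)) => x /Ws.
  move=> /(_ [set x | exists c : 'I_(size s) -> F, x = \sum_i c i *: s`_i]); apply.
  split=> [|y /= ys].
    split=> [|a _ _ [c ->] [d ->]].
      by exists (fun=> 0); rewrite big1// => i _; rewrite scale0r.
    exists (fun i => a * c i + d i); rewrite scaler_sumr -big_split /=.
    by apply: eq_bigr => i _; rewrite scalerDl scalerA.
  have ys' : (index y s < size s)%N by rewrite index_mem.
  exists (fun i => (i == Ordinal ys')%:R).
  rewrite (bigD1 (Ordinal ys'))//= big1 ?addr0 => [|i /negPf->]; last exact: scale0r.
  by rewrite eqxx scale1r nth_index.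
by exists n.
Qed.

Lemma fdim0 V : fdim ([set 0] : set V) 0.
Proof.
exists (fun=> 0); split=> [|c _ []//|x ->]; first by case.
by exists (fun=> 0); rewrite big_ord0.
Qed.

Lemma fdim_eq V (W W' : set V) n : fdim W n -> W `<=` W' -> W' `<=` W -> fdim W' n.
Proof. by move=> dW s1 s2; rewrite -(_ : W = W')//; exact/seteqP. Qed.

Lemma fdim_fin V (W : set V) (J : finType) (e : J -> V) :
  (forall j, W (e j)) ->
  (forall c : J -> F, \sum_j c j *: e j = 0 -> forall j, c j = 0) ->
  (forall x, W x -> exists c : J -> F, x = \sum_j c j *: e j) ->
  fdim W #|J|.
Proof.
have reidx (c : J -> F) : \sum_j c j *: e j =
    \sum_(i < #|J|) c (enum_val i) *: e (enum_val i).
  rewrite (reindex (@enum_val J predT))//=.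
  exact: onW_bij (@enum_val_bij J).
move=> We ie gen; exists (fun i => e (enum_val i)); split=> //.
  move=> c /= c0 i; rewrite -(enum_valK i).
  apply: (ie (fun j => c (enum_rank j))).
  by rewrite reidx -[RHS]c0; apply: eq_bigr => j _; rewrite enum_valK.
by move=> x /gen[c ->]; exists (fun i => c (enum_val i)); exact: reidx.
Qed.

(** A maximal family of [W] independent modulo the kernel maps to a basis of the image; together
    with a basis of the kernel it is a basis of [W]. *)
Lemma rank_nullity V V' (f : {linear V -> V'}) (W : set V) n :
  is_subspace W -> fdim W n -> exists r k,
  [/\ fdim (f @` W) r, fdim (W `&` [set x | f x = 0]) k & (r + k = n)%N].
Proof.
move=> sW dW; pose B := W `&` [set x | f x = 0].
have sB : is_subspace B.
  split=> [|a x y [Wx /= fx] [Wy /= fy]]; split=> /=.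
  - exact: subspace0.
  - exact: linear0.
  - by case: sW => _; apply.
  - by rewrite linearP fx fy scaler0 addr0.
have [k _ dB] : exists2 k, (k <= n)%N & fdim B k.
  apply: fdim_bounded => k v Bv; apply: (fdim_le dW) => i; exact: (Bv i).1.
have [r [v [_ Wv iv gen]]] := max_independent sB (Z := W) (N := n) (fun k v Wv iv =>
  fdim_le dW Wv (fun c (c0 : _ = 0) => iv c (eq_ind_r B (subspace0 sB) c0))).
exists r, k; split=> //.
  exists (fun i => f (v i)); split=> [i|c /=|_ [x Wx <-]].
  - by exists (v i).
  - under eq_bigr do rewrite -linearZ.
    rewrite -linear_sum => fc; apply: iv; split=> //.
    by apply: subspace_sum => // i _; exact: subspaceZ.
  - have [c [_ /=]] := gen _ Wx; exists c.
    move: b; rewrite linearB linear_sum => /eqP; rewrite subr_eq0 => /eqP ->.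
    by apply: eq_bigr => i _; rewrite linearZ.
have [w [Bw iw genw]] := dB.
apply: (@fdim_uniq _ W) dW.
exists (fun i => match fintype.split i with inl a => v a | inr b => w b end).
have sumE (c : 'I_(r + k) -> F) :
    \sum_i c i *: match fintype.split i with inl a => v a | inr b => w b end =
    \sum_i c (lshift k i) *: v i + \sum_i c (rshift r i) *: w i.
  rewrite big_split_ord /=; congr (_ + _); apply: eq_bigr => i _.
    by rewrite -[lshift _ _]/(unsplit (inl i)) unsplitK.
  by rewrite -[rshift _ _]/(unsplit (inr i)) unsplitK.
split=> [i|c /=|x Wx].
- by case: (fintype.split i) => // j; exact: (Bw j).1.
- rewrite sumE => c0.
  have cv0 : forall i, c (lshift k i) = 0.
    apply: (iv (fun i => c (lshift k i))).
    move/eqP: c0; rewrite addr_eq0 => /eqP ->; apply: subspaceN => //.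
    by apply: subspace_sum => // i _; exact: subspaceZ.
  move=> i; rewrite -(splitK i); case: (fintype.split i) => j /=; first exact: cv0.
  apply: (iw (fun j => c (rshift r j))) => /=.
  by rewrite -[RHS]c0 [X in _ = X + _]big1 ?add0r// => l _; rewrite cv0 scale0r.
- have [c /genw[d e]] := gen _ Wx.
  exists (fun i => match fintype.split i with inl a => c a | inr b => d b end).
  rewrite sumE; move/eqP: e; rewrite subr_eq addrC => /eqP ->.
  congr (_ + _); apply: eq_bigr => i _.
    by rewrite -[lshift _ _]/(unsplit (inl i)) unsplitK.
  by rewrite -[rshift _ _]/(unsplit (inr i)) unsplitK.
Qed.

Lemma subspace_dim_fdim V (R : realType) (W : set V) n :
  fdim W n -> subspace_dim R W = n%:R%:E.
Proof.
move=> dW; apply/eqP; rewrite eq_le; apply/andP; split.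
  apply: ub_ereal_sup => _ [k [v [Wv iv]] <-].
  by rewrite lee_fin ler_nat; exact: fdim_le dW Wv iv.
by apply: ereal_sup_ubound; exists n => //; have [v [Wv iv _]] := dW; exists v.
Qed.

End Dimensions.

Section SupportIn.
Context (K : choiceType) (F : fieldType).

Definition supp_in (P : pred K) : set (malg K F) :=
  [set v | forall k, k \in msupp v -> P k].

Lemma supp_inE (P : pred K) v : supp_in P v <-> forall k, ~~ P k -> mcoeff k v = 0.
Proof.
split=> [Pv k nPk|Pv k]; last first.
  by rewrite -mcoeff_neq0; apply: contraR => /Pv ->.
by apply: mcoeff_outdom; apply: contra nPk => /Pv.
Qed.

Lemma supp_in_subspace (P : pred K) : is_subspace (supp_in P).
Proof.
split=> [|a x y /supp_inE Px /supp_inE Py]; apply/supp_inE => k nPk.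
  by rewrite mcoeff0.
by rewrite mcoeffD mcoeffZ Px// Py// mulr0 addr0.
Qed.

Lemma supp_inU (P : pred K) k : P k -> supp_in P (mkmalgU k 1).
Proof. by move=> Pk k' /(fsubsetP msuppU_le); rewrite in_fset1 => /eqP ->. Qed.

Lemma supp_in_le (P Q : pred K) : (forall k, P k -> Q k) -> supp_in P `<=` supp_in Q.
Proof. by move=> PQ v Pv k /Pv /PQ. Qed.

Lemma mlin_mem (V : lmodType F) (W : set V) (f : K -> V) g : is_subspace W ->
  (forall k, k \in msupp g -> W (f k)) -> W (mlin f g).
Proof.
by move=> sW Wf; apply: subspace_sum_seq => // k /Wf; exact: subspaceZ.
Qed.

End SupportIn.

Lemma malg_scaleAr (K : monomType) (R : comNzRingType) (c : R) (s t : malg K R) :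
  c *: (s * t) = s * (c *: t).
Proof.
apply/malgP => k; rewrite mcoeffZ.
rewrite !(@mcoeffMlw _ _ (msupp s) (msupp t))//; last exact: msuppZ_le.
rewrite mulr_sumr; apply: eq_bigr => k1 _; rewrite mulr_sumr.
by apply: eq_bigr => k2 _; rewrite mcoeffZ mulrnAr mulrCA.
Qed.

(** * The universal enveloping algebra *)

Section UeaAlgebra.
Context (F : fieldType) (L : lieAlgType F).
Let T := malg (fmonom L) F.
Local Open Scope quotient_scope.

Lemma env_idealZ c (t : T) : env_ideal t -> env_ideal (c *: t).
Proof.
move=> It; have [_ _ IM] := env_idealP L.
by rewrite -mul_malgC -[_ * _]mulr1; exact: IM.
Qed.

Definition uea_scale (c : F) (u : uea L) : uea L := \pi_(uea L) (c *: repr u).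

Lemma uea_piZ c (t : T) : \pi_(uea L) (c *: t) = uea_scale c (\pi_(uea L) t).
Proof.
apply/esym/uea_piE; rewrite -scalerBr; apply: env_idealZ; exact: uea_repr.
Qed.

Lemma uea_scaleA c d u : uea_scale c (uea_scale d u) = uea_scale (c * d) u.
Proof.
elim/quotW: u => t.
by rewrite -(uea_piZ d t) -(uea_piZ c) -(uea_piZ (c * d)) scalerA.
Qed.

Lemma uea_scale1 : left_id 1 uea_scale.
Proof. by elim/quotW=> t; rewrite -uea_piZ scale1r. Qed.

Lemma uea_scaleDr : right_distributive uea_scale +%R.
Proof.
move=> c; elim/quotW=> s; elim/quotW=> t.
by rewrite (uea_piD s) -(uea_piZ c s) -(uea_piZ c t) -uea_piZ (uea_piD (c *: s)) scalerDr.
Qed.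

Lemma uea_scaleDl u : {morph uea_scale^~ u : c d / c + d}.
Proof.
move=> c d; elim/quotW: u => t.
by rewrite -(uea_piZ c) -(uea_piZ d) -uea_piZ (uea_piD (c *: t)) scalerDl.
Qed.

HB.instance Definition _ := GRing.Zmodule_isLmodule.Build F (uea L)
  uea_scaleA uea_scale1 uea_scaleDr uea_scaleDl.

Lemma uea_scaleAl (c : F) (u v : uea L) : c *: (u * v) = (c *: u) * v.
Proof.
elim/quotW: u => s; elim/quotW: v => t.
rewrite [_ * _]uea_piM /GRing.scale /= -(uea_piZ c s) -uea_piZ [RHS]uea_piM.
by rewrite scalerAl.
Qed.

HB.instance Definition _ := GRing.Lmodule_isLalgebra.Build F (uea L) uea_scaleAl.

Lemma uea_scaleAr (c : F) (u v : uea L) : c *: (u * v) = u * (c *: v).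
Proof.
elim/quotW: u => s; elim/quotW: v => t.
rewrite [_ * _]uea_piM /GRing.scale /= -(uea_piZ c t) -uea_piZ [RHS]uea_piM.
by rewrite malg_scaleAr.
Qed.

HB.instance Definition _ := GRing.Lalgebra_isAlgebra.Build F (uea L) uea_scaleAr.

Lemma pi_is_linear : linear (\pi_(uea L) : T -> uea L).
Proof. by move=> a s t; rewrite -(uea_piD (a *: s)) uea_piZ. Qed.

Definition pi_uea (t : T) : uea L := \pi_(uea L) t.
HB.instance Definition _ :=
  GRing.isLinear.Build F T (uea L) *:%R pi_uea pi_is_linear.

Definition embed (x : L) : uea L := \pi_(uea L) (letter x).

Lemma embed_is_linear : linear embed.
Proof.
move=> a x y; rewrite /embed -pi_is_linear; apply/uea_piE => I [_]; apply.
exact: env_linear.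
Qed.
HB.instance Definition _ := GRing.isLinear.Build F L (uea L) *:%R embed embed_is_linear.

Lemma embed_bracket x y : embed (bracket x y) = embed x * embed y - embed y * embed x.
Proof.
rewrite /embed [_ * _]uea_piM [X in _ - X]uea_piM -[- _]Quotient.pi_opp uea_piD.
apply/esym/uea_piE => I [_]; apply; exact: env_bracket.
Qed.

Lemma letterM (x : L) (m : fmonom L) :
  letter x * mkmalgU m 1 = mkmalgU (mmul (fmu x) m) 1 :> T.
Proof. by rewrite malgM_def fgmulUU mulr1. Qed.

Lemma pi_monomial (m : fmonom L) :
  \pi_(uea L) (mkmalgU m 1) = \prod_(x <- m : seq L) embed x.
Proof.
case: m => s /=; elim: s => [|x s IHs].
  by rewrite big_nil; congr (\pi_(uea L) _); rewrite -fmoneE.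
rewrite big_cons -IHs [RHS]uea_piM; congr (\pi_(uea L) _).
rewrite letterM; congr mkmalgU; apply/eqP; rewrite fmP.
by rewrite fmM fmU.
Qed.

Lemma uea_ind (P : set (uea L)) : is_subspace P ->
  (forall s : seq L, P (\prod_(x <- s) embed x)) -> forall u, P u.
Proof.
move=> sP Pm; elim/quotW => t.
rewrite -[\pi_ _ t]/(pi_uea t) (malg_sumZU t) linear_sum.
apply: subspace_sum => // m _; rewrite linearZ; apply: subspaceZ => //.
by rewrite /= /pi_uea pi_monomial.
Qed.

End UeaAlgebra.

Section Representations.
Context (F : fieldType) (L : lieAlgType F) (V : lmodType F).
Context (A : L -> V -> V) (W : set V).
Hypothesis A_linearl : forall v, linear (A^~ v).
Hypothesis A_linearr : forall x, linear (A x).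
Hypothesis sW : is_subspace W.
Hypothesis AW : forall x v, W v -> W (A x v).
Hypothesis A_rep : forall x y v, W v ->
  A x (A y v) - A y (A x v) - A (bracket x y) v = 0.
Let T := malg (fmonom L) F.

Definition word_action (m : fmonom L) (v : V) : V := foldr A v m.

Definition tensor_action (t : T) (v : V) : V := mlin (word_action^~ v) t.

Lemma word_action_linear m : linear (word_action m).
Proof.
rewrite /word_action; case: m => s /=; elim: s => //= x s IHs a u v.
by rewrite IHs A_linearr.
Qed.

Lemma word_actionW m v : W v -> W (word_action m v).
Proof. by move=> Wv; rewrite /word_action; elim: (m : seq L) => //= x s; exact: AW. Qed.

Lemma tensor_actionW t v : W v -> W (tensor_action t v).
Proof. by move=> Wv; apply: mlin_mem => // m _; exact: word_actionW. Qed.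

Lemma tensor_action_linearr t : linear (tensor_action t).
Proof.
move=> a u v; rewrite /tensor_action /mlin scaler_sumr -big_split /=.
apply: eq_bigr => m _; rewrite word_action_linear scalerDr !scalerA.
by rewrite mulrC.
Qed.

Lemma tensor_actionM s t v :
  tensor_action (s * t) v = tensor_action s (tensor_action t v).
Proof.
pose f1 := fun s : T => tensor_action (s * t) v.
have f1l : linear f1.
  by move=> a x y; rewrite /f1 /tensor_action mulrDl -scalerAl linearP.
pose f1' : {linear T -> V} := HB.pack f1 (GRing.isLinear.Build F T V *:%R f1 f1l).
pose g1 : {linear T -> V} := mlin (word_action^~ (tensor_action t v)).
apply: (@malg_linear_ext _ _ _ f1' g1) => m _.
rewrite /= /f1 /g1 /= mlinU.
pose f2 := fun t : T => tensor_action (mkmalgU m 1 * t) v.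
have f2l : linear f2.
  by move=> a x y; rewrite /f2 /tensor_action mulrDr -malg_scaleAr linearP.
pose f2' : {linear T -> V} := HB.pack f2 (GRing.isLinear.Build F T V *:%R f2 f2l).
pose g2 := fun t : T => word_action m (tensor_action t v).
have g2l : linear g2.
  by move=> a x y; rewrite /g2 /tensor_action linearP word_action_linear.
pose g2' : {linear T -> V} := HB.pack g2 (GRing.isLinear.Build F T V *:%R g2 g2l).
apply: (@malg_linear_ext _ _ _ f2' g2') => m' _.
rewrite /= /f2 /g2 malgM_def fgmulUU mulr1 /tensor_action !mlinU.
by rewrite /word_action fmM foldr_cat.
Qed.

Lemma tensor_action_letter x v : tensor_action (letter x) v = A x v.
Proof. by rewrite /tensor_action mlinU /word_action fmU. Qed.

Lemma tensor_action_linearl v : linear (tensor_action^~ v).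
Proof. by move=> a s t; rewrite /tensor_action linearP. Qed.

Lemma tensor_actionB s t v :
  tensor_action (s - t) v = tensor_action s v - tensor_action t v.
Proof. by rewrite /tensor_action linearB. Qed.

Lemma tensor_action0 t : tensor_action t 0 = 0.
Proof.
have := tensor_action_linearr t (-1) 0 0.
by rewrite scaler0 addr0 scaleN1r addNr.
Qed.

(** The Lie relation is available only on the invariant subspace [W], so annihilation is tested
    there, and stability of [W] gives closure under right multiplication. In PBW [W] is the span of
    the sorted words: insertion is defined on every word, but it is shown to represent the bracket
    only on sorted ones. *)
Lemma env_ideal_action t v : env_ideal t -> W v -> tensor_action t v = 0.
Proof.
move=> It; move: v.
have := It [set t : T | forall v, W v -> tensor_action t v = 0]; apply; split.
  split=> [v _|s u /= s0 u0 v Wv|a b u /= u0 v Wv].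
  - by rewrite /tensor_action linear0.
  - by rewrite tensor_actionB s0// u0// subr0.
  - by rewrite !tensor_actionM u0 ?tensor_action0//; exact: tensor_actionW.
move=> _ [a x y|x y] v Wv.
  rewrite tensor_actionB (tensor_action_linearl _ a) !tensor_action_letter.
  by rewrite A_linearl subrr.
have commutator s u r : tensor_action (s * u - u * s - r) v =
    tensor_action s (tensor_action u v) - tensor_action u (tensor_action s v)
    - tensor_action r v.
  by rewrite (tensor_actionB (_ - _)) (tensor_actionB (s * u)) !tensor_actionM.
rewrite (commutator (letter x)) !tensor_action_letter; exact: A_rep.
Qed.

Definition uea_action (u : uea L) (v : V) : V := tensor_action (repr u) v.

Lemma uea_action_pi t v : W v -> uea_action (pi_uea t) v = tensor_action t v.
Proof.
move=> Wv; apply/eqP; rewrite -subr_eq0 -tensor_actionB; apply/eqP.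
by apply: env_ideal_action => //; exact: uea_repr.
Qed.

Lemma uea_action_linear v : W v -> linear (uea_action^~ v).
Proof.
move=> Wv a; elim/quotW => s; elim/quotW => t.
rewrite -[\pi_(uea L)%qT s]/(pi_uea s) -[\pi_(uea L)%qT t]/(pi_uea t) -linearP.
by rewrite !uea_action_pi// tensor_action_linearl.
Qed.

Lemma uea_action_prod (s : seq L) v : W v ->
  uea_action (\prod_(x <- s) embed x) v = foldr A v s.
Proof.
move=> Wv; rewrite -[s]/(FMonom s : seq L) -pi_monomial uea_action_pi//.
by rewrite /tensor_action mlinU.
Qed.

End Representations.
Arguments embed {F L} x.

(** * The PBW theorem *)

Section LieBracket.
Context (F : fieldType) (L : lieAlgType F).

Lemma bracketC (x y : L) : bracket y x = - bracket x y.
Proof.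
apply/eqP; rewrite -addr_eq0; apply/eqP.
have := bracketxx (x + y).
have Dl u v w : bracket (u + v) w = bracket u w + bracket v w.
  by have := bracket_linearl w 1 u v; rewrite !scale1r.
have Dr u v w : bracket u (v + w) = bracket u v + bracket u w.
  by have := bracket_linearr u 1 v w; rewrite !scale1r.
by rewrite Dl !Dr !bracketxx add0r addr0 addrC.
Qed.

Lemma bracketNr (x y : L) : bracket x (- y) = - bracket x y.
Proof.
have := bracket_linearr x (-1) y 0; rewrite addr0 !scaleN1r => ->.
have := bracket_linearr x (-1) 0 0; rewrite scaler0 addr0.
by rewrite scaleN1r addNr => ->; rewrite addr0.
Qed.

(* The use of the Jacobi identity in PBW: the relation for [[x, y]] on [A t z]
   reduces to those for [[x, t]] and [[y, t]]. *)
Lemma bracket_jacobi (V : zmodType) (A : L -> V -> V) (x y t : L) (z : V) :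
  (forall x, {morph A x : u v / u + v}) ->
  (forall v, {morph A^~ v : x y / x + y}) ->
  A x (A t (A y z)) - A t (A x (A y z)) - A (bracket x t) (A y z) = 0 ->
  A y (A t (A x z)) - A t (A y (A x z)) - A (bracket y t) (A x z) = 0 ->
  (forall u v, A u (A v z) - A v (A u z) - A (bracket u v) z = 0) ->
  A x (A y (A t z)) - A y (A x (A t z)) - A (bracket x y) (A t z) = 0.
Proof.
move=> AD Al; move=> /eqP; rewrite subr_eq0 subr_eq => /eqP h1.
move=> /eqP; rewrite subr_eq0 subr_eq => /eqP h2 h3.
have {h3} e u v : A u (A v z) = A (bracket u v) z + A v (A u z).
  by have /eqP := h3 u v; rewrite subr_eq0 subr_eq => /eqP.
rewrite (e y t) (e x t) !AD h1 h2 (e x (bracket y t)) (e y (bracket x t)).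
rewrite (e (bracket x y) t) (e x y) AD.
have -> : A (bracket x (bracket y t)) z =
    A (bracket y (bracket x t)) z + A (bracket (bracket x y) t) z.
  rewrite -[RHS](Al z); congr (A _ z); apply/eqP; rewrite -subr_eq0; apply/eqP.
  by rewrite -[RHS](jacobi x y t) (bracketC x t) bracketNr
    (bracketC (bracket x y) t) opprD addrA.
apply/eqP; rewrite subr_eq0 subr_eq !addrA; apply/eqP.
by rewrite [LHS](ACl (2*5*1*4*3*6)).
Qed.

End LieBracket.

Section PBW.
Context (F : fieldType) (L : lieAlgType F) (I : countType) (b : I -> L).
Context (co : {linear L -> malg I F}) (deg : I -> nat).
Hypothesis coK : forall x, mlin b (co x) = x.
Hypothesis cob : forall i, co (b i) = mkmalgU i 1.
Hypothesis co_bracket : forall i j k,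
  k \in msupp (co (bracket (b i) (b j))) -> deg k = (deg i + deg j)%N.

(** PBW works for any total order on the basis. The numbering of a countable type supplies one,
    antisymmetric because the numbering is injective. *)
Definition pbw_le (i j : I) := (choice.pickle i <= choice.pickle j)%N.

Lemma pbw_le_total : total pbw_le.
Proof. by move=> i j; exact: leq_total. Qed.

Lemma pbw_le_trans : transitive pbw_le.
Proof. by move=> i j k; exact: leq_trans. Qed.

Lemma pbw_le_anti : antisymmetric pbw_le.
Proof. by move=> i j; rewrite -eqn_leq => /eqP; exact: (pcan_inj choice.pickleK). Qed.

Lemma pbw_leNW i j : ~~ pbw_le i j -> pbw_le j i.
Proof. by move=> nij; have := pbw_le_total i j; rewrite (negPf nij). Qed.

Fixpoint insert (i : I) (w : seq I) :=
  if w is j :: w' then if pbw_le i j then i :: w else j :: insert i w' else [:: i].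

Lemma perm_insert i w : perm_eq (insert i w) (i :: w).
Proof.
elim: w => //= j w IHw; case: ifP => // _.
by rewrite perm_sym (perm_catCA [:: i] [:: j] w) perm_sym /= perm_cons.
Qed.

Lemma insert_path j i w : pbw_le j i -> path pbw_le j w -> path pbw_le j (insert i w).
Proof.
elim: w j => /= [|k w IHw] j ji; first by rewrite ji.
move=> /andP[jk kw]; case: ifP => [ik|/negbT]; first by rewrite /= ji ik.
by move=> /pbw_leNW ki; rewrite /= jk IHw.
Qed.

Lemma insert_sorted i w : sorted pbw_le w -> sorted pbw_le (insert i w).
Proof.
case: w => //= j w jw; case: ifP => [ij|/negbT]; first by rewrite /= ij.
by move=> /pbw_leNW ki; exact: insert_path.
Qed.

Definition weight (w : seq I) := (\sum_(i <- w) deg i)%N.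

Lemma weight_cons i w : weight (i :: w) = (deg i + weight w)%N.
Proof. by rewrite /weight big_cons. Qed.

Lemma weight_insert i w : weight (insert i w) = (deg i + weight w)%N.
Proof. by rewrite -weight_cons; exact: perm_big (perm_insert i w). Qed.

Lemma size_insert i w : size (insert i w) = (size w).+1.
Proof. exact: perm_size (perm_insert i w). Qed.

Let S := malg (seq I) F.
Definition word (w : seq I) : S := mkmalgU w 1.

(* The letter [i] acts on the sorted word [w] as [word (insert i w)] plus a
   combination [lower (size w) i w] of words no longer than [w]; the first
   argument of [lower] is fuel. *)
Fixpoint lower n (i : I) (w : seq I) : S :=
  match n, w with
  | n'.+1, j :: w' =>
    if pbw_le i j then 0 else
    mlin (fun v => word (insert j v) + lower n' j v) (lower n' i w') +
    mlin (fun k => word (insert k w') + lower n' k w') (co (bracket (b i) (b j)))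
  | _, _ => 0
  end.

Definition good (n m : nat) (w : seq I) :=
  [&& sorted pbw_le w, (size w <= n)%N & weight w == m].

Definition act i w : S := word (insert i w) + lower (size w) i w.

(** The length bound drives the later inductions on words; the weight equality, which rests on
    [co_bracket], makes the action graded. *)
Lemma lower_good n i w : sorted pbw_le w ->
  supp_in (good (size w) (deg i + weight w)) (lower n i w).
Proof.
have s0 k m := supp_in_subspace F (good k m).
elim: n i w => [|n IHn] i [|j w] /=; try by move=> *; exact: (subspace0 (s0 _ _)).
case: ifP => [*|_ jw]; first exact: (subspace0 (s0 _ _)).
have sw := path_sorted jw.
apply: (subspaceD (s0 _ _)); apply: (mlin_mem (s0 _ _)).
  move=> v /IHn - /(_ sw) /and3P[sv szv /eqP wv].
  have wE : (deg i + weight (j :: w) = deg j + weight v)%N.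
    by rewrite wv weight_cons addnCA.
  apply: (subspaceD (s0 _ _)).
    apply: supp_inU; rewrite /good insert_sorted// size_insert ltnS szv.
    by rewrite wE weight_insert eqxx.
  move: (IHn j v sv); apply: supp_in_le => u /and3P[su szu /eqP wu].
  by rewrite /good su wu wE eqxx andbT /=; apply: leq_trans szu _; exact: leqW.
move=> k kco; have wE : (deg i + weight (j :: w) = deg k + weight w)%N.
  by rewrite (co_bracket kco) weight_cons addnA.
apply: (subspaceD (s0 _ _)).
  apply: supp_inU; rewrite /good insert_sorted// size_insert.
  by rewrite wE weight_insert ltnSn eqxx.
move: (IHn k w sw); apply: supp_in_le => u /and3P[su szu /eqP wu].
by rewrite /good su wu wE eqxx andbT /=; exact: leqW.
Qed.

Lemma eq_mlin (K : choiceType) (V : lmodType F) (f g : K -> V) (v : malg K F) :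
  (forall k, k \in msupp v -> f k = g k) -> mlin f v = mlin g v.
Proof. by move=> fg; rewrite /mlin big_seq [RHS]big_seq; apply: eq_bigr => k /fg ->. Qed.

(** Every recursive call acts on words no longer than the tail, so fuel [size w] is already enough.
    This lets the inner calls of [lower] be read as [act]. *)
Lemma lower_fuel n m i w : sorted pbw_le w -> (size w <= n)%N -> (n <= m)%N ->
  lower m i w = lower n i w.
Proof.
elim: n m i w => [|n IHn] m i [|j w].
- by case: m.
- by [].
- by case: m.
case: m => [|m]; first by [].
move=> /= jw; rewrite !ltnS => szw nm.
case: (pbw_le i j); [by []|have sw := path_sorted jw].
rewrite (IHn m i w sw szw nm); apply: f_equal2; apply: eq_mlin => v.
  move=> /lower_good - /(_ sw) /and3P[sv szv _].
  by rewrite (IHn m j v sv (leq_trans szv szw) nm).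
by move=> _; rewrite (IHn m v w sw szw nm).
Qed.

Lemma act_good i w : sorted pbw_le w ->
  supp_in (good (size w).+1 (deg i + weight w)) (act i w).
Proof.
move=> sw; apply: (subspaceD (supp_in_subspace F _)).
  apply: supp_inU; rewrite /good insert_sorted// size_insert.
  by rewrite weight_insert leqnn eqxx.
move: (@lower_good (size w) i w sw).
by apply: supp_in_le => u /and3P[su szu wu]; rewrite /good su wu andbT /= leqW.
Qed.

Lemma act_min i w : path pbw_le i w -> act i w = word (i :: w).
Proof. by case: w => [|j w]; rewrite /act /= ?addr0// => /andP[-> _]; rewrite addr0. Qed.

Definition lact i : S -> S := mlin (act i).
HB.instance Definition _ i := GRing.Linear.on (lact i).

Lemma lact_word i w : lact i (word w) = act i w.
Proof. exact: mlinU. Qed.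

Definition Lact (x : L) (v : S) : S := mlin (fun i => lact i v) (co x).

Lemma Lact_linearr x : linear (Lact x).
Proof.
move=> a u v; rewrite /Lact /mlin scaler_sumr -big_split /=; apply: eq_bigr => i _.
by rewrite linearP scalerDr !scalerA mulrC.
Qed.
HB.instance Definition _ x := GRing.isLinear.Build F S S *:%R (Lact x) (Lact_linearr x).

Lemma Lact_linearl v : linear (Lact^~ v).
Proof. by move=> a x y; rewrite /Lact !linearP. Qed.

Lemma Lact_b i v : Lact (b i) v = lact i v.
Proof. by rewrite /Lact cob mlinU. Qed.

(** This is the relation [b i b j = b j b i + [b i, b j]] of the enveloping algebra; the recursion
    of [lower] is designed to force it. *)
Lemma lact_cons i j w : path pbw_le j w -> ~~ pbw_le i j ->
  act i (j :: w) = lact j (act i w) + Lact (bracket (b i) (b j)) (word w).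
Proof.
move=> jw nij; have sw := path_sorted jw.
rewrite {1}/act /= (negPf nij) -act_min; last first.
  by apply: insert_path => //; exact: pbw_leNW.
have -> : act i w = word (insert i w) + lower (size w) i w by [].
rewrite linearD /= lact_word -[RHS]addrA.
apply: f_equal2; [by []|apply: f_equal2].
  apply: eq_mlin => v /lower_good - /(_ sw) /and3P[sv szv _].
  by rewrite /act (lower_fuel j sv (leqnn _) szv).
by apply: eq_mlin => k _; rewrite lact_word.
Qed.

Definition defect x y v := Lact x (Lact y v) - Lact y (Lact x v) - Lact (bracket x y) v.

Lemma defect_linear1 y v : linear (fun x => defect x y v).
Proof.
move=> a x x'; rewrite /defect (bracket_linearl y a) !Lact_linearl.
by rewrite Lact_linearr scaleB3.
Qed.

Lemma defect_linear3 x y : linear (defect x y).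
Proof. by move=> a u v; rewrite /defect !Lact_linearr scaleB3. Qed.

Lemma LactN x v : Lact (- x) v = - Lact x v.
Proof. by rewrite /Lact !linearN. Qed.

Lemma defectC x y v : defect y x v = - defect x y v.
Proof.
by rewrite /defect bracketC LactN opprK [RHS]opprB opprB [RHS]addrC.
Qed.

Lemma defectxx x v : defect x x v = 0.
Proof.
rewrite /defect bracketxx subrr.
have : Lact (0 - 0) v = 0 by rewrite /Lact linearB /= linearB subrr.
by rewrite subrr => ->; rewrite subr0.
Qed.

Lemma LactD x y v : Lact (x + y) v = Lact x v + Lact y v.
Proof. by have := Lact_linearl v 1 x y; rewrite !scale1r. Qed.

Lemma LactDr x : {morph Lact x : u v / u + v}.
Proof. exact: raddfD. Qed.

Lemma defect_jacobi x y t z :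
  defect x t (Lact y z) = 0 -> defect y t (Lact x z) = 0 ->
  (forall u v, defect u v z = 0) -> defect x y (Lact t z) = 0.
Proof. exact: (bracket_jacobi LactDr (fun v x y => LactD x y v)). Qed.

Lemma defect_subspace1 y v : is_subspace [set x | defect x y v = 0].
Proof.
split=> [|a x x' /= dx dx'] /=.
  have := defect_linear1 y v (-1) 0 0.
  by rewrite scaler0 addr0 scaleN1r addNr.
by rewrite (defect_linear1 y v a) dx dx' scaler0 addr0.
Qed.

Lemma defect_subspace3 x y : is_subspace [set v | defect x y v = 0].
Proof.
split=> [|a u v /= du dv] /=.
  have := defect_linear3 x y (-1) 0 0.
  by rewrite scaler0 addr0 scaleN1r addNr.
by rewrite (defect_linear3 x y a) du dv scaler0 addr0.
Qed.

Lemma defect_basis v :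
  (forall i j, defect (b i) (b j) v = 0) -> forall x y, defect x y v = 0.
Proof.
move=> dv x y; rewrite -(coK x).
apply: (mlin_mem (defect_subspace1 y v)) => i _ /=.
rewrite defectC -(coK y) [X in - X](_ : _ = 0) ?oppr0//.
apply: (mlin_mem (defect_subspace1 _ v)) => j _ /=; exact: dv.
Qed.

Lemma mlin_word v : mlin word v = v.
Proof. by rewrite [RHS]malg_sumZU. Qed.

Lemma defect_supp (P : pred (seq I)) x y v :
  (forall w, P w -> defect x y (word w) = 0) -> supp_in P v -> defect x y v = 0.
Proof.
move=> Pd Pv; rewrite -(mlin_word v).
by apply: (mlin_mem (defect_subspace3 x y)) => w /Pv; exact: Pd.
Qed.

(** If [j] can stand in front of [w] and [i] comes after [j], this is [lact_cons]. Otherwise [i] can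
    also stand in front of [w], and antisymmetry of the defect exchanges the roles. *)
Lemma defect_min i j w : path pbw_le j w -> defect (b i) (b j) (word w) = 0.
Proof.
have main k l : ~~ pbw_le k l -> path pbw_le l w -> defect (b k) (b l) (word w) = 0.
  move=> nkl lw; rewrite /defect !Lact_b !lact_word (act_min lw) lact_word.
  rewrite (lact_cons lw nkl); apply/eqP; rewrite subr_eq0 subr_eq.
  by rewrite addrC.
move=> jw; have [ij|nij] := boolP (pbw_le i j); last exact: main.
have [ji|nji] := boolP (pbw_le j i).
  by rewrite (pbw_le_anti (introT andP (conj ij ji))) defectxx.
rewrite defectC main ?oppr0//.
by case: w jw {main} => //= k w /andP[jk ->]; rewrite (pbw_le_trans ij jk).
Qed.

(** Induction on length. The only case beyond [defect_min] is a first letter [k] smaller than both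
    [i] and [j]; then the word is [b k] acting on its tail, and the Jacobi identity trades the pair
    [i, j] for pairs containing [k]. *)
Lemma Lact_rep w x y : sorted pbw_le w -> defect x y (word w) = 0.
Proof.
have [n] := ubnP (size w); elim: n w x y => // n IHn w x y.
rewrite ltnS => szw sw; apply: defect_basis => i j.
case: w sw szw => [|k w] /= sw szw; first exact: defect_min.
have [jk|njk] := boolP (pbw_le j k); first by apply: defect_min; rewrite /= jk.
have [ik|nik] := boolP (pbw_le i k).
  by rewrite defectC defect_min ?oppr0//= ik.
have sw' := path_sorted sw.
have IH v u t : supp_in (fun w' => sorted pbw_le w' && (size w' <= size w)%N) v ->
    defect u t v = 0.
  apply: defect_supp => w' /andP[sw1 szw1]; apply: IHn => //.
  exact: leq_ltn_trans szw1 szw.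
(* Since [k] precedes [l] and all of [w], it can stand in front of [insert l w]; the remaining terms
   are no longer than [w] and fall under the induction hypothesis. *)
have step l m : ~~ pbw_le l k -> defect (b m) (b k) (Lact (b l) (word w)) = 0.
  move=> nlk; rewrite Lact_b lact_word.
  have -> : act l w = word (insert l w) + lower (size w) l w by [].
  apply: (subspaceD (defect_subspace3 _ _)) => /=.
    by apply: defect_min; apply: insert_path => //; exact: pbw_leNW.
  apply: IH; move: (@lower_good (size w) l w sw'); apply: supp_in_le => u.
  by case/and3P => -> ->.
have <- : Lact (b k) (word w) = word (k :: w) by rewrite Lact_b lact_word act_min.
apply: defect_jacobi; [exact: step|exact: step|].
by move=> u v; apply: IH; apply: supp_inU; rewrite sw' leqnn.
Qed.

Definition sorted_span : set S := supp_in (sorted pbw_le).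

Lemma Lact_sorted x v : sorted_span v -> sorted_span (Lact x v).
Proof.
have sS := supp_in_subspace F (sorted pbw_le).
move=> sv; apply: (mlin_mem sS) => i _; apply: (mlin_mem sS) => w /sv sw.
by move: (@act_good i w sw); apply: supp_in_le => u /and3P[].
Qed.

Lemma Lact_rep_sorted x y v : sorted_span v ->
  Lact x (Lact y v) - Lact y (Lact x v) - Lact (bracket x y) v = 0.
Proof. by apply: defect_supp => w; exact: Lact_rep. Qed.

Lemma sorted_word w : sorted pbw_le w -> sorted_span (word w).
Proof. exact: supp_inU. Qed.

(** Acting on the empty word reads off the PBW expansion of [u]: a product of sorted letters
    rebuilds its own word, which gives linear independence of these products. *)
Definition normal_form (u : uea L) : S := uea_action Lact u (word [::]).

Lemma normal_form_linear : linear normal_form.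
Proof.
exact: (uea_action_linear Lact_linearl Lact_linearr (supp_in_subspace _ _)
  Lact_sorted Lact_rep_sorted (@sorted_word [::] isT)).
Qed.

Lemma normal_form_prod (s : seq L) :
  normal_form (\prod_(x <- s) embed x) = foldr Lact (word [::]) s.
Proof.
exact: (uea_action_prod Lact_linearl Lact_linearr (supp_in_subspace _ _)
  Lact_sorted Lact_rep_sorted s (@sorted_word [::] isT)).
Qed.

Lemma normal_form_sorted u : sorted_span (normal_form u).
Proof.
have sS := supp_in_subspace F (sorted pbw_le).
move: u; apply: uea_ind => [|s].
  split=> [|a x y sx sy].
    by rewrite (linear_fun0 normal_form_linear); exact: (subspace0 sS).
  by rewrite (normal_form_linear a); exact: (sS.2 a _ _ sx sy).
rewrite /= normal_form_prod; elim: s => [|x s IHs]; first exact: sorted_word.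
exact: Lact_sorted.
Qed.

Definition word_prod (w : seq I) : uea L := \prod_(i <- w) embed (b i).

Lemma foldr_Lact_word w : sorted pbw_le w ->
  foldr Lact (word [::]) (map b w) = word w.
Proof.
elim: w => //= i w IHw iw.
by rewrite (IHw (path_sorted iw)) Lact_b lact_word act_min.
Qed.

Lemma normal_form_word w : sorted pbw_le w -> normal_form (word_prod w) = word w.
Proof.
move=> sw; rewrite /word_prod -(big_map b predT embed) normal_form_prod.
exact: foldr_Lact_word.
Qed.

Definition of_normal_form : S -> uea L := mlin word_prod.
HB.instance Definition _ := GRing.Linear.on of_normal_form.

Lemma of_normal_form_word w : of_normal_form (word w) = word_prod w.
Proof. exact: mlinU. Qed.

Lemma normal_formK v : sorted_span v -> normal_form (of_normal_form v) = v.
Proof.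
move=> sv; rewrite -[RHS]mlin_word /of_normal_form /mlin.
rewrite (linear_fun_sum normal_form_linear) big_seq [RHS]big_seq; apply: eq_bigr => w /sv sw.
by rewrite (linear_funZ normal_form_linear) normal_form_word.
Qed.

Lemma of_normal_form_mem (P : pred (seq I)) x :
  (forall w, P w -> of_normal_form (Lact x (word w)) =
     embed x * of_normal_form (word w)) ->
  forall v, supp_in P v -> of_normal_form (Lact x v) = embed x * of_normal_form v.
Proof.
move=> Pw v Pv.
have sE : is_subspace [set v | of_normal_form (Lact x v) = embed x * of_normal_form v].
  split=> [|a u u' /= eu eu'] /=; first by rewrite !linear0 mulr0.
  by rewrite (Lact_linearr x a) !(linearP of_normal_form) /= eu eu' mulrDr scalerAr.
by rewrite -(mlin_word v); apply: (mlin_mem sE) => w /Pv; exact: Pw.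
Qed.

Lemma of_normal_form_basis v :
  (forall i, of_normal_form (Lact (b i) v) = embed (b i) * of_normal_form v) ->
  forall x, of_normal_form (Lact x v) = embed x * of_normal_form v.
Proof.
move=> bv x.
have sE : is_subspace [set x | of_normal_form (Lact x v) = embed x * of_normal_form v].
  split=> [|a y y' /= ey ey'] /=.
    by rewrite linear0 mul0r -(linear0 of_normal_form) /Lact !linear0.
  by rewrite Lact_linearl !linearP /= ey ey' mulrDl scalerAl.
by rewrite -(coK x); apply: (mlin_mem sE) => i _; exact: bv.
Qed.

Lemma of_normal_form_min i w : path pbw_le i w ->
  of_normal_form (Lact (b i) (word w)) = embed (b i) * of_normal_form (word w).
Proof.
move=> iw; rewrite Lact_b lact_word act_min// !of_normal_form_word.
by rewrite /word_prod big_cons.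
Qed.

(** The spanning half of PBW: sending words to products intertwines the two actions, by the same
    recursion as in [Lact_rep], so every product of elements of [L] is recovered from its normal
    form. *)
Lemma of_normal_form_act w x : sorted pbw_le w ->
  of_normal_form (Lact x (word w)) = embed x * of_normal_form (word w).
Proof.
have [n] := ubnP (size w); elim: n w x => // n IHn w x.
rewrite ltnS => szw sw; apply: of_normal_form_basis => i.
case: w sw szw => [|j w] /= sw szw; first exact: of_normal_form_min.
have [ij|nij] := boolP (pbw_le i j); first by apply: of_normal_form_min; rewrite /= ij.
have sw' := path_sorted sw.
have IH y v : supp_in (fun w' => sorted pbw_le w' && (size w' <= size w)%N) v ->
    of_normal_form (Lact y v) = embed y * of_normal_form v.
  apply: of_normal_form_mem => w' /andP[sw1 szw1]; apply: IHn => //.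
  exact: leq_ltn_trans szw1 szw.
have IHw y : of_normal_form (Lact y (word w)) = embed y * of_normal_form (word w).
  by apply: IH; apply: supp_inU; rewrite sw' leqnn.
rewrite [in LHS]Lact_b lact_word (lact_cons sw nij) -[lact j _]Lact_b.
rewrite (linearD of_normal_form) /= IHw embed_bracket.
have -> : of_normal_form (Lact (b j) (act i w)) =
    embed (b j) * of_normal_form (act i w).
  have -> : act i w = word (insert i w) + lower (size w) i w by [].
  rewrite !linearD /= mulrDr; apply: f_equal2.
    by apply: of_normal_form_min; apply: insert_path => //; exact: pbw_leNW.
  apply: IH; move: (@lower_good (size w) i w sw'); apply: supp_in_le => u.
  by case/and3P => -> ->.
rewrite -[act i w]lact_word -[lact i _]Lact_b IHw mulrBl !mulrA addrC subrK.
by rewrite !of_normal_form_word /word_prod big_cons mulrA.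
Qed.

Lemma of_normal_formK u : of_normal_form (normal_form u) = u.
Proof.
move: u; apply: uea_ind => [|s].
  split=> [|a x y /= ex ey] /=.
    by rewrite (linear_fun0 normal_form_linear) linear0.
  by rewrite (normal_form_linear a) linearP /= ex ey.
rewrite /= normal_form_prod.
have sf (r : seq L) : sorted_span (foldr Lact (word [::]) r).
  by elim: r => [|x r]; [exact: sorted_word|exact: Lact_sorted].
elim: s => [|x s IHs].
  by rewrite of_normal_form_word /word_prod !big_nil.
rewrite [foldr _ _ _]/= big_cons -IHs.
exact: (of_normal_form_mem (fun w sw => @of_normal_form_act w x sw) (sf s)).
Qed.

End PBW.

(** * The Hilbert series of U(L) *)

Section DivisorSums.
Local Open Scope nat_scope.

Definition divisor_sum (l : nat -> nat) k := \sum_(1 <= d < k.+1 | d %| k) d * l d.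

Lemma sum_multiples (g : nat -> nat) n d : 0 < d ->
  \sum_(1 <= j < n.+1 | j * d <= n) g (j * d) = \sum_(1 <= k < n.+1 | d %| k) g k.
Proof.
move=> d0; rewrite -[RHS]big_filter -[LHS]big_filter -(big_map (muln^~ d) predT g).
apply: perm_big; apply: uniq_perm => [||k].
- rewrite map_inj_uniq ?filter_uniq ?iota_uniq// => i j /eqP.
  by rewrite eqn_pmul2r// => /eqP.
- by rewrite filter_uniq ?iota_uniq.
rewrite mem_filter mem_index_iota; apply/mapP/idP => [[j]|].
  rewrite mem_filter mem_index_iota => /and3P[jd j1 _] ->.
  by rewrite dvdn_mull//= muln_gt0 j1 d0 ltnS.
move=> /and3P[/dvdnP[j ->] k1 kn]; exists j => //.
move: k1 kn; rewrite mem_filter mem_index_iota muln_gt0 !ltnS => /andP[-> _] jn.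
by rewrite jn (leq_trans _ jn)// leq_pmulr.
Qed.

(** Splits a multiplicity [c] into thresholds [j], so that the sum over words can be taken first. *)
Lemma sum_leq_bool c n : c <= n -> \sum_(1 <= j < n.+1) (j <= c) = c.
Proof.
elim: n => [|n IHn]; first by case: c => //; rewrite big_geq.
rewrite leq_eqVlt => /predU1P[->|]; last first.
  by rewrite ltnS => cn; rewrite big_nat_recr//= IHn// leqNgt ltnS cn addn0.
rewrite (eq_big_nat _ _ (F2 := fun=> 1)) => [|j /andP[_]]; last by rewrite ltnS => ->.
by rewrite sum_nat_const_nat subn1 muln1.
Qed.

End DivisorSums.

Section CountingSortedWords.
Local Open Scope nat_scope.
Context (I : countType) (deg : I -> nat) (l : nat -> nat) (Idx : nat -> seq I).
Hypothesis deg_gt0 : forall i, 0 < deg i.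
Hypothesis mem_Idx : forall n i, (i \in Idx n) = (deg i == n).
Hypothesis uniq_Idx : forall n, uniq (Idx n).
Hypothesis size_Idx : forall n, size (Idx n) = l n.

Definition letters_upto n := flatten [seq Idx d | d <- index_iota 1 n.+1].

Lemma mem_letters_upto n i : (i \in letters_upto n) = (deg i <= n).
Proof.
apply/flatten_mapP/idP => [[d]|dn].
  by rewrite mem_index_iota mem_Idx => /andP[_ dn] /eqP ->.
by exists (deg i); rewrite ?mem_index_iota ?mem_Idx ?deg_gt0.
Qed.

Fixpoint words_upto (s : seq I) n : seq (seq I) :=
  if n is n'.+1 then [::] :: [seq i :: w | i <- s, w <- words_upto s n'] else [:: [::]].

Lemma mem_words_upto s n w :
  (size w <= n) -> (forall i, i \in w -> i \in s) -> w \in words_upto s n.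
Proof.
elim: n w => [|n IHn] [|i w] //= szw ws; rewrite inE /=.
apply/allpairsP; exists (i, w); split=> //=; first by apply: ws; rewrite inE eqxx.
by apply: IHn => // j jw; apply: ws; rewrite inE jw orbT.
Qed.

(** Degrees are positive, so letters of degree at most [n] and length at most [n] suffice; [undup]
    makes the size an honest count. *)
Definition sorted_words n : seq (seq I) :=
  undup [seq w <- words_upto (letters_upto n) n |
    sorted (@pbw_le I) w && (weight deg w == n)].

Lemma deg_le_weight i w : i \in w -> deg i <= weight deg w.
Proof. by move=> iw; rewrite /weight (big_rem i)//= leq_addr. Qed.

Lemma size_le_weight w : size w <= weight deg w.
Proof.
elim: w => [|i w IHw]; first by rewrite /weight big_nil.
by rewrite weight_cons /= -add1n leq_add.
Qed.

Lemma mem_sorted_words n w :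
  (w \in sorted_words n) = sorted (@pbw_le I) w && (weight deg w == n).
Proof.
rewrite mem_undup mem_filter; apply: andb_idr => /andP[_ /eqP wn].
apply: mem_words_upto => [|i iw]; first by rewrite -wn size_le_weight.
by rewrite mem_letters_upto -wn deg_le_weight.
Qed.

Lemma sorted_eq_perm (w w' : seq I) : sorted (@pbw_le I) w -> sorted (@pbw_le I) w' ->
  perm_eq w w' -> w = w'.
Proof. exact: sorted_eq (@pbw_le_trans I) (@pbw_le_anti I) _ _. Qed.

Definition pbw_dim n := size (sorted_words n).

Lemma pbw_dim0 : pbw_dim 0 = 1.
Proof.
rewrite /pbw_dim; suff -> : size (sorted_words 0) = size [:: [::] : seq I] by [].
apply: perm_size; apply: uniq_perm => //; first exact: undup_uniq.
move=> w; rewrite mem_sorted_words inE; apply/andP/eqP => [[_ /eqP w0]|-> //].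
  by apply: size0nil; apply/eqP; rewrite -leqn0 -w0 size_le_weight.
by split=> //; rewrite /weight big_nil.
Qed.

Definition mult_count i j n := count (fun w => j <= count_mem i w) (sorted_words n).

(** Inserting one more [i] is a bijection from the words of weight [n - deg i] with at least [j]
    copies of [i] onto those of weight [n] with at least [j + 1]; removing an [i] inverts it. *)
Lemma mult_countS i j n : mult_count i j.+1 n =
  if deg i <= n then mult_count i j (n - deg i) else 0.
Proof.
case: ifPn => din; last first.
  rewrite /mult_count (@eq_in_count _ _ pred0) ?count_pred0// => w.
  rewrite mem_sorted_words => /andP[_ /eqP wn]; apply: contraNF din => iw.
  rewrite -wn; apply: deg_le_weight.
  by rewrite -has_pred1 has_count; exact: leq_trans iw.
rewrite /mult_count -!size_filter -[RHS](size_map (insert i)).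
apply: perm_size; apply: uniq_perm.
- by rewrite filter_uniq ?undup_uniq.
- rewrite map_inj_in_uniq ?filter_uniq ?undup_uniq// => w w'.
  rewrite !mem_filter !mem_sorted_words => /and3P[_ sw _] /and3P[_ sw' _] e.
  apply: sorted_eq_perm => //; rewrite -(perm_cons i).
  by apply: perm_trans (perm_insert i w'); rewrite perm_sym -e perm_insert.
move=> w; rewrite mem_filter mem_sorted_words; apply/idP/mapP.
  move=> /and3P[iw sw /eqP wn].
  have iw' : i \in w by rewrite -has_pred1 has_count; exact: leq_trans iw.
  have pw := perm_to_rem iw'.
  have srem : sorted (@pbw_le I) (rem i w).
    exact: subseq_sorted (@pbw_le_trans I) _ _ (rem_subseq _ _) sw.
  exists (rem i w).
    rewrite mem_filter mem_sorted_words srem -wn.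
    have -> : weight deg w = deg i + weight deg (rem i w).
      by rewrite -weight_cons; exact: perm_big.
    by move: iw; rewrite (permP pw) /= eqxx add1n ltnS addKn eqxx andbT.
  apply: sorted_eq_perm => //; first exact: insert_sorted.
  by rewrite (perm_trans pw)// perm_sym perm_insert.
move=> [w']; rewrite mem_filter mem_sorted_words => /and3P[iw sw /eqP wn] ->.
rewrite insert_sorted// weight_insert wn subnKC// eqxx andbT.
by rewrite (permP (perm_insert i w')) /= eqxx add1n ltnS iw.
Qed.

Lemma mult_countE i j n :
  mult_count i j n = if j * deg i <= n then pbw_dim (n - j * deg i) else 0.
Proof.
elim: j n => [|j IHj] n.
  by rewrite mul0n subn0 /= /mult_count (eq_count (a2 := predT)) ?count_predT.
rewrite mult_countS IHj mulSn; case: (leqP (deg i) n) => din.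
  by rewrite leq_subRL// subnDA.
by rewrite leqNgt (leq_trans din)// leq_addr.
Qed.

Lemma weight_count n w : w \in sorted_words n ->
  weight deg w = \sum_(i <- letters_upto n) deg i * count_mem i w.
Proof.
have uL : uniq (letters_upto n).
  have := iota_uniq 1 (n.+1 - 1).
  rewrite /letters_upto /index_iota; elim: (iota 1 (n.+1 - 1)) => //= d s IHs.
  move=> /andP[ds /IHs us]; rewrite cat_uniq uniq_Idx us andbT /=.
  apply/hasPn => i /flatten_mapP[d' d's]; rewrite !mem_Idx => /eqP ->.
  by apply: contraNN ds => /eqP <-.
rewrite mem_sorted_words => /andP[_ /eqP wn].
have : {subset w <= letters_upto n}.
  by move=> i iw; rewrite mem_letters_upto -wn deg_le_weight.
elim: w {wn} => [|a w IHw] wL.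
  by rewrite /weight big_nil big1// => i _; rewrite muln0.
rewrite weight_cons IHw => [|i iw]; last by apply: wL; rewrite inE iw orbT.
rewrite [RHS](eq_bigr (fun i => deg i * (a == i) + deg i * count_mem i w)); last first.
  by move=> i _; rewrite /= mulnDr.
rewrite big_split /=; congr (_ + _).
have aL : a \in letters_upto n by apply: wL; rewrite inE eqxx.
rewrite (bigD1_seq a)//= eqxx muln1 big1 ?addn0// => i /negPf ia.
by rewrite eq_sym ia muln0.
Qed.

(** The logarithmic derivative of the PBW product, by double counting: the total weight of all
    sorted words of weight [n] is split by letter [i] and by threshold [j] for its multiplicity.
    Each pair contributes [deg i * pbw_dim (n - j * deg i)], and grouping by [k = j * deg i]
    produces the divisor sums. *)
Lemma pbw_dim_rec n :
  n * pbw_dim n = \sum_(1 <= k < n.+1) divisor_sum l k * pbw_dim (n - k).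
Proof.
have -> : n * pbw_dim n = \sum_(w <- sorted_words n) weight deg w.
  rewrite (eq_big_seq (fun=> n)) => [|w]; last first.
    by rewrite mem_sorted_words => /andP[_ /eqP].
  by rewrite big_const_seq count_predT iter_addn_0 mulnC.
rewrite (eq_big_seq _ (@weight_count n)) exchange_big /=.
have -> : \sum_(i <- letters_upto n) \sum_(w <- sorted_words n) deg i * count_mem i w =
    \sum_(i <- letters_upto n) \sum_(1 <= k < n.+1 | deg i %| k) deg i * pbw_dim (n - k).
  rewrite big_seq [RHS]big_seq; apply: eq_bigr => i _; rewrite -!big_distrr /=; congr (_ * _).
  rewrite -(sum_multiples (fun k => pbw_dim (n - k)))//.
  transitivity (\sum_(1 <= j < n.+1) mult_count i j n).
    rewrite (eq_bigr (fun j => \sum_(w <- sorted_words n) (j <= count_mem i w))).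
      rewrite exchange_big /=; apply: eq_big_seq => w.
      rewrite mem_sorted_words => /andP[_ /eqP wn].
      have : count_mem i w <= n by rewrite -wn (leq_trans (count_size _ _)) ?size_le_weight.
      move: (count_mem i w) => c cn.
      by rewrite sum_leq_bool.
    by move=> j _; rewrite /mult_count -sum1_count big_mkcond; apply: eq_bigr => w _; case: ifP.
  by rewrite [RHS]big_mkcond; apply: eq_bigr => j _; exact: mult_countE.
rewrite /letters_upto big_flatten /= big_map.
rewrite (eq_big_nat _ _ (F2 := fun d =>
  \sum_(1 <= k < n.+1 | d %| k) d * l d * pbw_dim (n - k))) => [|d _]; last first.
  rewrite (eq_big_seq (fun=> \sum_(1 <= k < n.+1 | d %| k) d * pbw_dim (n - k))).
    rewrite big_const_seq count_predT iter_addn_0 size_Idx mulnC big_distrr /=.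
    by apply: eq_bigr => k _; rewrite mulnA [l d * d]mulnC.
  by move=> i; rewrite mem_Idx => /eqP ->.
rewrite (exchange_big_dep_nat predT)//=; apply: eq_big_nat => k /andP[k1 kn].
rewrite -big_distrl /=; congr (_ * _); rewrite /divisor_sum.
rewrite (big_cat_nat (n := k.+1))//= [X in _ + X]big_nat_cond [X in _ + X]big1 ?addn0//.
move=> d /andP[/andP[kd _] /(dvdn_leq k1)]; by rewrite leqNgt kd.
Qed.

End CountingSortedWords.

(** The grading enters the resolution only through these properties. Projections are used instead of
    homogeneous subspaces because taking a component is then a total linear map; [cg_0] says that
    degree 0 consists of the scalars and is read off by the augmentation, and [u] is the Hilbert
    function. *)
Record connected_grading (F : fieldType) (A : algType F) (eps : A -> F)
    (pr : nat -> A -> A) (u : nat -> nat) : Prop := ConnectedGrading {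
  cg_linear : forall n, linear (pr n);
  cg_proj : forall m n a, pr m (pr n a) = if m == n then pr n a else 0;
  cg_sum : forall a, exists N, a = \sum_(n < N) pr n a /\
    forall n, (N <= n)%N -> pr n a = 0;
  cg_mul : forall m n a b, pr m a = a -> pr n b = b -> pr (m + n)%N (a * b) = a * b;
  cg_0 : forall a, pr 0 a = (eps a)%:A;
  cg_dim : forall n, fdim [set a | pr n a = a] (u n) }.

Section UeaGrading.
Context (F : fieldType) (L : lieAlgType F) (I : countType) (b : I -> L).
Context (co : {linear L -> malg I F}) (deg : I -> nat) (Idx : nat -> seq I).
Hypothesis coK : forall x, mlin b (co x) = x.
Hypothesis cob : forall i, co (b i) = mkmalgU i 1.
Hypothesis co_bracket : forall i j k,
  k \in msupp (co (bracket (b i) (b j))) -> deg k = (deg i + deg j)%N.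
Hypothesis deg_gt0 : forall i, (0 < deg i)%N.
Hypothesis mem_Idx : forall n i, (i \in Idx n) = (deg i == n).

Let S := malg (seq I) F.
Local Notation nf := (normal_form b co).
Local Notation nf' := (of_normal_form b).

Let nfK := of_normal_formK coK cob co_bracket.
Let nf'K := normal_formK coK cob co_bracket.
Let nfS := normal_form_sorted coK cob co_bracket.

Let nfL : linear nf := normal_form_linear coK cob co_bracket.
Let nf0 := linear_fun0 nfL.
Let nfZ := linear_funZ nfL.

Definition homog (n : nat) : set S := supp_in (fun w => sorted (@pbw_le I) w && (weight deg w == n)).

Lemma homog_subspace n : is_subspace (homog n).
Proof. exact: supp_in_subspace. Qed.

Lemma homog_sorted n : homog n `<=` sorted_span (I := I) (F := F).
Proof. by apply: supp_in_le => w /andP[]. Qed.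

Definition trunc (n : nat) (v : S) : S :=
  \sum_(w <- msupp v | weight deg w == n) mkmalgU w (mcoeff w v).

Lemma mcoeff_trunc n v w :
  mcoeff w (trunc n v) = if weight deg w == n then mcoeff w v else 0.
Proof.
rewrite /trunc (raddf_sum (mcoeff w)) /= big_mkcond /=.
have [wv|/[dup] /mcoeff_outdom wv0 wv] := boolP (w \in msupp v).
  rewrite (bigD1_seq w)//= ?fset_uniq// mcoeffUU big1 ?addr0// => k /negPf kw.
  by case: ifP => // _; rewrite mcoeffU kw.
rewrite wv0 if_same big_seq big1// => k kv; case: ifP => // _.
by rewrite mcoeffU; case: eqP kv wv => // -> ->.
Qed.

Lemma trunc_linear n : linear (trunc n).
Proof.
move=> a v v'; apply/malgP => w.
rewrite mcoeffD mcoeffZ !mcoeff_trunc mcoeffD mcoeffZ.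
by case: ifP => // _; rewrite mulr0 addr0.
Qed.

Lemma trunc_trunc m n v : trunc m (trunc n v) = if m == n then trunc n v else 0.
Proof.
apply/malgP => w; rewrite fun_if mcoeff0 !mcoeff_trunc.
by case: eqP => [->|wm]; case: eqP => // mn; case: eqP => // wn; case: wm; rewrite wn -mn.
Qed.

Lemma trunc_homog n v : sorted_span v -> homog n (trunc n v).
Proof.
move=> /supp_inE sv; apply/supp_inE => w; rewrite mcoeff_trunc.
by case: eqP => // _; rewrite andbT; exact: sv.
Qed.

Lemma trunc_id n v : homog n v -> trunc n v = v.
Proof.
move=> /supp_inE vn; apply/malgP => w; rewrite mcoeff_trunc.
case: ifPn => // wn; rewrite vn//; apply: contraNN wn; by case/andP.
Qed.

Lemma trunc_sum v : exists N, v = \sum_(n < N) trunc n v /\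
  forall n, (N <= n)%N -> trunc n v = 0.
Proof.
pose N := (\max_(w <- msupp v) weight deg w).+1.
have wN w : w \in msupp v -> (weight deg w < N)%N.
  by move=> wv; rewrite ltnS; exact: (leq_bigmax_seq (F := weight deg)).
exists N; split=> [|n Nn]; apply/malgP => w; last first.
  rewrite mcoeff_trunc mcoeff0; case: ifPn => // /eqP wn.
  apply: mcoeff_outdom; apply/negP => /wN; by rewrite wn ltnNge Nn.
rewrite (raddf_sum (mcoeff w)) /=; under eq_bigr do rewrite mcoeff_trunc.
have [wv|/mcoeff_outdom ->] := boolP (w \in msupp v); last first.
  by rewrite big1// => i _; rewrite if_same.
rewrite (bigD1 (Ordinal (wN w wv)))//= eqxx big1 ?addr0// => i.
by rewrite -val_eqE /= eq_sym => /negPf ->.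
Qed.

Definition pbw_proj (n : nat) (u : uea L) : uea L := nf' (trunc n (nf u)).

Lemma nf_pbw_proj n u : nf (pbw_proj n u) = trunc n (nf u).
Proof. by apply: nf'K; apply: homog_sorted; apply: trunc_homog; exact: nfS. Qed.

Lemma pbw_proj_id n u : pbw_proj n u = u <-> homog n (nf u).
Proof.
split=> [<-|un]; last by rewrite /pbw_proj trunc_id ?nfK.
by rewrite nf_pbw_proj; apply: trunc_homog; exact: nfS.
Qed.

Lemma nf_embed x u : nf (embed x * u) = Lact b co x (nf u).
Proof.
have su : sorted_span (Lact b co x (nf u)).
  by apply: Lact_sorted; [exact: co_bracket|exact: nfS].
rewrite -[RHS](nf'K su); congr (nf _); rewrite -{1}(nfK u); apply/esym.
apply: (of_normal_form_mem _ (@nfS u)) => w sw.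
exact: (of_normal_form_act coK cob co_bracket).
Qed.

Lemma Lact_homog i n v : homog n v -> homog (deg i + n) (Lact b co (b i) v).
Proof.
move=> vn; rewrite (Lact_b cob); apply: (mlin_mem (homog_subspace _)) => w.
move=> /vn /andP[sw /eqP <-].
by apply: supp_in_le (act_good co_bracket sw) => w' /and3P[-> _ ->].
Qed.

(** Expanding the left factor in PBW monomials leaves multiplication by one letter at a time, which
    is [Lact] on normal forms and adds its degree. *)
Lemma pbw_proj_mul m n u v : pbw_proj m u = u -> pbw_proj n v = v ->
  pbw_proj (m + n) (u * v) = u * v.
Proof.
move=> /pbw_proj_id um /pbw_proj_id vn; apply/pbw_proj_id.
have sW : is_subspace [set a | homog (m + n) (nf (a * v))].
  split=> [|c a a' /= ha ha'] /=.
    by rewrite mul0r nf0; exact: (homog_subspace _).1.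
  by rewrite mulrDl -scalerAl (nfL c); exact: ((homog_subspace _).2 c _ _ ha ha').
rewrite -(nfK u); apply: (mlin_mem sW) => w /um /andP[_ /eqP <-] /=.
elim: w => [|i w IHw]; first by rewrite /word_prod /weight !big_nil mul1r.
rewrite /word_prod big_cons -mulrA nf_embed weight_cons -addnA.
exact: Lact_homog.
Qed.

Lemma augmentation_embed (x : L) : augmentation (embed x) = 0.
Proof. by rewrite /embed augmentation_pi mcoeffU -val_eqE /= fmuE fmoneE. Qed.

Lemma augmentationZ c (u : uea L) : augmentation (c *: u) = c * augmentation u.
Proof.
elim/quotW: u => t; rewrite /GRing.scale /= -uea_piZ !augmentation_pi.
by rewrite mcoeffZ.
Qed.

Lemma weight_eq0 w : (weight deg w == 0%N) = (w == [::]).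
Proof.
case: w => [|i w]; first by rewrite /weight big_nil eqxx.
by rewrite weight_cons addn_eq0 (gtn_eqF (deg_gt0 i)).
Qed.

Lemma augmentation_nf u : augmentation u = mcoeff [::] (nf u).
Proof.
have sE : is_subspace [set v | augmentation (nf' v) = mcoeff [::] v].
  split=> [|c v v' /= ev ev'] /=; first by rewrite linear0 raddf0 mcoeff0.
  rewrite (linearP (of_normal_form b)) (raddfD (@augmentation F L)) /=.
  by rewrite augmentationZ ev ev' mcoeffD mcoeffZ.
rewrite -{1}(nfK u) -[nf u]mlin_word; apply: (mlin_mem sE) => w _ /=.
rewrite of_normal_form_word /word mcoeffU; case: w => [|i w] /=.
  by rewrite /word_prod big_nil rmorph1.
by rewrite /word_prod big_cons rmorphM /= augmentation_embed mul0r.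
Qed.

Lemma pbw_proj0 u : pbw_proj 0 u = (augmentation u)%:A.
Proof.
rewrite /pbw_proj augmentation_nf.
have -> : trunc 0 (nf u) = mcoeff [::] (nf u) *: word F [::].
  apply/malgP => w; rewrite mcoeff_trunc weight_eq0 mcoeffZ mcoeffU.
  by rewrite eq_sym; case: eqP => [<-|_]; rewrite ?mulr1 ?mulr0.
by rewrite linearZ /= of_normal_form_word /word_prod big_nil.
Qed.

Lemma pbw_proj_dim n : fdim [set u | pbw_proj n u = u] (pbw_dim deg Idx n).
Proof.
pose w_ (i : 'I_(pbw_dim deg Idx n)) := nth [::] (sorted_words deg Idx n) i.
have wP i : sorted (@pbw_le I) (w_ i) && (weight deg (w_ i) == n).
  by rewrite -(mem_sorted_words deg_gt0 mem_Idx) mem_nth.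
have w_inj i j : (w_ i == w_ j) = (i == j).
  by rewrite /w_ nth_uniq// undup_uniq.
have nfw i : nf (word_prod b (w_ i)) = word F (w_ i).
  by case/andP: (wP i) => sw _; rewrite (normal_form_word coK cob co_bracket).
exists (fun i => word_prod b (w_ i)); split=> [i|c c0 j|u /= /pbw_proj_id un].
- by apply/pbw_proj_id; rewrite nfw; exact: supp_inU.
- have := congr1 (fun u => mcoeff (w_ j) (nf u)) (c0 : _ = 0).
  rewrite nf0 mcoeff0 (linear_fun_sum nfL) (raddf_sum (mcoeff (w_ j))) /= => <-.
  have coef i : mcoeff (w_ j) (nf (c i *: word_prod b (w_ i))) = c i * (i == j)%:R.
    by rewrite nfZ nfw mcoeffZ mcoeffU w_inj.
  rewrite (eq_bigr _ (fun i _ => coef i)) (bigD1 j isT) /= eqxx mulr1.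
  by rewrite big1 ?addr0// => i /negPf ->; rewrite mulr0.
- exists (fun i => mcoeff (w_ i) (nf u)).
  rewrite -{1}(nfK u) /of_normal_form.
  rewrite (@mlinEw _ _ _ _ [fset w in sorted_words deg Idx n]%fset); last first.
    apply/fsubsetP => w /un; rewrite -(mem_sorted_words deg_gt0 mem_Idx).
    by rewrite in_fset.
  transitivity (\sum_(w <- sorted_words deg Idx n) mcoeff w (nf u) *: word_prod b w).
    apply: perm_big; apply: uniq_perm; [exact: fset_uniq|exact: undup_uniq|].
    by move=> w; rewrite in_fset.
  by rewrite (big_nth [::]) big_mkord.
Qed.

Theorem uea_connected_grading :
  connected_grading (@augmentation F L) pbw_proj (pbw_dim deg Idx).
Proof.
split.
- move=> n a u v; rewrite /pbw_proj (nfL a).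
  by rewrite trunc_linear linearP.
- move=> m n u; rewrite {1}/pbw_proj nf_pbw_proj trunc_trunc.
  by case: ifP => // _; rewrite linear0.
- move=> u; have [N [uN u0]] := trunc_sum (nf u).
  exists N; split=> [|n /u0 e]; last by rewrite /pbw_proj e linear0.
  by rewrite -{1}(nfK u) uN linear_sum.
- exact: pbw_proj_mul.
- exact: pbw_proj0.
- exact: pbw_proj_dim.
Qed.

End UeaGrading.

(** * Comparison with the standard resolution *)

Section Lifting.
Context (A : nzRingType) (X Y : lmodType A) (D : {linear X -> Y}).

Lemma row_scale_sum m (p : 'rV[A]_m) : p = \sum_i p 0 i *: delta_mx 0 i.
Proof. exact: row_sum_delta. Qed.

Definition row_comb m (x : 'I_m -> X) (p : 'rV[A]_m) : X := \sum_i p 0 i *: x i.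

Lemma row_comb_linear m (x : 'I_m -> X) : linear (row_comb x).
Proof.
move=> a p q; rewrite /row_comb scaler_sumr -big_split; apply: eq_bigr => i _ /=.
by rewrite !mxE scalerDl scalerA.
Qed.
HB.instance Definition _ m x :=
  GRing.isLinear.Build A 'rV[A]_m X *:%R (@row_comb m x) (row_comb_linear x).

Lemma linear_row m (f : {linear 'rV[A]_m -> Y}) p :
  f p = \sum_i p 0 i *: f (delta_mx 0 i).
Proof. by rewrite {1}[p]row_scale_sum linear_sum; apply: eq_bigr => i _; rewrite linearZ. Qed.

Lemma lift_row m (f : {linear 'rV[A]_m -> Y}) :
  (forall i, exists x, D x = f (delta_mx 0 i)) ->
  exists g : {linear 'rV[A]_m -> X}, forall p, D (g p) = f p.
Proof.
move=> /choice[x Dx]; exists (row_comb x) => p.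
by rewrite (linear_row f) linear_sum; apply: eq_bigr => i _; rewrite linearZ /= Dx.
Qed.

Lemma lift_malg (K : choiceType) (f : {linear malg K A -> Y}) :
  (forall k, exists x, D x = f (mkmalgU k 1)) ->
  exists g : {linear malg K A -> X}, forall p, D (g p) = f p.
Proof.
move=> /choice[x Dx]; exists (mlin x) => p.
by apply: (malg_linear_ext (f := D \o mlin x)) => k _ /=; rewrite mlinU.
Qed.

End Lifting.

Section Comparison.
Context (A : nzRingType) (N : lmodType A).

HB.instance Definition _ n := GRing.isLinear.Build A (resolution N n.+1) (resolution N n)
  *:%R (@resolution_diff A N n) (@resolution_diff_linear A N n).

Lemma resolution_diff_surj n (g : resolution N n) :
  cover_eval g = 0 -> exists h, @resolution_diff A N n h = g.
Proof.
move=> /eqP g0; have [h hg] := cover_eval_surj (Syzygy g0); exists h.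
by rewrite /resolution_diff hg.
Qed.

Lemma cover_eval_diff n (g : resolution N n.+1) : cover_eval (resolution_diff g) = 0.
Proof. by apply/eqP; exact: (valP (cover_eval g)). Qed.

Lemma resolution_diff_eq0 n (g : resolution N n.+1) :
  resolution_diff g = 0 <-> cover_eval g = 0.
Proof. by split=> [g0|g0]; [exact: val_inj|rewrite /resolution_diff g0]. Qed.

(* Chain maps [f], [g] between a free complex and the standard resolution, in
   degree [k], with the part of the homotopy from [g \o f] to the identity
   needed to continue. *)
Definition comparison k m (Pm : lmodType A) (d : {linear 'rV[A]_m -> Pm}) :=
  exists (f : {linear 'rV[A]_m -> resolution N k})
         (g : {linear resolution N k -> 'rV[A]_m}) (h : {linear Pm -> 'rV[A]_m}),
  [/\ forall q, cover_eval q = 0 -> d (g q) = 0,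
      forall p, d p = 0 -> cover_eval (f p) = 0 &
      forall p, d (p - g (f p) - h (d p)) = 0].

Lemma comparison0 m (d : {linear 'rV[A]_m -> N}) : (forall x, exists p, d p = x) ->
  comparison 0 d.
Proof.
move=> dsurj.
pose ev : {linear free_cover N -> N} := @cover_eval A N.
have [f fE] := lift_row (D := ev) (f := d) (fun i => cover_eval_surj _).
have [g gE] := lift_malg (D := d) (f := ev) (fun k => dsurj _).
exists f, g, \0; split=> [q q0|p p0|p].
- by rewrite gE.
- by rewrite fE.
- by rewrite /= subr0 linearB gE /= fE subrr.
Qed.

(** The usual inductive construction of chain maps and homotopy. Both resolutions have free modules,
    so all three liftings are made on basis vectors, and exactness supplies the preimages. *)
Lemma comparisonS k m (Pm : lmodType A) (d : {linear 'rV[A]_m -> Pm})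
    m' (d' : {linear 'rV[A]_m' -> 'rV[A]_m}) :
  (forall p, d (d' p) = 0) -> (forall p, d p = 0 -> exists p', d' p' = p) ->
  comparison k d -> comparison k.+1 d'.
Proof.
move=> dd' exact_d [f [g [h [gP fP hP]]]].
have [f' f'E] : exists f' : {linear 'rV[A]_m' -> resolution N k.+1},
    forall p, resolution_diff (f' p) = f (d' p).
  apply: (lift_row (D := @resolution_diff A N k) (f := f \o d')) => i /=.
  by apply: resolution_diff_surj; exact: fP.
have [g' g'E] : exists g' : {linear resolution N k.+1 -> 'rV[A]_m'},
    forall q, d' (g' q) = g (resolution_diff q).
  apply: (lift_malg (D := d') (f := g \o @resolution_diff A N k)) => x /=.
  by apply: exact_d; apply: gP; exact: cover_eval_diff.
(* The error of the homotopy so far lies in the kernel of [d], that is, in the image of [d']; a lift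
   of it is the next homotopy. *)
pose th p := p - g (f p) - h (d p).
have th_lin : linear th.
  move=> a p q; by rewrite /th (linearP f) (linearP g) (linearP d) (linearP h) scaleB3.
pose th' : {linear 'rV[A]_m -> 'rV[A]_m} :=
  HB.pack th (GRing.isLinear.Build A _ _ *:%R th th_lin).
have [h' h'E] : exists h' : {linear 'rV[A]_m -> 'rV[A]_m'},
    forall p, d' (h' p) = th p.
  apply: (lift_row (D := d') (f := th')) => i /=.
  by apply: exact_d; exact: hP.
exists f', g', h'; split=> [q q0|p p0|p].
- by rewrite g'E (proj2 (resolution_diff_eq0 q) q0) linear0.
- by apply/resolution_diff_eq0; rewrite f'E p0 linear0.
- rewrite !linearB h'E g'E f'E /th /= dd' linear0 subr0.
  by rewrite subrr.
Qed.

End Comparison.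

(** Scalars of [F] act through [c%:A]. The synonym keeps the structure over [F] apart from the one
    over [A] on the same carrier. *)
Definition restr (F : fieldType) (A : algType F) (V : lmodType A) : Type := V.

Section RestrictionOfScalars.
Context (F : fieldType) (A : algType F) (V : lmodType A).

HB.instance Definition _ := GRing.Zmodule.on (restr V).

Definition restr_scale (c : F) (v : restr V) : restr V := (c%:A : A) *: (v : V).

Lemma restr_scaleA c d v : restr_scale c (restr_scale d v) = restr_scale (c * d) v.
Proof. by rewrite /restr_scale scalerA -scalerAl mul1r scalerA. Qed.

Lemma restr_scale1 : left_id 1 restr_scale.
Proof. by move=> v; rewrite /restr_scale !scale1r. Qed.

Lemma restr_scaleDr : right_distributive restr_scale +%R.
Proof. by move=> c u v; exact: scalerDr. Qed.

Lemma restr_scaleDl v : {morph restr_scale^~ v : c d / c + d}.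
Proof. by move=> c d; rewrite /restr_scale scalerDl; exact: scalerDl. Qed.

HB.instance Definition _ := GRing.Zmodule_isLmodule.Build F (restr V)
  restr_scaleA restr_scale1 restr_scaleDr restr_scaleDl.

Lemma restrZ (c : F) (v : restr V) : c *: v = (c%:A : A) *: (v : V).
Proof. by []. Qed.

End RestrictionOfScalars.

Section CohomologyBound.
Context (F : fieldType) (L : lieAlgType F).
Let A : algType F := uea L.
Local Notation triv := (trivial_module L).
Local Notation eps := (@augmentation F L).

Lemma augmentationA (c : F) : eps (c%:A) = c.
Proof.
have -> : (c%:A : uea L) = pi_uea (c *: 1) by rewrite linearZ.
by rewrite augmentation_pi mcoeffZ mcoeff1 eqxx mulr1.
Qed.

(** This is [I K] for the augmentation ideal [I], so that [K / I K] is the space of minimal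
    generators of [K]. *)
Definition aug_sub (V : lmodType A) (K : set V) : set (restr V) :=
  @lspan F (restr V) [set z : restr V | exists a (k : V), [/\ eps a = 0, K k & z = a *: k]].

(** Since [a - eps a] lies in [I], a functional killing [I K] is linear over the enveloping algebra
    on [K], with values in the trivial module. *)
Lemma aug_sub_functional (V : lmodType A) (K : set V) (psi : {linear restr V -> F^o}) :
  (forall b, aug_sub K b -> psi b = 0) ->
  forall a x, K x -> psi (a *: x) = eps a * psi x.
Proof.
move=> psi0 a x Kx.
have : psi ((a - (eps a)%:A) *: x) = 0.
  apply: psi0; apply: sub_lspan; exists (a - (eps a)%:A), x; split=> //.
  by rewrite raddfB /= augmentationA subrr.
rewrite scalerBl => /eqP.
rewrite (raddfB psi) /= subr_eq0 => /eqP ->.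
exact: (linear_funZ (linearP psi) (eps a) x).
Qed.

(** Pulling [psi] back along [g] after the differential gives a cocycle one degree higher. If it is
    a coboundary, then on the kernel of [d] the functional [psi] splits into two maps that extend to
    module maps from the free module to the trivial one, and minimality kills both. *)
Lemma comparison_cocycle k m (Pm : lmodType A) (d : {linear 'rV[A]_m -> Pm}) :
  comparison triv k d -> (forall p, d p = 0 -> forall i, eps (p 0 i) = 0) ->
  exists gam : resolution triv k.+1 -> 'rV[A]_m,
  forall psi : {linear restr 'rV[A]_m -> F^o},
  (forall a x, d x = 0 -> psi (a *: x) = eps a * psi x) ->
  cocycles triv triv k.+1 (psi \o gam) /\
  (coboundaries triv triv k.+1 (psi \o gam) -> forall x, d x = 0 -> psi x = 0).
Proof.
move=> [f [g [h [gP fP hP]]]] dmin.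
exists (g \o @resolution_diff _ triv k) => psi psiE.
have dg q : d (g (resolution_diff q)) = 0 by apply: gP; exact: cover_eval_diff.
split; first split=> [a q q' /=|q /=].
- rewrite (resolution_diff_linear a) linearP (raddfD psi) /= psiE//.
- have -> : resolution_diff (resolution_diff q) = 0.
    by apply/resolution_diff_eq0; exact: cover_eval_diff.
  by rewrite linear0 raddf0.
move=> [eta eta_lin etaE] x dx.
(* A module map from a free module to the trivial module sees only augmentations of coordinates, and
   those of [x] vanish by minimality. *)
have min0 (phi : 'rV[A]_m -> F) : (forall p, phi p = \sum_i eps (p 0 i) * phi (delta_mx 0 i)) ->
    phi x = 0.
  by move=> ->; rewrite big1// => i _; rewrite dmin// mul0r.
have [y fy] := resolution_diff_surj (fP x dx).
have e1 : psi (g (f x)) = 0.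
  rewrite -fy; have /= -> := etaE y; rewrite fy.
  apply: (min0 (fun p => eta (f p))) => p.
  rewrite {1}[p]row_scale_sum linear_sum (linear_fun_sum eta_lin).
  apply: eq_bigr => i _.
  by rewrite linearZ (linear_funZ eta_lin).
pose th p := p - g (f p) - h (d p).
(* [psi] is a module map only on the kernel of [d], but [th] takes all its values there, so the
   composite is one on the whole free module. *)
have e2 : psi (th x) = 0.
  apply: (min0 (fun p => psi (th p))) => p.
  have th_lin : linear th.
    by move=> a u v; rewrite /th (linearP f) (linearP g) (linearP d) (linearP h) scaleB3.
  rewrite {1}[p]row_scale_sum (linear_fun_sum th_lin) (raddf_sum psi).
  apply: eq_bigr => i _.
  by rewrite (linear_funZ th_lin); apply: psiE; exact: hP.
move: e2; rewrite /th dx linear0 subr0 (raddfB psi) /= e1 subr0.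
by [].
Qed.

(** Functionals dual to the family and killing [I K] give cocycles. A combination that is a
    coboundary vanishes on the kernel of [d], and evaluating it at [x i] returns its [i]-th
    coefficient. *)
Lemma comparison_independent (R : realType) k m (Pm : lmodType A)
    (d : {linear 'rV[A]_m -> Pm}) r (x : 'I_r -> restr 'rV[A]_m) :
  comparison triv k d -> (forall p, d p = 0 -> forall i, eps (p 0 i) = 0) ->
  (forall i, d (x i) = 0) -> independent_mod (aug_sub [set p | d p = 0]) x ->
  (r%:R%:E <= cohomology_dim L R k.+1)%E /\ (Ext_eq0 triv triv k.+1 -> r = 0%N).
Proof.
move=> cmp dmin dx ix.
have [gam gamP] := comparison_cocycle cmp dmin.
set B := aug_sub _ in ix.
have sB : is_subspace B by exact: lspan_subspace.
have [psi psiP] := dual_functionals sB ix.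
have psiE j := aug_sub_functional (K := [set p | d p = 0]) (psiP j).1.
pose v j : resolution triv k.+1 -> F^o := psi j \o gam.
have vZ j : cocycles triv triv k.+1 (v j) by exact: (gamP (psi j) (psiE j)).1.
have vi : independent_mod (coboundaries triv triv k.+1 : set (resolution triv k.+1 -> F^o)) v.
  move=> c cB i.
  pose psic (y : restr 'rV[A]_m) : F^o := \sum_j c j * psi j y.
  have psic_lin : linear psic.
    move=> a u w; rewrite /psic scaler_sumr -big_split; apply: eq_bigr => j _ /=.
    by rewrite linearP mulrDr /= mulrCA.
  pose psic' : {linear restr 'rV[A]_m -> F^o} :=
    HB.pack psic (GRing.isLinear.Build F _ F^o *:%R psic psic_lin).
  have psicE a y : d y = 0 -> psic' (a *: y) = eps a * psic' y.
    move=> dy; rewrite /= /psic mulr_sumr; apply: eq_bigr => j _.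
    by rewrite psiE// mulrCA.
  have : coboundaries triv triv k.+1 (psic' \o gam).
    have <- : \sum_j c j *: v j = psic' \o gam; last exact: cB.
    apply/funext => q; rewrite fct_sumE /=; apply: eq_bigr => j _.
    by [].
  move=> /((gamP psic' psicE).2) /(_ (x i) (dx i)).
  rewrite /= /psic (bigD1 i)//= (psiP i).2 eqxx mulr1 big1 ?addr0// => j ji.
  by rewrite (psiP j).2 eq_sym (negPf ji) mulr0.
split; first by apply: ereal_sup_ubound; exists r => //; exists v.
move=> ext0; case: r x dx ix psi psiP psiE v vZ vi => // r x dx ix psi psiP psiE v vZ vi.
have /vi/(_ ord0) : (coboundaries triv triv k.+1 : set (resolution triv k.+1 -> F^o))
    (\sum_i (i == ord0)%:R *: v i).
  have -> : \sum_i (i == ord0)%:R *: v i = v ord0; last by apply: ext0; exact: vZ.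
  apply/funext => q; rewrite fct_sumE (bigD1 ord0)// big1 => [|i /andP[_ /negPf ->]].
    by apply: (etrans (addr0 _)); rewrite eqxx; exact: scale1r.
  exact: scale0r.
by rewrite eqxx /= => /eqP; rewrite oner_eq0.
Qed.

End CohomologyBound.

Section ProductDimension.
Context (F : fieldType) (A : algType F) (m : nat) (W : 'I_m -> set A) (n : 'I_m -> nat).
Hypothesis W0 : forall i, W i 0.
Hypothesis dW : forall i, fdim (W i) (n i).

Lemma fdim_row : fdim [set x : restr 'rV[A]_m | forall i, W i (x 0 i)] (\sum_i n i).
Proof.
pose e i := sval (cid (dW i)).
have eP i : [/\ forall j, W i (e i j), independent_mod [set 0] (e i) &
    forall x, W i x -> exists c : 'I_(n i) -> F, x = \sum_j c j *: e i j].
  exact: svalP (cid (dW i)).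
pose J : finType := {i : 'I_m & 'I_(n i)}.
pose tg i (j : 'I_(n i)) : J := Tagged (fun i => 'I_(n i)) j.
pose f (p : J) : restr 'rV[A]_m := e (tag p) (tagged p) *: delta_mx 0 (tag p).
have sumE (c : J -> F) i : (\sum_p c p *: f p : 'rV[A]_m) 0 i =
    \sum_j c (tg _ j) *: e i j.
  have coord (g : J -> restr 'rV[A]_m) : (\sum_p g p : 'rV[A]_m) 0 i = \sum_p (g p : 'rV[A]_m) 0 i.
    exact: summxE.
  rewrite coord.
  pose h i' (j' : 'I_(n i')) : A :=
    ((c (tg _ j') *: f (tg _ j') : restr 'rV[A]_m) : 'rV[A]_m) 0 i.
  transitivity (\sum_i' \sum_(j' : 'I_(n i')) h i' j').
    by rewrite sig_big_dep; apply: eq_big => // -[i' j'].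
  have hE i' j' : h i' j' = c (tg _ j') *: (e i' j' * (i == i')%:R).
    by rewrite /h restrZ !mxE /= mulr_algl.
  rewrite (bigD1 i)//= [X in _ + X]big1 ?addr0 => [|i' /negPf ii']; last first.
    by rewrite big1// => j' _; rewrite hE eq_sym ii' mulr0 scaler0.
  by apply: eq_bigr => j _; rewrite hE eqxx mulr1.
have -> : (\sum_i n i)%N = #|J|.
  rewrite card_tagged sumnE big_map big_enum /=.
  by apply: eq_bigr => i _; rewrite card_ord.
apply: (fdim_fin (e := f)) => [[i j] i'|c c0 [i j]|x Wx].
- rewrite /f /= !mxE /= eq_sym; case: eqP => [<-|_]; last by rewrite mulr0.
  by rewrite mulr1; case: (eP i).
- have [_ ie _] := eP i; apply: (ie (fun j => c (tg _ j))).
  by rewrite /= -sumE c0 mxE.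
- have cP i : exists c : 'I_(n i) -> F, (x : 'rV[A]_m) 0 i = \sum_j c j *: e i j.
    by have [_ _] := eP i; apply; exact: Wx.
  exists (fun p => sval (cid (cP (tag p))) (tagged p)).
  apply: (@matrixP A 1 m x _).1 => i0 i; rewrite ord1 sumE /=.
  exact: svalP (cid (cP i)).
Qed.

End ProductDimension.

(** * Minimal graded resolutions *)

Section GradedFree.
Context (F : fieldType) (L : lieAlgType F) (pr : nat -> uea L -> uea L) (u : nat -> nat).
Hypothesis H : connected_grading (@augmentation F L) pr u.
Local Notation A := (uea L).
Local Notation eps := (@augmentation F L).

Let prL n : linear (pr n) := cg_linear H n.
Let pr0 n : pr n 0 = 0 := linear_fun0 (prL n).

Lemma pr_homog p a n : pr p a = a -> pr n a = if n == p then a else 0.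
Proof. by move=> ap; rewrite -{1}ap (cg_proj H) ap. Qed.

Lemma cg_sum_ge a : exists N, forall M, (N <= M)%N ->
  a = \sum_(n < M) pr n a /\ forall n, (M <= n)%N -> pr n a = 0.
Proof.
have [N [aE a0]] := cg_sum H a; exists N => M NM; split; last first.
  by move=> n Mn; apply: a0; exact: leq_trans Mn.
rewrite -(big_mkord predT (fun n => pr n a)) (big_cat_nat (n := N))//= big_mkord -aE.
by rewrite big_nat_cond big1 ?addr0// => n /andP[/andP[/a0]].
Qed.

Lemma pr_mulr p a n b : pr p a = a ->
  pr n (a * b) = if (p <= n)%N then a * pr (n - p)%N b else 0.
Proof.
move=> ap; have [N /(_ _ (leqnn _)) [bE b0]] := cg_sum_ge b.
rewrite {1}bE mulr_sumr (linear_fun_sum (prL n)).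
have e q : pr n (a * pr q b) = if n == (p + q)%N then a * pr q b else 0.
  by apply: pr_homog; apply: (cg_mul H) => //; rewrite (cg_proj H) eqxx.
under eq_bigr do rewrite e.
case: leqP => pn; last first.
  by rewrite big1// => q _; rewrite ltn_eqF// (leq_trans pn)// leq_addr.
have ne q : (n == p + q)%N = (q == n - p)%N.
  by rewrite -(eqn_add2l p q) subnKC// eq_sym.
under eq_bigr do rewrite ne.
have [nN|Nn] := ltnP (n - p) N.
  rewrite (bigD1 (Ordinal nN))//= eqxx big1 ?addr0// => q.
  by rewrite -val_eqE /= => /negPf ->.
rewrite b0// mulr0 big1// => q _; rewrite ltn_eqF//; exact: leq_trans Nn.
Qed.

Lemma pr_mull q a n b : pr q b = b ->
  pr n (a * b) = if (q <= n)%N then pr (n - q)%N a * b else 0.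
Proof.
move=> bq; have [N /(_ _ (leqnn _)) [aE a0]] := cg_sum_ge a.
rewrite {1}aE mulr_suml (linear_fun_sum (prL n)).
have e p : pr n (pr p a * b) = if n == (p + q)%N then pr p a * b else 0.
  by apply: pr_homog; apply: (cg_mul H) => //; rewrite (cg_proj H) eqxx.
under eq_bigr do rewrite e.
case: leqP => qn; last first.
  by rewrite big1// => p _; rewrite ltn_eqF// (leq_trans qn)// leq_addl.
have ne p : (n == p + q)%N = (p == n - q)%N.
  by rewrite -(eqn_add2r q p) subnK// eq_sym.
under eq_bigr do rewrite ne.
have [nN|Nn] := ltnP (n - q) N.
  rewrite (bigD1 (Ordinal nN))//= eqxx big1 ?addr0// => p.
  by rewrite -val_eqE /= => /negPf ->.
rewrite a0// mul0r big1// => p _; rewrite ltn_eqF//; exact: leq_trans Nn.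
Qed.

Lemma eps_pr n a : (0 < n)%N -> eps (pr n a) = 0.
Proof.
move=> n0; rewrite -(augmentationA L (eps (pr n a))) -(cg_0 H) (cg_proj H).
by rewrite (ltn_eqF n0) raddf0.
Qed.

Section Shifted.
Context (m : nat) (dl : 'I_m -> nat).

(** The [i]-th basis vector sits in degree [dl i]. The guard is needed because natural subtraction
    would turn negative degrees into degree 0. *)
Definition shift_pr n (i : 'I_m) (a : A) : A :=
  if (dl i <= n)%N then pr (n - dl i)%N a else 0.

Definition Pr n (x : 'rV[A]_m) : 'rV[A]_m := \row_i shift_pr n i (x 0 i).

Lemma shift_pr_linear n i : linear (shift_pr n i).
Proof.
move=> c a b; rewrite /shift_pr; case: ifP => _; first exact: prL.
by rewrite scaler0 addr0.
Qed.

Lemma shift_pr0 n i : shift_pr n i 0 = 0.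
Proof. exact: linear_fun0 (shift_pr_linear n i). Qed.

Lemma Pr_linear n : linear (Pr n : restr 'rV[A]_m -> restr 'rV[A]_m).
Proof.
move=> c x y; apply/matrixP => i0 i; rewrite ord1 !mxE !mulr_algl.
by rewrite shift_pr_linear.
Qed.

Lemma Pr0 n : Pr n 0 = 0.
Proof. exact: linear_fun0 (Pr_linear n). Qed.

Lemma PrD n x y : Pr n (x + y) = Pr n x + Pr n y.
Proof. exact: linear_funD (Pr_linear n) x y. Qed.

Lemma Pr_sum n J (r : seq J) (P : pred J) (f : J -> 'rV[A]_m) :
  Pr n (\sum_(j <- r | P j) f j) = \sum_(j <- r | P j) Pr n (f j).
Proof. exact: (linear_fun_sum (Pr_linear n) r P f). Qed.

Lemma shift_pr_proj k n i a :
  shift_pr k i (shift_pr n i a) = if k == n then shift_pr n i a else 0.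
Proof.
rewrite /shift_pr; case: (eqVneq k n) => [->|kn].
  by case: (leqP (dl i) n) => // _; rewrite (cg_proj H) eqxx.
case: (leqP (dl i) k) => // ik; case: (leqP (dl i) n) => in_; last by rewrite pr0.
rewrite (cg_proj H); case: eqP => // e; case/eqP: kn.
by rewrite -(subnK ik) e subnK.
Qed.

Lemma Pr_proj k n x : Pr k (Pr n x) = if k == n then Pr n x else 0.
Proof.
apply/rowP => i; rewrite !mxE shift_pr_proj; case: ifP => _; by rewrite mxE.
Qed.

Lemma Pr_homog p x n : Pr p x = x -> Pr n x = if n == p then x else 0.
Proof. by move=> xp; rewrite -{1}xp Pr_proj xp. Qed.

Lemma shift_pr_sum i a : exists N, forall M, (N <= M)%N ->
  a = \sum_(n < M) shift_pr n i a.
Proof.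
have [N NP] := cg_sum_ge a; exists (dl i + N)%N => M NM.
have dM : (dl i <= M)%N by rewrite (leq_trans _ NM)// leq_addr.
have NM' : (N <= M - dl i)%N by rewrite leq_subRL.
rewrite {1}(NP _ NM').1.
rewrite -(big_mkord predT (fun n => pr n a)) -(big_mkord predT (fun n => shift_pr n i a)) /= [RHS](big_cat_nat (n := dl i))//=.
rewrite [X in _ = X + _]big_nat_cond [X in _ = X + _]big1 ?add0r; last first.
  by move=> n /andP[/andP[_ nd] _]; rewrite /shift_pr leqNgt nd.
rewrite -{2}[dl i]add0n big_addn; apply: eq_bigr => n _.
by rewrite /shift_pr leq_addl addnK.
Qed.

Lemma Pr_decomp x : exists N, x = \sum_(n < N) Pr n x.
Proof.
have /choice[N NP] i := shift_pr_sum i (x 0 i).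
exists (\max_i N i); apply/rowP => i; rewrite summxE.
rewrite {1}(NP i _ (leq_bigmax i)); by apply: eq_bigr => n _; rewrite mxE.
Qed.

Lemma Pr_scaler p a n x : pr p a = a ->
  Pr n (a *: x) = if (p <= n)%N then a *: Pr (n - p) x else 0.
Proof.
move=> ap; apply/rowP => i; rewrite !mxE /shift_pr (pr_mulr _ _ ap).
case: (leqP p n) => pn; rewrite !mxE /shift_pr; last first.
  case: (leqP p (n - dl i)) => [pnd|_]; last by rewrite if_same.
  by have := leq_trans pnd (leq_subr _ _); rewrite leqNgt pn.
have [dpn|dpn] := leqP (dl i + p) n.
  have -> : (dl i <= n)%N by lia.
  have -> : (p <= n - dl i)%N by lia.
  have -> : (dl i <= n - p)%N by lia.
  by rewrite subnAC.
have -> : (dl i <= n - p)%N = false by lia.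
have [dn|_] := leqP (dl i) n; last by rewrite mulr0.
have -> : (p <= n - dl i)%N = false by lia.
by rewrite mulr0.
Qed.

Lemma Pr_scalel q a n x : Pr q x = x ->
  Pr n (a *: x) = if (q <= n)%N then pr (n - q)%N a *: x else 0.
Proof.
move=> xq; apply/rowP => i; rewrite !mxE.
have := congr1 (fun y : 'rV_m => y 0 i) xq; rewrite !mxE {1}/shift_pr.
case: (leqP (dl i) q) => [iq xi|qi xi]; last first.
  by rewrite -xi mulr0 shift_pr0; case: ifP => _; rewrite mxE// -xi mulr0.
rewrite /shift_pr (pr_mull _ _ xi); have [qn|nq] := leqP q n; rewrite mxE; last first.
  case: (leqP (dl i) n) => // dn.
  by have -> : (q - dl i <= n - dl i)%N = false by lia.
have -> : (dl i <= n)%N by lia.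
have -> : (q - dl i <= n - dl i)%N by lia.
by have -> : (n - dl i - (q - dl i) = n - q)%N by lia.
Qed.

Definition free_dim n := (\sum_i if dl i <= n then u (n - dl i) else 0)%N.

Lemma fdim_Pr n : fdim [set x : restr 'rV[A]_m | Pr n x = x] (free_dim n).
Proof.
pose W i : set A := [set a | shift_pr n i a = a].
have dW i : fdim (W i) (if (dl i <= n)%N then u (n - dl i) else 0%N).
  rewrite /W /shift_pr; case: leqP => _; first exact: (cg_dim H).
  by apply: (fdim_eq (@fdim0 _ _)) => x /= ->.
have W0 i : W i 0 by rewrite /W /= shift_pr0.
apply: (fdim_eq (fdim_row W0 dW)) => x /= Wx.
  by apply/rowP => i; rewrite mxE; exact: Wx.
by move=> i; rewrite /W /= -{2}Wx mxE.
Qed.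

End Shifted.
End GradedFree.

Section Stages.
Context (F : fieldType) (L : lieAlgType F) (pr : nat -> uea L -> uea L) (u : nat -> nat).
Hypothesis H : connected_grading (@augmentation F L) pr u.
Local Notation A := (uea L).
Local Notation eps := (@augmentation F L).
Local Notation triv := (trivial_module L).

(* The [k]-th step of a minimal graded free resolution of the trivial module;
   [c] is the Hilbert function of the kernel. *)
Record stage k m (Pm : lmodType A) (d : {linear 'rV[A]_m -> Pm})
    (dl : 'I_m -> nat) (c : nat -> nat) : Prop := Stage {
  stage_comparison : comparison triv k d;
  stage_minimal : forall p, d p = 0 -> forall i, eps (p 0 i) = 0;
  stage_graded : forall n x, d x = 0 -> d (Pr pr dl n x) = 0;
  stage_dim : forall n,
    fdim [set x : restr 'rV[A]_m | Pr pr dl n x = x /\ d x = 0] (c n) }.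

Lemma aug_sub_gen (V : lmodType A) (K : set V) a (k : V) :
  eps a = 0 -> K k -> aug_sub K (a *: k).
Proof. by move=> a0 Kk; apply: sub_lspan; exists a, k. Qed.

(** A graded Nakayama argument. Once [K / I K] is known to be finite dimensional, a maximal
    independent family of homogeneous elements is finite, and it generates [K] by induction on
    degree. *)
Lemma next_stage k m (Pm : lmodType A) (d : {linear 'rV[A]_m -> Pm}) dl c N :
  stage k d dl c ->
  (forall r (x : 'I_r -> restr 'rV[A]_m), (forall i, d (x i) = 0) ->
     independent_mod (aug_sub [set p | d p = 0]) x -> (r <= N)%N) ->
  exists m' (d' : {linear 'rV[A]_m' -> 'rV[A]_m}) dl' c',
    [/\ stage k.+1 d' dl' c', (m' <= N)%N &
        forall n, (c n + c' n = free_dim u dl' n)%N].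
Proof.
move=> [cmp dmin dgr dim] bnd.
pose K : set 'rV[A]_m := [set p | d p = 0]; pose B := aug_sub K.
pose V : lmodType F := restr 'rV[A]_m.
have sB : is_subspace B by exact: lspan_subspace.
(* [Z] is not a subspace. Maximality among homogeneous elements is enough, because every element of
   the kernel is a sum of homogeneous elements of the kernel. *)
pose Z : set V := [set z : V | d z = 0 /\ exists n, Pr pr dl n z = z].
have bndZ r (x : 'I_r -> V) : (forall i, Z (x i)) -> independent_mod B x -> (r <= N)%N.
  by move=> Zx; apply: bnd => i; exact: (Zx i).1.
have [r [v [rN Zv iv gen]]] := max_independent sB bndZ.
have /choice[dl' dl'P] i : exists n, Pr pr dl n (v i) = v i by exact: (Zv i).2.
have dv i : d (v i) = 0 by exact: (Zv i).1.
pose d' : {linear 'rV[A]_r -> 'rV[A]_m} := row_comb (X := 'rV[A]_m) v.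
have d'E p : d' p = \sum_i p 0 i *: (v i : 'rV[A]_m) by [].
pose Im : set V := [set y : V | exists p, d' p = y].
have ImZ a (y : 'rV[A]_m) : Im y -> Im (a *: y).
  by move=> [p <-]; exists (a *: p); rewrite linearZ.
have sIm : is_subspace Im.
  split=> [|a x y [p <-] [q <-]]; first by exists 0; rewrite linear0.
  by exists ((a%:A : A) *: p + q); rewrite linearP.
have Imv i : Im (v i).
  exists (delta_mx 0 i); rewrite d'E (bigD1 i)//= mxE !eqxx scale1r big1 ?addr0//.
  by move=> j /negPf ji; rewrite mxE ji andbF scale0r.
have homogP n (z : 'rV[A]_m) : d z = 0 -> Pr pr dl n z = z -> Im z.
  elim/ltn_ind: n z => n IHn z dz nz.
  have BIm b : B b -> Im (Pr pr dl n b).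
    apply: (lspan_min (W := [set b : V | Im (Pr pr dl n b)])).
      split=> /= [|a x y Ix Iy]; first by rewrite (Pr0 H); exact: (subspace0 sIm).
      by rewrite (Pr_linear H dl n a); exact: sIm.2.
    move=> _ [a [q [a0 dq ->]]] /=.
    have [M /(_ _ (leqnn _)) [aE _]] := cg_sum_ge H a.
    rewrite aE scaler_suml (Pr_sum H); apply: (subspace_sum (W := Im)) => // -[p /= _] _.
    have prp : pr p (pr p a) = pr p a by rewrite (cg_proj H) eqxx.
    rewrite (Pr_scaler H _ _ _ prp).
    case: leqP => pn; last exact: (subspace0 sIm).
    (* The degree 0 part of [a] is its augmentation, which is zero. So only positive [p] remain, and
       the component of [q] has degree less than [n]. *)
    case: p prp pn => [|p] prp pn.
      by rewrite (cg_0 H) a0 !scale0r; exact: (subspace0 sIm).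
    apply: ImZ; apply: (IHn (n - p.+1)%N); first by lia.
      exact: dgr.
    by rewrite (Pr_proj H) eqxx.
  have [e Be] := gen z (conj dz (ex_intro _ n nz)).
  have := BIm _ Be.
  set s := \sum_i _ in Be *.
  have Is : Im (Pr pr dl n s).
    rewrite /s (Pr_sum H); apply: (subspace_sum (W := Im)) => // i _.
    rewrite (linear_funZ (Pr_linear H dl n)) (Pr_homog H _ (dl'P i)).
    by apply: (subspaceZ _ sIm); case: ifP => _; [exact: Imv|exact: (subspace0 sIm)].
  move=> Ib; have -> : z = (Pr pr dl n (z - s) + Pr pr dl n s : V).
    by rewrite -(PrD H) subrK.
  exact: (subspaceD sIm).
have surj z : d z = 0 -> exists p, d' p = z.
  move=> dz; have [M ->] := Pr_decomp H dl z.
  apply: (subspace_sum (W := Im)) => // i _; apply: (homogP i); first exact: dgr.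
  by rewrite (Pr_proj H) eqxx.
have dd' p : d (d' p) = 0.
  by rewrite d'E linear_sum big1// => i _; rewrite linearZ /= dv scaler0.
have d'_Pr n p : d' (Pr pr dl' n p) = Pr pr dl n (d' p).
  rewrite !d'E (Pr_sum H); apply: eq_bigr => i _.
  by rewrite (Pr_scalel H _ _ (dl'P i)) mxE /shift_pr; case: ifP => // _; rewrite scale0r.
have d'lin : linear (d' : restr 'rV[A]_r -> V) by move=> a x y; exact: (linearP d' (a%:A)).
pose d'F : {linear restr 'rV[A]_r -> V} :=
  HB.pack (d' : restr 'rV[A]_r -> V) (GRing.isLinear.Build F _ _ *:%R _ d'lin).
pose W n : set (restr 'rV[A]_r) := [set x : restr 'rV[A]_r | Pr pr dl' n x = x].
have sW n : is_subspace (W n).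
  split=> [|a x y]; first exact: (Pr0 H).
  by rewrite /W /= => xn yn; rewrite (Pr_linear H dl' n a) xn yn.
have kerdim n : exists c', fdim [set x : restr 'rV[A]_r | Pr pr dl' n x = x /\ d' x = 0] c' /\
    (c n + c' = free_dim u dl' n)%N.
  have [r1 [k1 [dr1 dk1 rk]]] := rank_nullity d'F (sW n) (fdim_Pr H dl' n).
  exists k1; split; first by apply: (fdim_eq dk1) => x.
  rewrite -rk; congr (_ + _)%N; apply: (fdim_uniq _ dr1).
  apply: (fdim_eq (dim n)) => [x [xn dx]|_ [x xn <-]].
    have [p px] := surj x dx; exists (Pr pr dl' n p).
      by rewrite /W /= (Pr_proj H) eqxx.
    by rewrite /= d'_Pr px.
  by split; [rewrite /= -d'_Pr xn|exact: dd'].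
have [c' c'P] := choice kerdim.
exists r, d', dl', c'; split; [|exact: rN|by move=> n; exact: (c'P n).2].
split=> [|p p0 i|n x x0|n]; last exact: (c'P n).1.
- exact: (comparisonS dd' surj cmp).
(* A relation among the generators becomes, on replacing each coefficient by its augmentation, a
   relation modulo [I K]; independence makes the augmentations vanish. *)
- apply: (iv (fun i => eps (p 0 i))).
  have -> : \sum_i eps (p 0 i) *: v i =
      \sum_i (((eps (p 0 i))%:A - p 0 i : A) *: (v i : 'rV[A]_m) : V).
    rewrite -[LHS]subr0 -[X in _ - X]p0 d'E -[LHS]sumrB.
    by apply: eq_bigr => j _; rewrite scalerBl.
  apply: (subspace_sum (W := B)) => // i' _; apply: aug_sub_gen; last exact: dv.
  by rewrite raddfB /= augmentationA subrr.
- by rewrite d'_Pr x0 (Pr0 H).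
Qed.

End Stages.

Lemma quot_dim_bounded (R : realType) (F : fieldType) (V : lmodType F) (Z B : set V) :
  quot_dim R Z B != +oo%E -> exists N, forall r, (r%:R%:E <= quot_dim R Z B)%E -> (r <= N)%N.
Proof.
case E: (quot_dim R Z B) => [x| |] // _; last by exists 0.
exists (Num.bound `|x|) => r; rewrite lee_fin => rx.
have := le_lt_trans (le_trans rx (ler_norm x)) (archi_boundP (normr_ge0 x)).
by rewrite ltr_nat => /ltnW.
Qed.

Lemma const_mxM (A : nzRingType) m n (a b : A) :
  const_mx (a * b) = a *: const_mx b :> 'M[A]_(m, n).
Proof. by apply/matrixP => i j; rewrite !mxE. Qed.

(** * The Hilbert series as the inverse of a polynomial *)

Section HilbertSeries.
Context (F : fieldType) (L : lieAlgType F) (pr : nat -> uea L -> uea L) (u : nat -> nat).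
Hypothesis H : connected_grading (@augmentation F L) pr u.
Local Notation A := (uea L).
Local Notation eps := (@augmentation F L).
Local Notation triv := (trivial_module L).

Definition aug_row (x : 'rV[A]_1) : triv := eps (x 0 0).

Lemma aug_row_linear : linear aug_row.
Proof.
move=> a x y; rewrite /aug_row !mxE.
rewrite (raddfD (@augmentation F L)) /=.
by rewrite (rmorphM (@augmentation F L)).
Qed.
HB.instance Definition _ := GRing.isLinear.Build A 'rV[A]_1 triv *:%R aug_row aug_row_linear.

Lemma aug_row_restr_linear : linear (aug_row : restr 'rV[A]_1 -> F^o).
Proof.
move=> a x y; have -> : (a *: x + y : restr 'rV[A]_1) = (a%:A : A) *: (x : 'rV[A]_1) + y by [].
rewrite (linearP aug_row).
exact: (congr1 (fun c : F => c * aug_row x + aug_row y) (augmentationA L a)).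
Qed.

Lemma stage0 : exists c,
  stage pr 0 (aug_row : {linear 'rV[A]_1 -> triv}) (fun=> 0%N) c /\
  forall n, (c n + (n == 0) = u n)%N.
Proof.
pose W n : set (restr 'rV[A]_1) := [set x | Pr pr (fun=> 0%N) n x = x].
have PrE n (x : 'rV[A]_1) : (Pr pr (fun=> 0%N) n x) 0 0 = pr n (x 0 0).
  by rewrite mxE /shift_pr /= subn0.
pose f : {linear restr 'rV[A]_1 -> F^o} :=
  HB.pack (aug_row : restr 'rV[A]_1 -> F^o)
    (GRing.isLinear.Build F _ F^o *:%R _ aug_row_restr_linear).
have sW n : is_subspace (W n).
  split=> [|a x y]; first exact: (Pr0 H).
  by rewrite /W /= => xn yn; rewrite (Pr_linear H _ n a) xn yn.
have dimP n : exists c,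
    fdim [set x : restr 'rV[A]_1 | Pr pr (fun=> 0%N) n x = x /\ aug_row x = 0] c /\
    (c + (n == 0) = u n)%N.
  have [r [k [dr dk rk]]] := rank_nullity f (sW n) (fdim_Pr H (fun=> 0%N) n).
  exists k; split; first by apply: (fdim_eq dk) => x.
  have -> : u n = free_dim u ((fun=> 0%N) : 'I_1 -> nat) n.
    by rewrite /free_dim big_ord1 /= subn0.
  rewrite -rk addnC; congr (_ + _)%N; apply: (fdim_uniq _ dr).
  case: n {sW dr dk rk} => [|n] /=.
    exists (fun=> 1 : F^o); split=> [_|c /= c0 i|x _].
    - exists (const_mx 1 : 'rV[A]_1); last by rewrite /= /aug_row mxE rmorph1.
      apply/rowP => i; rewrite ord1 PrE mxE (cg_0 H) rmorph1; exact: scale1r.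
    - by move: c0; rewrite big_ord1 (ord1 i) => <-; rewrite /GRing.scale /= mulr1.
    - by exists (fun=> x); rewrite big_ord1 /GRing.scale /= mulr1.
  apply: (fdim_eq (@fdim0 _ _)) => [x /= ->|_ [x /= xn <-]].
    exists (0 : 'rV[A]_1); first exact: (Pr0 H).
    by rewrite /aug_row mxE raddf0.
  by rewrite /= /aug_row -xn PrE (eps_pr H).
have [c cP] := choice dimP.
exists c; split; last by move=> n; exact: (cP n).2.
split=> [|p p0 i|n x x0|n]; last exact: (cP n).1.
- apply: comparison0 => x; exists (const_mx ((x : F)%:A)).
  by rewrite /= /aug_row mxE augmentationA.
- by rewrite (ord1 i).
- rewrite /= /aug_row PrE; case: n => [|n]; last by rewrite (eps_pr H).
  by rewrite (cg_0 H) augmentationA.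
Qed.

(** The first kernel is [I], and [I / I^2] is spanned by the generators in [s]: a commutator of
    elements of [I] lies in [I^2], and so does a product of two elements of [I]. *)
Lemma augmentation_ideal_fg (s : seq L) r (x : 'I_r -> restr 'rV[A]_1) :
  smallest (@is_lie_subalgebra F L) [set` s] = setT ->
  (forall i, aug_row (x i) = 0) ->
  independent_mod (aug_sub [set p | aug_row p = 0]) x -> (r <= size s)%N.
Proof.
move=> sgen x0.
set B := aug_sub _.
have sB : is_subspace B by exact: lspan_subspace.
pose V : lmodType F := restr 'rV[A]_1.
pose row (a : A) : V := const_mx a.
have rowP_lin : linear row.
  by move=> c a b; apply/rowP => i; rewrite !mxE mulr_algl.
pose D : set V := [set p | exists c : 'I_(size s) -> F,
  B (p - \sum_j c j *: row (embed (tnth (in_tuple s) j)))].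
have BD : B `<=` D.
  move=> b Bb; exists (fun=> 0); rewrite big1 ?subr0// => j _; exact: scale0r.
have sD : is_subspace D.
  split=> [|a p q [c Bc] [d Bd]]; first by apply: BD; exact: (subspace0 sB).
  exists (fun j => a * c j + d j).
  have -> : a *: p + q - \sum_j (a * c j + d j) *: row (embed (tnth (in_tuple s) j)) =
      a *: (p - \sum_j c j *: row (embed (tnth (in_tuple s) j))) +
      (q - \sum_j d j *: row (embed (tnth (in_tuple s) j))).
    rewrite scalerBr [RHS]addrACA -opprD; congr (_ - _).
    rewrite scaler_sumr -big_split; apply: eq_bigr => i _ /=.
    by rewrite scalerDl scalerA.
  exact: (sB.2 _ _ _ Bc Bd).
have rowM a b : eps a = 0 -> eps b = 0 -> B (row (a * b)).
  move=> a0 b0; rewrite /row const_mxM.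
  by apply: aug_sub_gen => //=; rewrite /aug_row mxE.
(* The elements whose image lies in the span of the generators modulo [I^2] form a Lie subalgebra,
   since all brackets map into [I^2]. *)
have Dembed y : D (row (embed y)).
  have : setT y by []; rewrite -sgen => /(_ [set y | D (row (embed y))]); apply; split.
    split=> [|y1 y2 D1 D2]; last first.
      rewrite /= embed_bracket (linear_funB rowP_lin).
      by apply: BD; apply: (subspaceB sB); apply: rowM; exact: augmentation_embed.
    split=> /= [|a y1 y2 D1 D2].
      by rewrite linear0 (linear_fun0 rowP_lin); exact: (subspace0 sD).
    by rewrite (embed_is_linear a) (rowP_lin a); exact: (sD.2 _ _ _ D1 D2).
  move=> z /= zs; have zs' : (index z s < size s)%N by rewrite index_mem.
  exists (fun j => (j == Ordinal zs')%:R); rewrite (bigD1 (Ordinal zs'))//= eqxx scale1r.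
  rewrite big1 => [|i /negPf ->]; last by rewrite scale0r.
  rewrite (tnth_nth 0) /= nth_index// addr0 subrr; exact: (subspace0 sB).
have Drow a : D (row (a - (eps a)%:A)).
  pose Q : set A := [set a | D (row (a - (eps a)%:A))].
  have sQ : is_subspace Q.
    split=> [|c a1 a2 Q1 Q2]; rewrite /Q /=.
      by rewrite raddf0 scale0r subr0 (linear_fun0 rowP_lin); exact: (subspace0 sD).
    have -> : c *: a1 + a2 - (eps (c *: a1 + a2))%:A =
        c *: (a1 - (eps a1)%:A) + (a2 - (eps a2)%:A).
      rewrite raddfD /= augmentationZ scalerDl scalerBr -scalerA.
      by rewrite [RHS]addrACA -opprD.
    by rewrite (rowP_lin c); exact: (sD.2 _ _ _ Q1 Q2).
  apply: (uea_ind sQ) => w; rewrite /Q /=; elim: w => [|y w IHw].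
    by rewrite big_nil rmorph1 scale1r subrr (linear_fun0 rowP_lin); exact: (subspace0 sD).
  rewrite big_cons (rmorphM (@augmentation F L)) /= augmentation_embed mul0r scale0r subr0.
  set v := \prod_(_ <- w) _ in IHw *.
  have -> : embed y * v = (embed y * (v - (eps v)%:A)) + eps v *: embed y.
    by rewrite mulrBr -scalerAr mulr1 subrK.
  rewrite (linear_funD rowP_lin) (linear_funZ rowP_lin).
  apply: (subspaceD sD); last by apply: (subspaceZ _ sD).
  apply: BD; apply: rowM; first exact: augmentation_embed.
  by rewrite raddfB /= augmentationA subrr.
apply: (@independent_mod_le _ _ _ _ (fun j => row (embed (tnth (in_tuple s) j))) _ _ sB) => i.
have := Drow ((x i : 'rV[A]_1) 0 0).
have -> : row ((x i : 'rV[A]_1) 0 0 - (eps ((x i : 'rV[A]_1) 0 0))%:A) = x i.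
  by apply/rowP => j; rewrite mxE !ord1 [eps _]x0 scale0r subr0.
by [].
Qed.

(** The [n]-th coefficient of the product of [p] and the Hilbert series of [u]. *)
Definition conv (p : {poly int}) n : int := \sum_(i < n.+1) p`_i * (u (n - i))%:Z.

Lemma convD p q n : conv (p + q) n = conv p n + conv q n.
Proof.
by rewrite /conv -big_split; apply: eq_bigr => i _; rewrite coefD mulrDl.
Qed.

Lemma convZ a p n : conv (a *: p) n = a * conv p n.
Proof. by rewrite /conv mulr_sumr; apply: eq_bigr => i _; rewrite coefZ mulrA. Qed.

Lemma conv_free m (dl : 'I_m -> nat) n :
  conv (\sum_i 'X^(dl i)) n = (free_dim u dl n)%:Z.
Proof.
rewrite /free_dim /conv (big_morph Posz PoszD (erefl _)).
under [LHS]eq_bigr do rewrite coef_sum mulr_suml.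
rewrite exchange_big /=; apply: eq_bigr => j _.
case: leqP => jn.
  have jn' : (dl j < n.+1)%N by [].
  rewrite (bigD1 (Ordinal jn'))//= coefXn eqxx mul1r big1 ?addr0// => i.
  by rewrite -val_eqE /= coefXn => /negPf ->; rewrite mul0r.
rewrite big1// => i _; rewrite coefXn ltn_eqF ?mul0r//.
exact: leq_trans (ltn_ord i) jn.
Qed.

(** Euler characteristic. At stage [k], [p] is the alternating sum of the polynomials
    [sum_i X^(dl i)] of the modules so far, and its product with the Hilbert series differs from 1
    by the series of the current kernel, up to sign. Once the kernel is zero, only 1 is left. *)
Lemma finite_resolution_poly (R : realType) (n : nat) :
  finitely_generated L ->
  (forall k, (2 <= k)%N -> cohomology_dim L R k != +oo%E) ->
  Ext_eq0 triv triv n.+1 ->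
  exists p : {poly int}, forall j, conv p j = (j == 0%N)%:R.
Proof.
move=> [s sgen] Hfin ext0.
have step k m (Pm : lmodType A) (d : {linear 'rV[A]_m -> Pm}) dl c p N :
    stage pr k d dl c ->
    (forall r (x : 'I_r -> restr 'rV[A]_m), (forall i, d (x i) = 0) ->
      independent_mod (aug_sub [set p | d p = 0]) x -> (r <= N)%N) ->
    (forall j, conv p j + (-1) ^+ k.+1 * (c j)%:Z = (j == 0%N)%:R) ->
    exists m' (d' : {linear 'rV[A]_m' -> 'rV[A]_m}) dl' c' p',
    [/\ stage pr k.+1 d' dl' c', (m' <= N)%N, (forall j, c j + c' j = free_dim u dl' j)%N &
    forall j, conv p' j + (-1) ^+ k.+2 * (c' j)%:Z = (j == 0%N)%:R].
  move=> st bnd cp; have [m' [d' [dl' [c' [st' mN cc]]]]] := next_stage H st bnd.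
  exists m', d', dl', c', (p + (-1) ^+ k.+1 *: \sum_i 'X^(dl' i)); split=> // j.
  rewrite convD convZ conv_free -cc PoszD mulrDr -(cp j).
  by rewrite -!addrA [(-1) ^+ k.+2]exprS mulN1r mulNr subrr addr0.
have stages k : exists m (Pm : lmodType A) (d : {linear 'rV[A]_m -> Pm}) dl c p,
    [/\ stage pr k d dl c,
    exists N, forall r (x : 'I_r -> restr 'rV[A]_m), (forall i, d (x i) = 0) ->
      independent_mod (aug_sub [set p | d p = 0]) x -> (r <= N)%N &
    forall j, conv p j + (-1) ^+ k.+1 * (c j)%:Z = (j == 0%N)%:R].
  elim: k => [|k [m [Pm [d [dl [c [p [st [N bnd] cp]]]]]]]].
    have [c [st cE]] := stage0.
    exists 1%N, triv, aug_row, (fun=> 0%N), c, 1; split=> [//||j].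
      by exists (size s) => r x; exact: augmentation_ideal_fg.
    have -> : conv 1 j = (u j)%:Z.
      rewrite /conv (bigD1 ord0)//= coef1 mul1r subn0 big1 ?addr0// => i.
      by rewrite -val_eqE /= coef1 => /negPf ->; rewrite mul0r.
    by rewrite -cE PoszD expr1 mulN1r addrC addKr; case: eqP.
  have [m' [d' [dl' [c' [p' [st' _ _ cp']]]]]] := step _ _ _ _ _ _ _ _ st bnd cp.
  exists m', 'rV[A]_m, d', dl', c', p'; split=> //.
  (* The kernel of stage [k.+1] is governed by cohomology in degree [k.+2], which is at least 2;
     stage 0 was settled by the Lie generators. *)
  have [M MP] := quot_dim_bounded (Hfin k.+2 isT).
  exists M => r x dx ix; apply: MP.
  by have [] := comparison_independent R (stage_comparison st') (stage_minimal st') dx ix.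
have [m [Pm [d [dl [c [p [st _ cp]]]]]]] := stages n.
(* Vanishing of Ext leaves no generators for this kernel, so the next free module has rank 0 and its
   dimension formula gives [c j = 0]. *)
have bnd r (x : 'I_r -> restr 'rV[A]_m) : (forall i, d (x i) = 0) ->
    independent_mod (aug_sub [set p | d p = 0]) x -> (r <= 0)%N.
  move=> dx ix.
  by rewrite ((comparison_independent R (stage_comparison st) (stage_minimal st) dx ix).2 ext0).
have [m' [d' [dl' [c' [p' [_ m'0 cc _]]]]]] := step _ _ _ _ _ _ _ _ st bnd cp.
exists p => j; rewrite -(cp j).
have : (c j + c' j = 0)%N.
  by rewrite cc /free_dim; case: m' m'0 dl' d' {cc} => // _ dl' _; rewrite big_ord0.
by move=> /eqP; rewrite addn_eq0 => /andP[/eqP -> _]; rewrite mulr0 addr0.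
Qed.

End HilbertSeries.

(** * Power sums of the reciprocal roots *)

Section TruncatedSeries.
Context (R : comNzRingType) (N : nat).
Implicit Types a b c : {poly R}.

(** Congruence modulo [X^N], so that truncated polynomials can stand for power series. *)
Definition eqX a b := forall n, (n < N)%N -> a`_n = b`_n.

Lemma eqX_sym a b : eqX a b -> eqX b a.
Proof. by move=> ab n /ab. Qed.

Lemma eqX_trans a b c : eqX a b -> eqX b c -> eqX a c.
Proof. by move=> ab bc n nN; rewrite ab// bc. Qed.

Lemma eqXD a b a' b' : eqX a b -> eqX a' b' -> eqX (a + a') (b + b').
Proof. by move=> ab ab' n nN; rewrite !coefD ab// ab'. Qed.

Lemma eqXM c a b : eqX a b -> eqX (c * a) (c * b).
Proof.
move=> ab n nN; rewrite !coefM; apply: eq_bigr => i _; rewrite ab//.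
exact: leq_ltn_trans (leq_subr _ _) nN.
Qed.

Lemma eqX_deriv a b : eqX a b -> eqX ('X * a^`()) ('X * b^`()).
Proof.
move=> ab [|n] nN; rewrite !coefXM//= !coef_deriv ab//.
Qed.

Lemma geometric_eqX (x : R) :
  eqX ((1 - x *: 'X) * \poly_(n < N) (if (0 < n)%N then x ^+ n else 0)) (x *: 'X).
Proof.
move=> n nN; rewrite mulrBl mul1r coefB -scalerAl coefZ coefXM coefZ coefX.
rewrite !coef_poly nN; case: n nN => [|[|n]] nN /=; first by rewrite !mulr0 subrr.
  by rewrite (ltnW nN) mulr0 subr0 expr1 mulr1.
by rewrite (ltnW nN) -exprS subrr mulr0.
Qed.

(** Newton's identities as a logarithmic derivative: each factor contributes [- X (1 - x X)' / (1 -
    x X) = x X / (1 - x X)], a geometric series without constant term. *)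
Lemma newton_eqX (r : seq R) :
  eqX ((\prod_(x <- r) (1 - x *: 'X)) *
       \sum_(x <- r) \poly_(n < N) (if (0 < n)%N then x ^+ n else 0))
      (- ('X * (\prod_(x <- r) (1 - x *: 'X))^`())).
Proof.
elim: r => [|x r IHr].
  by rewrite !big_nil mulr0 derivC mulr0 oppr0.
rewrite !big_cons; set q := \prod_(_ <- _) _ in IHr *; set G := \sum_(_ <- _) _ in IHr *.
rewrite mulrDr derivM.
have dE : (1 - x *: 'X)^`() = - x%:P by rewrite derivB derivC derivZ derivX sub0r alg_polyC.
apply: (@eqX_trans _ (q * (x *: 'X) + (1 - x *: 'X) * - ('X * q^`()))).
  apply: eqXD.
    by rewrite [_ * q]mulrC -mulrA; apply: eqXM; exact: geometric_eqX.
  by rewrite -mulrA; exact: eqXM.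
rewrite dE mulrDr opprD mulrN -!mul_polyC.
suff -> : q * (x%:P * 'X) = - ('X * (- x%:P * q)).
  by rewrite [(1 - _) * ('X * _)]mulrCA.
by ring.
Qed.

End TruncatedSeries.

Section PowerSums.
Context (u l : nat -> nat) (p : {poly int}).
Hypothesis u0 : u 0 = 1%N.
Hypothesis u_rec : forall n,
  (n * u n = \sum_(1 <= k < n.+1) divisor_sum l k * u (n - k))%N.
Hypothesis pu : forall n, \sum_(i < n.+1) p`_i * (u (n - i))%:Z = (n == 0%N)%:R.

Let pC : {poly algC} := map_poly intr p.

(** The relation in degree 0 makes the constant coefficient 1. Hence no root [z] is zero, each
    [X - z] is a multiple of [1 - z^-1 X], and the remaining scalar is found by evaluating at 0. *)
Lemma pC_root_factor : exists r : seq algC, pC = \prod_(x <- r) (1 - x *: 'X).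
Proof.
have p0 : pC`_0 = 1.
  by have := pu 0; rewrite big_ord1 u0 mulr1 coef_map /= => ->.
have [z pE] := closed_field_poly_normal pC.
have z0 x : x \in z -> x != 0.
  move=> xz; apply/eqP => x0; have : pC.[x] = 0.
    rewrite pE hornerZ; have /rootP -> : root (\prod_(y <- z) ('X - y%:P)) x.
      by rewrite root_prod_XsubC.
    by rewrite mulr0.
  by rewrite x0 horner_coef0 p0 => /eqP; rewrite oner_eq0.
have [c cE] : exists c, pC = c *: \prod_(x <- [seq x^-1 | x <- z]) (1 - x *: 'X).
  rewrite {1}pE; elim: z {pE} z0 (lead_coef _) => [|x z IHz] z0 d.
    by exists d; rewrite !big_nil.
  have [|c cE] := IHz _ (d * - x).
    by move=> y yz; apply: z0; rewrite inE yz orbT.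
  exists c; rewrite /= !big_cons [RHS]scalerAr -cE -[RHS]scalerAr -scalerA.
  congr (d *: _); rewrite scalerAl; congr (_ * _).
  have x0 : x != 0 by apply: z0; rewrite inE eqxx.
  by rewrite scalerBr scalerA mulNr mulfV// scaleN1r opprK scaleNr addrC -alg_polyC.
exists [seq x^-1 | x <- z].
suff -> : pC = 1 *: \prod_(x <- [seq x^-1 | x <- z]) (1 - x *: 'X) by rewrite scale1r.
rewrite {1}cE; congr (_ *: _).
have := p0; rewrite -horner_coef0 cE hornerZ horner_prod big1_seq ?mulr1// => x _.
by rewrite hornerD hornerN hornerZ hornerX hornerC mulr0 subr0.
Qed.

(** Modulo [X^(n+1)], [p U = 1] and [X U' = U S]. Differentiating the first gives
    [S = p U S = p X U' = - X p' U]. Newton's identities give [p G = - X p'], and multiplying by [U]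
    yields the same value for [G]. *)
Lemma divisor_sum_power_sum : exists r : seq algC, forall n, (0 < n)%N ->
  (divisor_sum l n)%:R = \sum_(x <- r) x ^+ n.
Proof.
have [r pE] := pC_root_factor; exists r => n n0.
pose N := n.+1.
pose U : {poly algC} := \poly_(i < N) (u i)%:R.
pose S : {poly algC} := \poly_(i < N) (if (0 < i)%N then (divisor_sum l i)%:R else 0).
pose G : {poly algC} := \sum_(x <- r) \poly_(i < N) (if (0 < i)%N then x ^+ i else 0).
have pU : eqX N (pC * U) 1.
  move=> k kN; rewrite coefM coef1 -[RHS](rmorph_nat intr) -pu rmorph_sum.
  apply: eq_bigr => i _; rewrite coef_map coef_poly /= rmorphM /=.
  by rewrite (leq_ltn_trans (leq_subr _ _) kN).
have SU : eqX N ('X * U^`()) (U * S).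
  move=> k kN; rewrite [U * S]mulrC coefXM coefM; case: k kN => [|k] kN /=.
    by rewrite big_ord1 !coef_poly /= mul0r.
  rewrite coef_deriv coef_poly kN -mulrnA mulnC u_rec natr_sum big_ord_recl.
  rewrite coef_poly /= mul0r add0r big_add1 big_mkord; apply: eq_bigr => i _.
  have iN : (i.+1 < N)%N by apply: leq_ltn_trans kN; exact: ltn_ord i.
  by rewrite !coef_poly /bump leq0n add1n iN (leq_ltn_trans (leq_subr _ _) kN) natrM.
have dpU : eqX N ('X * pC^`() * U + pC * ('X * U^`())) 0.
  have := eqX_deriv pU; rewrite derivC mulr0 derivM.
  by have -> : 'X * (pC^`() * U + pC * U^`()) = 'X * pC^`() * U + pC * ('X * U^`()) by ring.
have e1 : eqX N S (- ('X * pC^`() * U)).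
  have a1 : eqX N (pC * U * S) S.
    by rewrite mulrC -{2}[S]mulr1; exact: eqXM.
  have a2 : eqX N (pC * U * S) (pC * ('X * U^`())).
    by rewrite -mulrA; apply: eqXM; exact: eqX_sym.
  move=> k kN; rewrite -a1// a2// coefN; have := dpU k kN; rewrite coefD coef0.
  by move=> /eqP; rewrite addrC addr_eq0 => /eqP.
have e2 : eqX N G (- ('X * pC^`() * U)).
  have a1 : eqX N (U * (pC * G)) (U * - ('X * pC^`())).
    by apply: eqXM; rewrite pE; exact: newton_eqX.
  have a2 : eqX N (U * (pC * G)) G.
    rewrite mulrCA mulrA mulrC -{2}[G]mulr1; exact: eqXM.
  have -> : - ('X * pC^`() * U) = U * - ('X * pC^`()) by ring.
  by move=> k kN; rewrite -a2// a1.
have := e1 n (ltnSn n); rewrite -(e2 n (ltnSn n)).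
rewrite coef_poly ltnSn n0 => ->; rewrite /G coef_sum; apply: eq_bigr => x _.
by rewrite coef_poly ltnSn n0.
Qed.

End PowerSums.

Section Growth.
Context (r : seq algC).
Let s n : algC := \sum_(x <- r) x ^+ n.

Lemma bernoulli (R : numDomainType) (e : R) n : 0 <= e -> 1 + n%:R * e <= (1 + e) ^+ n.
Proof.
move=> e0; elim: n => [|n IHn]; first by rewrite mul0r addr0.
rewrite exprS; apply: le_trans (ler_wpM2l (addr_ge0 ler01 e0) IHn).
rewrite mulrDl mul1r mulrDr mulr1 -natr1 mulrDl mul1r addrA.
rewrite [X in _ <= X](_ : _ = 1 + n%:R * e + e + e * (n%:R * e)); last by ring.
by rewrite lerDl !mulr_ge0// ler0n.
Qed.

Lemma geometric_unbounded (R : archiNumFieldType) (x c : R) :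
  1 < x -> (forall n, (0 < n)%N -> x ^+ n <= c) -> False.
Proof.
move=> x1 xc; have e0 : 0 < x - 1 by rewrite subr_gt0.
have c0 : 0 <= c.
  by apply: le_trans (xc 1 isT); rewrite expr1 ltW// (lt_trans ltr01).
have := archi_boundP (divr_ge0 c0 (ltW e0)); set n := Num.bound _.
rewrite ltr_pdivrMr// => cn.
have le1 : 1 + n.+1%:R * (x - 1) <= c.
  apply: le_trans (bernoulli n.+1 (ltW e0)) _; rewrite addrC subrK; exact: xc.
have lt2 : c < 1 + n.+1%:R * (x - 1).
  apply: lt_le_trans cn _.
  by rewrite -[n.+1%:R]natr1 mulrDl mul1r addrCA lerDl addr_ge0// ltW.
by have := lt_le_trans lt2 le1; rewrite ltxx.
Qed.

(* The polynomial vanishing at all the other points of [r] isolates the term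
   of [x0] in a linear combination of shifts of [s]. *)
Lemma power_sum_dominates x0 : x0 \in r -> exists (c : algC) (q : {poly algC}), 0 < c /\
  forall n, c * `|x0| ^+ n <= \sum_(k < size q) `|q`_k| * `|s (n + k)|.
Proof.
move=> x0r.
pose q : {poly algC} := \prod_(x <- r | x != x0) ('X - x%:P).
have qx0 : q.[x0] != 0.
  rewrite horner_prod prodf_seq_neq0; apply/allP => x _ /=.
  by apply/implyP => xx; rewrite !hornerE subr_eq0 eq_sym.
have qx x : x \in r -> x != x0 -> q.[x] = 0.
  move=> xr xx0; rewrite horner_prod; apply/eqP; rewrite prodf_seq_eq0.
  by apply/hasP; exists x => //; rewrite xx0 !hornerE subrr eqxx.
have m0 : (0 < count_mem x0 r)%N by rewrite -has_count has_pred1.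
exists (`|(count_mem x0 r)%:R * q.[x0]|), q; split.
  by rewrite normr_gt0 mulf_neq0// pnatr_eq0 -lt0n.
move=> n; rewrite -normrX -normrM.
have -> : (count_mem x0 r)%:R * q.[x0] * x0 ^+ n = \sum_(k < size q) q`_k * s (n + k).
  rewrite /s; under [RHS]eq_bigr do rewrite mulr_sumr.
  rewrite exchange_big /=.
  transitivity (\sum_(x <- r) x ^+ n * q.[x]).
    rewrite (bigID (pred1 x0)) /= [X in _ + X]big1_seq ?addr0; last first.
      by move=> x /andP[xx0 xr]; rewrite qx// mulr0.
    rewrite (eq_bigr (fun=> x0 ^+ n * q.[x0])) => [|x /eqP -> //].
    by rewrite big_const_seq iter_addr_0 -[RHS]mulr_natl -mulrA; congr (_ * _); exact: mulrC.
  apply: eq_bigr => x _; rewrite horner_coef mulr_sumr; apply: eq_bigr => k _.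
  by rewrite exprD; ring.
apply: le_trans (ler_norm_sum _ _ _) _.
by apply: ler_sum => k _; rewrite normrM.
Qed.

Lemma power_sum_subexponential :
  (forall M, (0 < M)%N -> exists C : algC, forall n, `|s n| <= C * ((1 + M%:R^-1) ^+ 3) ^+ n) ->
  forall x, x \in r -> `|x| <= 1.
Proof.
move=> sub x xr; apply: contraT => nx1.
have x1 : 1 < `|x| by rewrite real_ltNge ?real1 ?normr_real.
have e0 : 0 < `|x| - 1 by rewrite subr_gt0.
exfalso.
have [M M0 Mx] : exists2 M, (0 < M)%N & (1 + M%:R^-1) ^+ 3 < `|x|.
  (* For [0 <= t <= 1], [(1 + t)^3 <= 1 + 3t + 3t + t], which is the origin of 7; [M] is chosen so
     that [7 / M] is less than the excess of the modulus over 1. *)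
  pose M := (Num.bound (7%:R / (`|x| - 1))).+1; exists M => //.
  have := archi_boundP (divr_ge0 (ler0n _ 7) (ltW e0)).
  move=> /lt_trans -/(_ M%:R); rewrite ltr_nat ltnSn => /(_ isT).
  rewrite ltr_pdivrMr// mulrC -ltr_pdivrMr ?ltr0n// => Me.
  set t := M%:R^-1 in Me *.
  have t0 : 0 <= t by rewrite invr_ge0.
  have t1 : t <= 1 by rewrite invf_le1 ?ltr0n// ler1n.
  have t2 : t ^+ 2 <= t by rewrite expr2 ler_piMl.
  have t3 : t ^+ 3 <= t by rewrite exprS ler_piMr// (le_trans t2).
  apply: (@le_lt_trans _ _ (1 + 7%:R * t)); last first.
    by rewrite addrC -ltrBrDr.
  have -> : (1 + t) ^+ 3 = 1 + (3%:R * t + 3%:R * t ^+ 2 + t ^+ 3) by ring.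
  have -> : 7%:R * t = 3%:R * t + 3%:R * t + t by ring.
  by rewrite lerD2l lerD// lerD2l ler_wpM2l.
have [C sC] := sub M M0.
set rho := (1 + _) ^+ 3 in Mx sC.
have rho0 : 0 < rho by rewrite exprn_gt0// ltr_pwDl// invr_ge0.
have [c [q [c0 cq]]] := power_sum_dominates xr.
(* The shifts by [k] only change the constant, by factors [rho ^+ k], so the powers of the modulus
   divided by [rho] stay bounded although this ratio exceeds 1. *)
apply: (@geometric_unbounded _ (`|x| / rho) ((\sum_(k < size q) `|q`_k| * (C * rho ^+ k)) / c)).
  by rewrite ltr_pdivlMr// mul1r.
move=> n n0; rewrite expr_div_n ler_pdivlMr// mulrAC ler_pdivrMr ?exprn_gt0//.
rewrite mulrC; apply: le_trans (cq n) _; rewrite mulr_suml; apply: ler_sum => k _.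
rewrite -mulrA ler_wpM2l// -mulrA -exprD addnC; exact: sC.
Qed.

Lemma power_sum_bound n : (forall x, x \in r -> `|x| <= 1) -> `|s n| <= (size r)%:R.
Proof.
move=> x1; apply: le_trans (ler_norm_sum _ _ _) _.
rewrite -sum1_size natr_sum; rewrite big_seq [X in _ <= X]big_seq.
by apply: ler_sum => x /x1 xle; rewrite normrX exprn_ile1.
Qed.

End Growth.

Lemma divisor_sum_ge (l : nat -> nat) n : (0 < n)%N -> (n * l n <= divisor_sum l n)%N.
Proof.
by move=> n0; rewrite /divisor_sum big_mkcond big_nat_recr//= dvdnn leq_addl.
Qed.

(** There are at most [n] divisors [d], each at most [n], and [l d <= C * rho ^+ n] where [C]
    absorbs the finitely many small indices. Each of the two factors [n] costs [M * rho ^+ n] by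
    Bernoulli, whence the exponent 3. *)
Lemma divisor_sum_subexponential (l : nat -> nat) M : (0 < M)%N ->
  (exists n0, forall n, (n0 <= n)%N -> (l n * M ^ n <= M.+1 ^ n)%N) ->
  exists2 C : algC, 0 <= C & forall n, (divisor_sum l n)%:R <= C * ((1 + M%:R^-1) ^+ 3) ^+ n.
Proof.
move=> M0 [n0 ln].
pose rho : algC := 1 + M%:R^-1.
have rho1 : 1 <= rho by rewrite lerDl invr_ge0.
have rhoE : rho = M.+1%:R / M%:R.
  by rewrite -natr1 mulrDl divff ?mul1r// pnatr_eq0 -lt0n.
pose C : algC := 1 + (\sum_(n < n0) l n)%:R.
have C0 : 0 <= C by rewrite addr_ge0.
have lC n : (l n)%:R <= C * rho ^+ n.
  have rn1 : 1 <= rho ^+ n by exact: exprn_ege1.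
  have [nn0|nn0] := leqP n0 n.
    apply: (@le_trans _ _ (rho ^+ n)); last first.
      by rewrite ler_peMl ?(le_trans ler01)// lerDl.
    rewrite rhoE expr_div_n ler_pdivlMr ?exprn_gt0 ?ltr0n//.
    by rewrite -!natrX -natrM ler_nat ln.
  apply: (@le_trans _ _ C); last by rewrite ler_peMr.
  rewrite (@le_trans _ _ (\sum_(n < n0) l n)%:R)// ?lerDr// ler_nat.
  by rewrite (bigD1 (Ordinal nn0))//= leq_addr.
have nrho n : n%:R <= M%:R * rho ^+ n.
  rewrite mulrC -ler_pdivrMr ?ltr0n//.
  apply: le_trans (bernoulli n _); last by rewrite invr_ge0.
  by rewrite lerDr.
exists (M%:R * M%:R * C) => [|n]; first by rewrite !mulr_ge0.
apply: (@le_trans _ _ (n%:R * (n%:R * (C * rho ^+ n)))).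
  rewrite /divisor_sum natr_sum.
  apply: (@le_trans _ _ (\sum_(1 <= d < n.+1) n%:R * (C * rho ^+ n))); last first.
    by rewrite sumr_const_nat subn1 /= [X in _ <= X]mulr_natl.
  rewrite big_mkcond /=; rewrite !big_nat; apply: ler_sum => d /andP[_ dn].
  case: ifP => _; last by rewrite !mulr_ge0// exprn_ge0// (le_trans ler01).
  rewrite natrM ler_pM//; first by rewrite ler_nat.
  apply: le_trans (lC d) _; rewrite ler_wpM2l//; exact: ler_weXn2l.
have r0 k : 0 <= rho ^+ k by rewrite exprn_ge0// (le_trans ler01).
rewrite exprAC -/rho.
have -> : M%:R * M%:R * C * (rho ^+ n) ^+ 3 =
  (M%:R * rho ^+ n) * ((M%:R * rho ^+ n) * (C * rho ^+ n)) by ring.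
rewrite ler_pM ?mulr_ge0//; apply: ler_pM => //; exact: mulr_ge0.
Qed.

Theorem eventually_zero_of_polynomial_inverse (u l : nat -> nat) (p : {poly int}) :
  u 0 = 1%N ->
  (forall n, (n * u n = \sum_(1 <= k < n.+1) divisor_sum l k * u (n - k))%N) ->
  (forall n, \sum_(i < n.+1) p`_i * (u (n - i)%N)%:Z = (n == 0%N)%:R) ->
  (forall M, (0 < M)%N ->
     exists n0, forall n, (n0 <= n)%N -> (l n * M ^ n <= M.+1 ^ n)%N) ->
  exists D, forall n, (D < n)%N -> l n = 0%N.
Proof.
move=> u0 u_rec pu sub; have [r rE] := divisor_sum_power_sum u0 u_rec pu.
have r1 : forall x, x \in r -> `|x| <= 1.
  apply: power_sum_subexponential => M M0.
  have [C C0 CP] := divisor_sum_subexponential M0 (sub M M0).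
  (* The identity with divisor sums holds only for positive exponents; the power sum of exponent 0
     is [size r], hence the extra constant. *)
  exists (C + (size r)%:R) => -[|n].
    rewrite expr0 mulr1 (eq_bigr (fun=> 1)) => [|y _]; last by rewrite expr0.
    by rewrite big_const_seq count_predT iter_addr_0 normr_nat lerDr.
  rewrite -rE// normr_nat; apply: le_trans (CP n.+1) _.
  rewrite ler_wpM2r ?lerDl// exprn_ge0// exprn_ge0// addr_ge0// invr_ge0//.
exists (size r) => n rn; have n0 : (0 < n)%N by apply: leq_ltn_trans rn.
have := power_sum_bound n r1; rewrite -rE// normr_nat ler_nat => dr.
have := leq_trans (divisor_sum_ge l n0) dr; case: (l n) => // k.
by rewrite mulnS leqNgt (leq_trans rn)// leq_addr.
Qed.

(** * Homogeneous bases *)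

Section GradedBasis.
Context (F : fieldType) (L : lieAlgType F) (gr : nat -> set L).
Hypothesis gr_grading : is_grading gr.

(** [is_grading] leaves [gr 0] arbitrary. Putting zero there gives components indexed by all natural
    numbers and a plain convolution formula for brackets. *)
Definition gr0 (n : nat) : set L := if n == 0%N then [set 0] else gr n.

Lemma gr0_subspace n : is_subspace (gr0 n).
Proof.
rewrite /gr0; case: n => [|n] /=; first exact: is_subspace_set0.
exact: grading_subspace.
Qed.

Lemma gr0_bracket m n x y : gr0 m x -> gr0 n y -> gr0 (m + n) (bracket x y).
Proof.
have b0 (z : L) : bracket 0 z = 0 by exact: linear_fun0 (bracket_linearl z).
have br0 (z : L) : bracket z 0 = 0 by exact: linear_fun0 (bracket_linearr z).
rewrite /gr0; case: m n => [|m] [|n] /=.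
- by move=> -> ->; rewrite b0.
- by move=> -> yn; rewrite b0; exact: (subspace0 (gr0_subspace n.+1)).
- by move=> xm ->; rewrite br0 addn0; exact: (subspace0 (gr0_subspace m.+1)).
- exact: (grading_bracket gr_grading).
Qed.

Definition decomp (x : L) (v : nat -> L) := (forall k, gr0 k (v k)) /\
  exists N, (forall k, (N <= k)%N -> v k = 0) /\ x = \sum_(k < N) v k.

Lemma decomp_exists x : exists v, decomp x v.
Proof.
have [N [v [gv ->]]] := grading_sum gr_grading x.
exists (fun k => if (0 < k < N)%N then v k else 0); split=> [k|].
  case: ifP => [/andP[k0 _]|_]; last exact: (subspace0 (gr0_subspace k)).
  by rewrite /gr0 gtn_eqF//; exact: gv.
exists N; split=> [k Nk|]; first by rewrite [(k < N)%N]ltnNge Nk andbF.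
rewrite -(big_mkord predT (fun k => if (0 < k < N)%N then v k else 0)).
case: N gv => [|N] gv; first by rewrite !big_geq.
rewrite [RHS]big_ltn//= add0r; apply: eq_big_nat => k kN.
by rewrite kN.
Qed.

Lemma decomp_ge x v : decomp x v -> exists N, forall M, (N <= M)%N ->
  (forall k, (M <= k)%N -> v k = 0) /\ x = \sum_(k < M) v k.
Proof.
move=> [_ [N [v0 ->]]]; exists N => M NM; split.
  by move=> k Mk; apply: v0; exact: leq_trans Mk.
rewrite -(big_mkord predT v) -(big_mkord predT v) [RHS](big_cat_nat (n := N))//=.
by rewrite [X in _ = _ + X]big_nat_cond [X in _ = _ + X]big1 ?addr0// => k /andP[/andP[/v0]].
Qed.

Lemma decomp0_uniq v : decomp 0 v -> forall k, v k = 0.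
Proof.
move=> [gv [N [v0 /esym vs]]] k.
have [Nk|kN] := leqP N k; first exact: v0.
have v00 : v 0 = 0 by exact: gv 0.
case: k kN => // k kN.
apply: (grading_direct gr_grading (n := N) (v := v)) => //.
  by case=> // j _; exact: gv j.+1.
case: N kN vs {v0} => // N kN; rewrite -(big_mkord predT v) big_ltn// v00 add0r.
by [].
Qed.

Lemma decomp_lin a x y v w : decomp x v -> decomp y w ->
  decomp (a *: x + y) (fun k => a *: v k + w k).
Proof.
move=> dv dw; have [N NP] := decomp_ge dv; have [M MP] := decomp_ge dw.
split=> [k|]; first exact: ((gr0_subspace k).2 _ _ _ (dv.1 k) (dw.1 k)).
exists (maxn N M); have [v0 {1}->] := NP _ (leq_maxl N M).
have [w0 {1}->] := MP _ (leq_maxr N M); split=> [k kk|].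
  by rewrite v0// w0// scaler0 addr0.
by rewrite scaler_sumr -big_split.
Qed.

Lemma decomp_uniq x v w : decomp x v -> decomp x w -> v = w.
Proof.
move=> dv dw; apply/funext => k; apply/eqP; rewrite -subr_eq0 -scaleN1r addrC; apply/eqP.
have := decomp_lin (-1) dw dv.
have -> : -1 *: x + x = 0 by rewrite scaleN1r addNr.
by move=> /decomp0_uniq/(_ k).
Qed.

Definition comp x := sval (cid (decomp_exists x)).

Lemma compP x : decomp x (comp x).
Proof. exact: svalP (cid (decomp_exists x)). Qed.

Lemma comp_gr x k : gr0 k (comp x k).
Proof. exact: (compP x).1. Qed.

Lemma comp_eq x v : decomp x v -> comp x = v.
Proof. by apply: decomp_uniq; exact: compP. Qed.

Lemma comp_linear n : linear (comp^~ n).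
Proof. by move=> a x y; rewrite (comp_eq (decomp_lin a (compP x) (compP y))). Qed.

Lemma comp_homog n x k : gr0 n x -> comp x k = if k == n then x else 0.
Proof.
move=> xn; rewrite (@comp_eq x (fun k => if k == n then x else 0))//; split=> [j|].
  by case: eqP => [->|_] //; exact: (subspace0 (gr0_subspace j)).
exists n.+1; split=> [j nj|]; first by rewrite gtn_eqF.
rewrite (bigD1 ord_max)//= eqxx big1 ?addr0// => i.
by rewrite -val_eqE /= => /negPf ->.
Qed.

Lemma bracket_suml (J : Type) (r : seq J) (P : pred J) (f : J -> L) y :
  bracket (\sum_(j <- r | P j) f j) y = \sum_(j <- r | P j) bracket (f j) y.
Proof. exact: (linear_fun_sum (f := bracket^~ y) (bracket_linearl y)). Qed.

Lemma bracket_sumr (J : Type) (r : seq J) (P : pred J) (f : J -> L) x :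
  bracket x (\sum_(j <- r | P j) f j) = \sum_(j <- r | P j) bracket x (f j).
Proof. exact: (linear_fun_sum (f := bracket x) (bracket_linearr x)). Qed.

Lemma comp_bracket x y n :
  comp (bracket x y) n = \sum_(i < n.+1) bracket (comp x i) (comp y (n - i)%N).
Proof.
have [N NP] := decomp_ge (compP x); have [M MP] := decomp_ge (compP y).
have [x0 xE] := NP _ (leqnn _); have [y0 yE] := MP _ (leqnn _).
have b0 (z : L) : bracket 0 z = 0 by exact: linear_fun0 (bracket_linearl z).
have br0 (z : L) : bracket z 0 = 0 by exact: linear_fun0 (bracket_linearr z).
rewrite {1}xE bracket_suml (linear_fun_sum (comp_linear n)).
have e (i : nat) : comp (bracket (comp x i) y) n =
    if (i <= n)%N then bracket (comp x i) (comp y (n - i)%N) else 0.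
  rewrite {1}yE bracket_sumr (linear_fun_sum (comp_linear n)).
  rewrite (eq_bigr (fun j : 'I_M => if (n == i + j)%N then bracket (comp x i) (comp y j) else 0)).
    case: leqP => ni; last first.
      by rewrite big1// => j _; rewrite ltn_eqF// (leq_trans ni)// leq_addr.
    have [nM|Mn] := ltnP (n - i) M.
      rewrite (bigD1 (Ordinal nM))//= subnKC// eqxx big1 ?addr0// => j.
      rewrite -val_eqE /= => ji; rewrite ifF//; apply: contraNF ji => /eqP ->.
      by rewrite addKn.
    rewrite y0// br0 big1// => j _; rewrite ifF//; apply/eqP => nij.
    by move: Mn; rewrite nij addKn leqNgt ltn_ord.
  by move=> j _; apply: comp_homog; apply: gr0_bracket; exact: comp_gr.
under eq_bigr do rewrite e.
pose f (i : nat) := if (i <= n)%N then bracket (comp x i) (comp y (n - i)%N) else 0.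
have fE K : (N <= K)%N -> \sum_(i < N) f i = \sum_(i < K) f i.
  move=> NK; rewrite -(big_mkord predT f) -(big_mkord predT f) [RHS](big_cat_nat (n := N))//=.
  rewrite [X in _ = _ + X]big_nat_cond [X in _ = _ + X]big1 ?addr0// => k /andP[/andP[Nk _] _].
  by rewrite /f x0// b0 if_same.
have fE' K : (n < K)%N -> \sum_(i < n.+1) f i = \sum_(i < K) f i.
  move=> NK; rewrite -(big_mkord predT f) -(big_mkord predT f) [RHS](big_cat_nat (n := n.+1))//=.
  rewrite [X in _ = _ + X]big_nat_cond [X in _ = _ + X]big1 ?addr0// => k /andP[/andP[Nk _] _].
  by rewrite /f leqNgt Nk.
rewrite [LHS](fE (maxn N n.+1)) ?leq_maxl// -(fE' (maxn N n.+1)) ?leq_maxr//.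
by apply: eq_bigr => i _; rewrite /f -ltnS ltn_ord.
Qed.

Section FiniteDimensional.
Context (s : seq L).
Hypothesis s_gen : smallest (@is_lie_subalgebra F L) [set` s] = setT.

(* The recursion spans degree [n] because a bracket of degree [n] has both
   arguments of degree less than [n]. *)
Fixpoint brackets n : seq L :=
  if n is n'.+1 then
    brackets n' ++ [seq comp x k | x <- s, k <- iota 0 n.+1]
    ++ [seq bracket x y | x <- brackets n', y <- brackets n']
  else [::].

Lemma brackets_mono m n : (m <= n)%N ->
  lspan [set` brackets m] `<=` lspan [set` brackets n].
Proof.
move=> mn; apply: lspan_mono => x /=; elim: n mn => [|n IHn].
  by rewrite leqn0 => /eqP ->.
rewrite leq_eqVlt => /predU1P[->//|]; rewrite ltnS => /IHn{}IHn /IHn xn.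
by rewrite /= mem_cat xn.
Qed.

Lemma bracket_lspan n x y : lspan [set` brackets n] x -> lspan [set` brackets n] y ->
  lspan [set` brackets n.+1] (bracket x y).
Proof.
have sB := @lspan_subspace F L [set` brackets n.+1].
move=> + yn; apply: (lspan_min (W := [set x | lspan [set` brackets n.+1] (bracket x y)])).
  split=> [|a u v /= ? ?] /=; last by rewrite (bracket_linearl y a); exact: sB.2.
  by rewrite (linear_fun0 (bracket_linearl y)); exact: sB.1.
move=> x' /= x'n; move: y yn.
apply: (lspan_min (W := [set y | lspan [set` brackets n.+1] (bracket x' y)])).
  split=> [|a u v /= ? ?] /=; last by rewrite (bracket_linearr x' a); exact: sB.2.
  by rewrite (linear_fun0 (bracket_linearr x')); exact: sB.1.
move=> y' /= y'n; apply: sub_lspan => /=.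
by rewrite !mem_cat (allpairs_f (fun x y => bracket x y) x'n y'n) !orbT.
Qed.

(** The elements all of whose components lie in these spans form a Lie subalgebra: in the
    convolution for a bracket the two end terms vanish, and the others have both factors in smaller
    degree. The generators need not be homogeneous, so all their components are put into
    [brackets]. *)
Lemma comp_lspan x n : lspan [set` brackets n] (comp x n).
Proof.
have sB k := @lspan_subspace F L [set` brackets k].
have c0 z : comp z 0 = 0 by exact: comp_gr z 0%N.
have : setT x by []; rewrite -s_gen.
move=> /(_ [set x | forall n, lspan [set` brackets n] (comp x n)]); apply; split.
  split; first split=> [k|a y z /= yP zP k].
  - by rewrite (linear_fun0 (comp_linear k)); exact: (sB k).1.
  - by rewrite (comp_linear k a); exact: (sB k).2.
  - move=> y z /= yP zP k; rewrite comp_bracket.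
    apply: subspace_sum => // -[i /= ik] _.
    case: i ik => [|i] ik.
      by rewrite c0 (linear_fun0 (f := bracket^~ _) (bracket_linearl _)); exact: (sB _).1.
    case: k ik => [|k] ik; first by [].
    move: ik; rewrite ltnS leq_eqVlt => /predU1P[->|ik].
      by rewrite subnn c0 (linear_fun0 (f := bracket _) (bracket_linearr _)); exact: (sB _).1.
    apply: bracket_lspan; first by apply: (brackets_mono (m := i.+1)) => //; exact: yP.
    by apply: (brackets_mono (m := (k.+1 - i.+1)%N)); [rewrite subSS leq_subr|exact: zP].
move=> y /= ys [|k]; first by rewrite c0; exact: (sB _).1.
have ks : k.+1 \in iota 0 k.+2 by rewrite mem_iota add0n ltnSn.
apply: sub_lspan.
have -> : brackets k.+1 = brackets k ++ [seq comp x j | x <- s, j <- iota 0 k.+2]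
    ++ [seq bracket x y | x <- brackets k, y <- brackets k] by [].
by rewrite /= !mem_cat (allpairs_f (fun x j => comp x j) ys ks) orbT.
Qed.

Lemma gr0_fdim n : exists l, fdim (gr0 n) l.
Proof.
apply: (fdim_seq (s := brackets n)) => x xn.
by have := @comp_lspan x n; rewrite (comp_homog _ xn) eqxx.
Qed.

End FiniteDimensional.

Section Basis.
Context (l : nat -> nat).
Hypothesis l_dim : forall n, fdim (gr0 n) (l n).

Let e n : 'I_(l n) -> L := sval (cid (l_dim n)).

Let eP n : [/\ forall j, gr0 n (@e n j), independent_mod [set 0] (@e n) &
    forall x, gr0 n x -> exists c : 'I_(l n) -> F, x = \sum_j c j *: @e n j].
Proof. exact: svalP (cid (l_dim n)). Qed.

Definition basis_index : countType := {n : nat & 'I_(l n)}.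

Definition basis_mk n (j : 'I_(l n)) : basis_index := Tagged (fun n => 'I_(l n)) j.

Definition basis (i : basis_index) : L := @e (tag i) (tagged i).

Lemma basis_gr i : gr0 (tag i) (basis i).
Proof. by case: i => n j; have [eg _ _] := eP n; exact: eg. Qed.

Lemma basis_index_gt0 (i : basis_index) : (0 < tag i)%N.
Proof.
case: i => -[|n] j //=; exfalso.
have l0 : l 0 = 0%N by apply: fdim_uniq (l_dim 0) _; exact: fdim0.
by move: j; rewrite l0; case.
Qed.

(** Serves twice: independence within one degree gives injectivity of the coordinate map, and
    applied to a bracket of basis elements it shows that the structure constants are homogeneous. *)
Lemma comp_mlin (g : malg basis_index F) n :
  comp (mlin basis g) n = \sum_(j < l n) mcoeff (basis_mk j) g *: @e n j.
Proof.
pose f1 (g : malg basis_index F) := comp (mlin basis g) n.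
have f1l : linear f1 by move=> a x y; rewrite /f1 linearP (comp_linear n a).
pose f1' : {linear malg basis_index F -> L} := HB.pack f1 (GRing.isLinear.Build F _ _ *:%R f1 f1l).
pose f2 (g : malg basis_index F) := \sum_(j < l n) mcoeff (basis_mk j) g *: @e n j.
have f2l : linear f2.
  move=> a x y; rewrite /f2 scaler_sumr -big_split; apply: eq_bigr => j _ /=.
  by rewrite mcoeffD mcoeffZ scalerDl scalerA.
pose f2' : {linear malg basis_index F -> L} := HB.pack f2 (GRing.isLinear.Build F _ _ *:%R f2 f2l).
apply: (@malg_linear_ext _ _ _ f1' f2') => -[k i] _ /=.
rewrite /f1 /f2 mlinU (comp_homog _ (basis_gr _)) /=.
case: eqP => [nk|nk]; last first.
  rewrite big1// => j _; rewrite mcoeffU; case: eqP => [/(congr1 tag)/= kn|_].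
    by case: nk.
  by rewrite scale0r.
case: k / nk i => i; rewrite (bigD1 i)//= mcoeffUU scale1r big1 ?addr0// => j ji.
rewrite mcoeffU; case: eqP => [/eqP|_]; last by rewrite scale0r.
by rewrite eq_Tagged /= eq_sym (negPf ji).
Qed.

Lemma mlin_basis_inj : injective (mlin basis).
Proof.
move=> g h gh; apply/malgP => -[n j].
have [_ ie _] := eP n.
apply/eqP; rewrite -subr_eq0 -mcoeffB; apply/eqP.
apply: (ie (fun j => mcoeff (basis_mk j) (g - h))) => /=.
by rewrite -comp_mlin linearB /= gh subrr (linear_fun0 (comp_linear n)).
Qed.

Lemma mlin_basis_surj x : exists g, mlin basis g = x.
Proof.
pose Im : set L := [set y | exists g, mlin basis g = y].
have sIm : is_subspace Im.
  split=> [|a y z [g <-] [h <-]]; first by exists 0; rewrite linear0.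
  by exists (a *: g + h); rewrite linearP.
have [_ [N [_ ->]]] := compP x.
apply: (subspace_sum (W := Im)) => // k _.
have [_ _ gen] := eP k; have [c ->] := gen _ (comp_gr x k).
apply: (subspace_sum (W := Im)) => // j _; apply: subspaceZ => //.
by exists (mkmalgU (basis_mk j) 1); rewrite mlinU.
Qed.

Definition coords (x : L) : malg basis_index F := sval (cid (mlin_basis_surj x)).

Lemma coordsK x : mlin basis (coords x) = x.
Proof. exact: svalP (cid (mlin_basis_surj x)). Qed.

Lemma coords_linear : linear coords.
Proof. by move=> a x y; apply: mlin_basis_inj; rewrite linearP /= !coordsK. Qed.
HB.instance Definition _ := GRing.isLinear.Build F L (malg basis_index F) *:%R coords coords_linear.

Lemma coords_basis i : coords (basis i) = mkmalgU i 1.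
Proof. by apply: mlin_basis_inj; rewrite coordsK mlinU. Qed.

Lemma coords_bracket i j k :
  k \in msupp (coords (bracket (basis i) (basis j))) -> tag k = (tag i + tag j)%N.
Proof.
have := comp_mlin (coords (bracket (basis i) (basis j))) (tag k).
rewrite coordsK (comp_homog _ (gr0_bracket (basis_gr i) (basis_gr j))).
case: eqP => // _ /esym c0; rewrite -mcoeff_neq0 => /eqP; case.
have [_ ie _] := eP (tag k).
by case: k c0 ie => n h c0 ie; exact: (ie _ c0 h).
Qed.

Definition basis_of_degree n : seq basis_index := [seq basis_mk j | j <- enum 'I_(l n)].

Lemma mem_basis_of_degree n i : (i \in basis_of_degree n) = (tag i == n).
Proof.
apply/mapP/eqP => [[j _ ->]//|]; case: i => k j /= kn.
by case: n / kn; exists j; rewrite ?mem_enum.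
Qed.

Lemma uniq_basis_of_degree n : uniq (basis_of_degree n).
Proof.
rewrite map_inj_uniq ?enum_uniq// => i j /eqP.
by rewrite eq_Tagged /= => /eqP.
Qed.

Lemma size_basis_of_degree n : size (basis_of_degree n) = l n.
Proof. by rewrite size_map size_enum_ord. Qed.

End Basis.
End GradedBasis.

(** * Entropy 1 and the growth of dimensions *)

Section Entropy.
Context (R : realType) (l : nat -> nat) (v : nat -> \bar R).
Hypothesis vE : forall n, (0 < n)%N -> v n = (l n)%:R%:E.
Hypothesis v_entropy : limn_esup (fun n => poweR (v n) n%:R^-1) = 1%E.

(** The rate [1 + 1/M = (M + 1)/M] is cleared of denominators, so the bound concerns natural numbers
    and passes from [R] to [algC], where the roots live. *)
Lemma limn_esup1_subexponential M : (0 < M)%N ->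
  exists n0, forall n, (n0 <= n)%N -> (l n * M ^ n <= M.+1 ^ n)%N.
Proof.
move=> M0; pose rho : R := 1 + M%:R^-1.
have M0' : (0 : R) < M%:R by rewrite ltr0n.
have rho1 : 1 < rho by rewrite ltrDl invr_gt0.
have rhoE : rho = M.+1%:R / M%:R.
  by rewrite -natr1 mulrDl divff ?gt_eqF// mul1r.
have : (limn_esup (fun n => poweR (v n) n%:R^-1) < rho%:E)%E by rewrite v_entropy lte_fin.
move=> /ereal_inf_lt[_ [V [n0 _ n0V] <-] supV].
exists n0.+1 => n n0n; have n0' : (0 < n)%N by exact: leq_trans n0n.
have : (poweR (v n) n%:R^-1 < rho%:E)%E.
  apply: le_lt_trans supV; apply: ereal_sup_ubound; exists n => //.
  by apply: n0V => /=; exact: ltnW.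
rewrite vE// poweR_EFin lte_fin => lt_rho.
have : ((l n)%:R : R) <= rho ^+ n.
  have -> : ((l n)%:R : R) = ((l n)%:R `^ n%:R^-1) ^+ n.
    rewrite -powR_mulrn ?powR_ge0// -powRrM mulVf ?powRr1 ?ler0n//.
    by rewrite pnatr_eq0 -lt0n.
  by apply: lerXn2r; rewrite ?nnegrE ?powR_ge0// ltW// (lt_trans ltr01).
rewrite rhoE expr_div_n ler_pdivlMr ?exprn_gt0//.
by rewrite -!natrX -natrM ler_nat.
Qed.

(** Late terms would be 0 raised to the nonzero power [1/n], that is 0, and the upper limit could
    not exceed 0. *)
Lemma limn_esup1_not_eventually_zero : ~ exists D, forall n, (D < n)%N -> l n = 0%N.
Proof.
move=> [D lD].
have : (limn_esup (fun n => poweR (v n) n%:R^-1) <= 0)%E.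
  apply: (@le_trans _ _ (ereal_sup ((fun n => poweR (v n) n%:R^-1) @` [set n | (D < n)%N]))).
    apply: ereal_inf_lbound; exists [set n | (D < n)%N] => //.
    exact: nbhs_infty_ge D.+1.
  apply: ub_ereal_sup => _ [n /= Dn <-].
  have n0 : (0 < n)%N by exact: leq_ltn_trans Dn.
  rewrite vE// lD// poweR_EFin lee_fin powR0// invr_eq0 pnatr_eq0.
  by rewrite -lt0n.
by rewrite v_entropy lee_fin ler10.
Qed.

End Entropy.

Theorem corollaryB (R : realType) (F : fieldType) (L : lieAlgType F)
    (gr : nat -> set L) (gr_grading : is_grading gr)
    (L_fg : finitely_generated L) (L_gen1 : generated_in_degree1 gr)
    (L_entropy : entropy R gr = 1%E) :
  cd L R = +oo%E \/
  exists2 k, (2 <= k)%N & cohomology_dim L R k = +oo%E.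
Proof.
apply: contrapT => /not_orP[cd_fin coh_fin].
have [n ext0] : exists n, forall M : lmodType (uea L), Ext_eq0 (trivial_module L) M n.+1.
  apply: contra_notP cd_fin => /forallNP no.
  (* With no admissible [n], [cd] is the infimum of the empty set. *)
  rewrite /cd [X in ereal_inf X](_ : _ = set0) ?ereal_inf0//.
  by apply/seteqP; split=> // x [n nE _]; exact: (no n nE).
have coh k : (2 <= k)%N -> cohomology_dim L R k != +oo%E.
  by move=> k2; apply/eqP => e; apply: coh_fin; exists k.
have [s sgen] := L_fg.
have [l l_dim] := choice (gr0_fdim gr_grading sgen).
pose deg (i : basis_index l) := tag i.
pose Idx := @basis_of_degree l.
have deg0 (i : basis_index l) : (0 < deg i)%N := basis_index_gt0 l_dim i.
have mIdx m (i : basis_index l) : (i \in Idx m) = (deg i == m) := mem_basis_of_degree m i.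
have H := uea_connected_grading (coordsK gr_grading l_dim) (coords_basis gr_grading l_dim)
  (@coords_bracket _ _ _ gr_grading _ l_dim) deg0 mIdx.
(* Finite cohomological dimension enters here, with the trivial module as coefficients. *)
have [p pE] := finite_resolution_poly H L_fg coh (ext0 _).
have lE m : (0 < m)%N -> subspace_dim R (gr m) = (l m)%:R%:E.
  by move=> m0; apply: subspace_dim_fdim; have := l_dim m; rewrite /gr0 gtn_eqF.
apply: (limn_esup1_not_eventually_zero lE L_entropy).
apply: (eventually_zero_of_polynomial_inverse (pbw_dim0 deg0 mIdx)
  (pbw_dim_rec deg0 mIdx (@uniq_basis_of_degree l) (@size_basis_of_degree l)) pE).
exact: limn_esup1_subexponential lE L_entropy.
Qed.
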